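(* Let $\mu$ be an admissible even Borel probability measure on $\mathbb{R}$ that satisfies the $\Lambda^{\ast}$-condition. Then, for any $\delta\in\left(0,\tfrac{1}{2}\right)$, $$\lim_{n\to\infty}\varrho(\mu_n,\delta)=0,\qquad\text{where } \varrho(\mu_n,\delta):=\varrho_2(\mu_n,\delta)-\varrho_1(\mu_n,\delta).$$
   Context: Let $X$ be a random variable with distribution $\mu$. Write $x^{\ast}=\sup\{x\in\mathbb{R}:\mu([x,\infty))>0\}$ (possibly $+\infty$), $I=(-x^{\ast},x^{\ast})$, $\Lambda_\mu(t)=\ln\int_{\mathbb{R}} e^{tx}\,d\mu(x)$, and $\Lambda_\mu^{\ast}(x)=\sup_{t\in\mathbb{R}}\{tx-\Lambda_\mu(t)\}$ (Legendre transform). The measure $\mu$ is called admissible if: $\mathrm{Var}(X)>0$; there is $r>0$ with $\mathbb{E}e^{tX}<\infty$ for all $t\in(-r,r)$; if $x^{\ast}<\infty$ then $\mu(\{x^{\ast}\})=0$; and one of the following holds: (1) $x^{\ast}<\infty$, or (2) $x^{\ast}=+\infty$ and $\{\Lambda_\mu<\infty\}=\mathbb{R}$, or (3) $x^{\ast}=+\infty$, $\{\Lambda_\mu<\infty\}$ is bounded and $\mu$ is log-concave. The measure $\mu$ satisfies the $\Lambda^{\ast}$-condition if $\lim_{x\uparrow x^{\ast}}\frac{-\ln\mu([x,\infty))}{\Lambda_\mu^{\ast}(x)}=1$. Let $\mu_n=\mu^{\otimes n}$ on $\mathbb{R}^n$. For $N>n$ let $\vec X_1,\dots,\vec X_N$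 be independent random vectors in $\mathbb{R}^n$ each with distribution $\mu_n$ (joint law $\mu_n^N$), and $K_N=\mathrm{conv}\{\vec X_1,\dots,\vec X_N\}$. For $\delta\in(0,\tfrac12)$ define $\varrho_1(\mu_n,\delta)=\sup\{\varrho_1:\sup\{\mathbb{E}_{\mu_n^N}[\mu_n(K_N)]:N\le \exp(\varrho_1 n)\}\le\delta\}$ and $\varrho_2(\mu_n,\delta)=\inf\{\varrho_2:\inf\{\mathbb{E}_{\mu_n^N}[\mu_n(K_N)]:N\ge\exp(\varrho_2 n)\}\ge 1-\delta\}$. *)

(* Defs.v *)
From HB Require Import structures.
From mathcomp Require Import all_boot all_order all_algebra.
From mathcomp Require Import all_classical all_reals all_analysis.
Set Implicit Arguments. Unset Strict Implicit. Unset Printing Implicit Defensive.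
Import Order.TTheory GRing.Theory Num.Theory.
Import numFieldNormedType.Exports.
Local Open Scope classical_set_scope.
Local Open Scope ring_scope.

Section Defs.
Variables (R : realType) (mu : probability R R).

Definition xstar : \bar R :=
  ereal_sup [set x%:E | x in [set x : R | (0 < mu `[x, +oo[%classic)%E]].

Definition Lambda (t : R) : \bar R :=
  match (\int[mu]_x (expR (t * x))%:E)%E with
  | r%:E => (ln r)%:E
  | _ => +oo%E
  end.

Definition Lambda_star (x : R) : \bar R :=
  ereal_sup [set ((t * x)%:E - Lambda t)%E | t in [set: R]].

Definition mean : \bar R := (\int[mu]_x x%:E)%E.
Definition variance : \bar R := (\int[mu]_x ((x - fine mean) ^+ 2)%:E)%E.

Definition log_concave : Prop :=
  forall (A B : set R) (l : R), compact A -> compact B -> 0 < l < 1 ->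
    fine (mu A) `^ l * fine (mu B) `^ (1 - l)
      <= fine (mu [set l * a + (1 - l) * b | a in A & b in B]).

Definition admissible : Prop :=
  [/\ (0 < variance)%E,
      (exists2 r : R, 0 < r &
         forall t : R, - r < t < r -> (\int[mu]_x (expR (t * x))%:E < +oo)%E),
      (forall a : R, xstar = a%:E -> mu [set a] = 0%E) &
      [\/ (xstar < +oo)%E,
          xstar = +oo%E /\ (forall t : R, (Lambda t < +oo)%E) |
          [/\ xstar = +oo%E,
              (exists M : R, forall t : R, (Lambda t < +oo)%E -> `|t| <= M) &
              log_concave]]].

Definition even_measure : Prop :=
  forall A : set R, measurable A -> mu ((fun x => - x) @^-1` A) = mu A.

Definition Lambda_star_condition : Prop :=
  let f : R -> R := fun x : R => - ln (fine (mu `[x, +oo[%classic)) / fine (Lambda_star x) in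
  match xstar with
  | a%:E => f x @[x --> a^'-] --> (1 : R)
  | +oo%E => f x @[x --> +oo] --> (1 : R)
  | -oo%E => False
  end.

(** iterated integral with respect to mu in k real variables;
    the first integrated variable becomes coordinate 0 *)
Definition scons (x : R) (v : nat -> R) : nat -> R :=
  fun i => if i is i'.+1 then v i' else x.

Fixpoint iint (k : nat) (f : (nat -> R) -> \bar R) : \bar R :=
  match k with
  | 0 => f (fun _ => 0)
  | k'.+1 => (\int[mu]_x iint k' (fun v => f (scons x v)))%E
  end.

(** mu_n = mu^{\otimes n} on R^n = ('I_n -> R) *)
Definition mu_n (n : nat) (A : set ('I_n -> R)) : \bar R :=
  iint n (fun v => (\1_A (fun i : 'I_n => v i))%:E).

Definition hull (n N : nat) (X : 'I_N -> 'I_n -> R) : set ('I_n -> R) :=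
  [set y | exists l : 'I_N -> R, [/\ forall j, 0 <= l j,
       \sum_(j < N) l j = 1 &
       forall i, y i = \sum_(j < N) l j * X j i]].

(** E_{mu_n^N}[mu_n(K_N)], the N points being coordinate blocks of a
    vector of n*N iid mu-distributed coordinates *)
Definition Emu (n N : nat) : \bar R :=
  iint (n * N) (fun w => mu_n (hull (fun (j : 'I_N) (i : 'I_n) => w (j * n + i)%N))).

Definition rho1 (n : nat) (delta : R) : \bar R :=
  ereal_sup [set r%:E | r in [set r : R |
    (ereal_sup [set Emu n N | N in [set N : nat | (n < N)%N /\ (N%:R <= expR (r * n%:R))%R]]
      <= delta%:E)%E]].

Definition rho2 (n : nat) (delta : R) : \bar R :=
  ereal_inf [set r%:E | r in [set r : R |
    (ereal_inf [set Emu n N | N in [set N : nat | (n < N)%N /\ (expR (r * n%:R) <= N%:R)%R]]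
      >= (1 - delta)%:E)%E]].

End Defs.

(* Main.v *)
(* The expected measure of K_N passes from near 0 to near 1 while (ln N) / n
   crosses a window of width O(eps) around kappa = E[u(X)], where
   u(v) = s m(s) - ln E[e^{sX}], m(s) is the mean of the (discretised) law of X
   tilted by e^{sx}, and s = s(v) is the first point of a fine grid with m(s)
   slightly above |v|; u(v) is replaced by 0 for |v| > z0, where P(|X| > z0) is
   small.

   Few points.  If x lies in K_N then some X_j satisfies
   sum_i t(x_i) (X_{j,i} - x_i) >= 0, with t(v) the grid point preceding s(v)
   with the sign of v.  This has probability at most
   exp(- sum_i (t(x_i) x_i - ln E[e^{t(x_i) X}])), and for most x the sum
   is at least n (kappa - O(eps)).

   Many points.  If x is not in K_N, then Gordan's alternative provides a
   half-space {w : <a, w - x> >= 0} containing no X_j.  Every such half-space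
   has mass at least exp(- n (kappa + O(eps))): tilt coordinate i by s(x_i)
   in the direction of the sign of a_i if |x_i| <= z0, and ask
   that w_i be beyond x_i otherwise.  The latter costs - ln P(X >= |x_i|), whose
   expectation over {|X| > z0} is small because P(P(X >= |X'|) <= 2^-k)
   is at most 2^{1-k}, for X' an independent copy of X.  The slack in
   m(s(v)) > |v| allows a to be rounded to a grid of exp(O(n ln n)) directions,
   while the probability that a given half-space is missed by all X_j is doubly
   exponentially small.

   Admissibility ensures that a tilt with mean above z0 exists at which the
   moment generating function is finite.  When that function has a bounded
   domain, log-concavity bounds the tail from below by an exponential, so that
   the function explodes at the end of its domain. *)
Require Import Defs.
From HB Require Import structures.
From mathcomp Require Import all_boot all_order all_algebra.
From mathcomp Require Import all_classical all_reals all_analysis.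
From mathcomp Require Import measurable_realfun.
From mathcomp Require Import ring lra.
Import Order.TTheory GRing.Theory Num.Theory.
Import numFieldNormedType.Exports.
Set Implicit Arguments. Unset Strict Implicit. Unset Printing Implicit Defensive.
Local Open Scope classical_set_scope.
Local Open Scope ring_scope.

(** * Iterated integrals *)

(** Two constraints shape the argument. The measure of the hull of a sample is never handled
    directly: from above, its indicator is majorised by measurable functions; from below, a
    measurable error term is added that makes the sum at least 1. Both majorants are built from
    products over coordinates or over sample points, which factorise once the order of integration
    is exchanged. Moreover x changes with n, so every rate has to be uniform in the tilts and in the
    direction a: the Chernoff rates depend only on bounds of the variables, which is why the law is
    cut into finitely many cells of a bounded interval. The cells are symmetric about 0, so that a
    tilt and its mirror image have the same cost. Since the tilts stay in a fixed interval [0, T],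
    means close to [xstar] are out of reach; coordinates beyond z0 are rare enough to be paid for by
    tail probabilities instead. Finally the window is kept at positive rates, so that for large n
    there are integers N > n on both sides of it. *)

Section IteratedIntegral.
Variables (R : realType) (mu : probability R R).

(** The integral of a nonnegative function is a supremum over the simple functions below it, so
    monotonicity holds for arbitrary nonnegative functions, in particular for those built from
    convex hulls. *)
Lemma ge0_le_integralT (f g : R -> \bar R) : (forall x, (0 <= f x)%E) ->
  (forall x, (f x <= g x)%E) -> (\int[mu]_x f x <= \int[mu]_x g x)%E.
Proof.
move=> f0 fg; rewrite !ge0_integralTE//; last first.
  by move=> x; exact: le_trans (f0 x) (fg x).
apply: ge_ereal_sup => _ /= [h hf <-]; apply: ereal_sup_ubound; exists h => //= x.
exact: le_trans (hf x) (fg x).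
Qed.

Lemma iint_ge0 k (f : (nat -> R) -> \bar R) : (forall v, (0 <= f v)%E) ->
  (0 <= iint mu k f)%E.
Proof.
elim: k f => [|k IH] f f0 //=; apply: integral_ge0 => x _.
by apply: IH => v.
Qed.

Lemma le_iint k (f g : (nat -> R) -> \bar R) : (forall v, (0 <= f v)%E) ->
  (forall v, (f v <= g v)%E) -> (iint mu k f <= iint mu k g)%E.
Proof.
elim: k f g => [|k IH] f g f0 fg //=; apply: ge0_le_integralT => x.
  exact: iint_ge0.
exact: IH.
Qed.

Lemma eq_iint k (f g : (nat -> R) -> \bar R) : (forall v, f v = g v) ->
  iint mu k f = iint mu k g.
Proof. by move=> /funext ->. Qed.

Lemma iint_cst k (c : R) : iint mu k (fun _ => c%:E) = c%:E.
Proof.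
elim: k => //= k IH; rewrite (_ : (fun _ => _) = cst c%:E); last first.
  by apply/funext => x; rewrite IH.
by rewrite integral_cst//= [X in (_ * X)%E]probability_setT mule1.
Qed.

(* A function of countably many real variables is called measurable when
   substituting measurable functions for the variables always yields a
   measurable function; this avoids any sigma-algebra on [nat -> R]. *)
Definition seqmfun (F : (nat -> R) -> \bar R) :=
  forall d (S : measurableType d) (y : S -> nat -> R),
    (forall i, measurable_fun setT (fun s => y s i)) ->
    measurable_fun setT (fun s => F (y s)).

Definition seqmfun2 (F : (nat -> R) -> (nat -> R) -> \bar R) :=
  forall d (S : measurableType d) (x y : S -> nat -> R),
    (forall i, measurable_fun setT (fun s => x s i)) ->
    (forall i, measurable_fun setT (fun s => y s i)) ->
    measurable_fun setT (fun s => F (x s) (y s)).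

Lemma measurable_scons d (S : measurableType d) (a : S -> R) (y : S -> nat -> R) :
  measurable_fun setT a -> (forall i, measurable_fun setT (fun s => y s i)) ->
  forall i, measurable_fun setT (fun s => scons (a s) (y s) i).
Proof. by move=> ma my; case=> [|i]; [exact: ma | exact: my]. Qed.

(** Tonelli, by induction on [k] with the parameter space enlarged from [S] to [S * R]: the
    outermost integration variable moves to the head of the parameter sequence. *)
Lemma seqmfun2_iint k (F : (nat -> R) -> (nat -> R) -> \bar R) :
  (forall w v, (0 <= F w v)%E) -> seqmfun2 F -> seqmfun (fun w => iint mu k (F w)).
Proof.
elim: k F => [|k IH] F F0 mF d S x mx /=; first by apply: mF.
pose F' (w v : nat -> R) := F (fun i => w i.+1) (scons (w 0%N) v).
have mF' : seqmfun2 F'.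
  move=> d1 S1 x1 y1 mx1 my1; apply: mF => [i|]; first exact: mx1.
  by apply: measurable_scons.
have F'0 w v : (0 <= F' w v)%E by exact: F0.
pose G (p : S * R) := iint mu k (F' (scons p.2 (x p.1))).
have mG : measurable_fun setT G.
  apply: (IH F' F'0 mF' _ _ (fun p : S * R => scons p.2 (x p.1))) => i.
  apply: (@measurable_scons _ (S * R)%type (fun p : S * R => p.2) (fun p => x p.1)).
    exact: measurable_snd.
  by move=> j; exact: (measurableT_comp (mx j) measurable_fst).
exact: (measurable_fun_fubini_tonelli_F (m2 := mu) G mG (fun p => iint_ge0 _ (F'0 _))).
Qed.

Lemma seqmfun_scons F a : seqmfun F -> seqmfun (fun v => F (scons a v)).
Proof. by move=> mF d S y my; apply: mF; exact: measurable_scons. Qed.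

Lemma seqmfun2_scons1 F a : seqmfun2 F -> seqmfun2 (fun w v => F (scons a w) v).
Proof. by move=> mF d S x y mx my; apply: mF => //; exact: measurable_scons. Qed.

Lemma seqmfun_iint_scons k F : (forall v, (0 <= F v)%E) -> seqmfun F ->
  measurable_fun setT (fun x => iint mu k (fun v => F (scons x v))).
Proof.
move=> F0 mF.
apply: (@seqmfun2_iint k (fun w v => F (scons (w 0%N) v)) _ _ _ R (fun x _ => x)) => //.
by move=> d S x y mx my; apply: mF; exact: measurable_scons.
Qed.

Lemma iintD k F G : (forall v, (0 <= F v)%E) -> (forall v, (0 <= G v)%E) ->
  seqmfun F -> seqmfun G ->
  iint mu k (fun v => F v + G v)%E = (iint mu k F + iint mu k G)%E.
Proof.
elim: k F G => [|k IH] F G F0 G0 mF mG //=.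
transitivity (\int[mu]_x (iint mu k (fun v => F (scons x v)) +
                          iint mu k (fun v => G (scons x v))))%E.
  by apply: eq_integral => x _; rewrite IH//; exact: seqmfun_scons.
rewrite ge0_integralD//.
- by move=> x _; exact: iint_ge0.
- exact: seqmfun_iint_scons.
- by move=> x _; exact: iint_ge0.
- exact: seqmfun_iint_scons.
Qed.

Lemma iint_sum k (I : Type) (s : seq I) F : (forall i v, (0 <= F i v)%E) ->
  (forall i, seqmfun (F i)) ->
  iint mu k (fun v => \sum_(i <- s) F i v)%E = (\sum_(i <- s) iint mu k (F i))%E.
Proof.
move=> F0 mF; elim: s => [|i s IH].
  by rewrite big_nil (@eq_iint k _ (fun=> 0%E)) ?iint_cst// => v; rewrite big_nil.
rewrite big_cons -IH -iintD//.
- by apply: eq_iint => v; rewrite big_cons.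
- by move=> v; apply: sume_ge0.
- by move=> d S y my; apply: emeasurable_sum => j; exact: mF.
Qed.

Lemma iintZ k (c : R) F : 0 <= c -> (forall v, (0 <= F v)%E) -> seqmfun F ->
  iint mu k (fun v => c%:E * F v)%E = (c%:E * iint mu k F)%E.
Proof.
move=> c0; elim: k F => [|k IH] F F0 mF //=.
transitivity (\int[mu]_x (c%:E * iint mu k (fun v => F (scons x v))))%E.
  by apply: eq_integral => x _; rewrite IH//; exact: seqmfun_scons.
rewrite ge0_integralZl//; first exact: seqmfun_iint_scons.
by move=> x _; exact: iint_ge0.
Qed.

Lemma integral_iint_swap k (G : R -> (nat -> R) -> \bar R) :
  (forall a v, (0 <= G a v)%E) ->
  (forall d (S : measurableType d) (a : S -> R) (y : S -> nat -> R),
    measurable_fun setT a -> (forall i, measurable_fun setT (fun s => y s i)) ->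
    measurable_fun setT (fun s => G (a s) (y s))) ->
  (\int[mu]_a iint mu k (G a) = iint mu k (fun v => \int[mu]_a G a v))%E.
Proof.
elim: k G => [|k IH] G G0 mG //=.
pose f (p : R * R) := iint mu k (fun v => G p.1 (scons p.2 v)).
have mf : measurable_fun setT f.
  pose F (w v : nat -> R) := G (w 0%N) (scons (w 1%N) v).
  have mF : seqmfun2 F.
    by move=> d S x y mx my; apply: mG => //; exact: measurable_scons.
  apply: (@seqmfun2_iint k F (fun w v => G0 _ _) mF _ (R * R)%type
    (fun p => scons p.1 (fun=> p.2))).
  apply: (@measurable_scons _ (R * R)%type (fun p => p.1) (fun p => fun=> p.2)).
    exact: measurable_fst.
  by move=> j; exact: measurable_snd.
rewrite (fubini_tonelli f mf); last by move=> p; exact: iint_ge0.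
apply: eq_integral => b _; rewrite -IH//.
by move=> d S a y ma my; apply: mG => //; exact: measurable_scons.
Qed.

Lemma iint_swap m k F : (forall w v, (0 <= F w v)%E) -> seqmfun2 F ->
  iint mu m (fun w => iint mu k (F w)) = iint mu k (fun v => iint mu m (F^~ v)).
Proof.
elim: m F => [|m IH] F F0 mF //=.
transitivity (\int[mu]_x iint mu k (fun v => iint mu m (fun w => F (scons x w) v)))%E.
  by apply: eq_integral => x _; rewrite IH//; exact: seqmfun2_scons1.
rewrite integral_iint_swap//.
  by move=> a v; apply: iint_ge0.
move=> d S a y ma my.
pose H (p v : nat -> R) := F (scons (p 0%N) v) (fun i => p i.+1).
have mH : seqmfun2 H.
  by move=> d' S' p v mp mv; apply: mF => [|i]; [exact: measurable_scons | exact: mp].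
apply: (@seqmfun2_iint m H (fun w v => F0 _ _) mH _ S (fun s => scons (a s) (y s))).
by apply: measurable_scons.
Qed.

(** Only [Psi] is measurable. At each level the partial integral of [f] dominates [M], the positive
    part of [a] minus the partial integral of [Psi]; this minorant is measurable, and additivity is
    applied to it. *)
Lemma iint_mixed k (f Psi : (nat -> R) -> \bar R) (a : R) :
  (forall v, (0 <= f v)%E) -> (forall v, (0 <= Psi v)%E) -> seqmfun Psi ->
  (forall v, (a%:E <= f v + Psi v)%E) ->
  (a%:E <= iint mu k f + iint mu k Psi)%E.
Proof.
elim: k f Psi => [|k IH] f Psi f0 P0 mP fP //=.
pose F x := iint mu k (fun v => f (scons x v)).
pose G x := iint mu k (fun v => Psi (scons x v)).
have F0 x : (0 <= F x)%E by exact: iint_ge0.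
have G0 x : (0 <= G x)%E by exact: iint_ge0.
have mG : measurable_fun setT G by exact: seqmfun_iint_scons.
have FG x : (a%:E <= F x + G x)%E by apply: IH => //; exact: seqmfun_scons.
pose M x := (maxe (a%:E - G x) 0)%E.
have M0 x : (0 <= M x)%E by rewrite /M le_max lexx orbT.
have mM : measurable_fun setT M.
  by apply: measurable_maxe => //; apply: emeasurable_funB.
have MF x : (M x <= F x)%E.
  rewrite /M ge_max F0 andbT; move: (FG x) (G0 x).
  case: (G x) => [g| |]//=; last by rewrite leNye.
  by move=> H _; rewrite (EFinN g) leeBlDr.
apply: (@le_trans _ _ (\int[mu]_x M x + \int[mu]_x G x)%E); last first.
  by rewrite leeD2r// ge0_le_integralT.
rewrite -ge0_integralD//.
have -> : a%:E = (\int[mu]_x a%:E)%E.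
  by rewrite integral_cst//= [X in (_ * X)%E]probability_setT mule1.
have [a0|a0] := leP 0 a; last first.
  rewrite integral_cst//= [X in (_ * X)%E]probability_setT mule1.
  apply: (@le_trans _ _ 0%E); first by rewrite lee_fin ltW.
  by apply: integral_ge0 => x _; rewrite adde_ge0.
apply: ge0_le_integralT => x //.
rewrite /M; move: (G0 x); case: (G x) => [g| |]//= g0.
  by rewrite -leeBlDr// le_max lexx.
by rewrite maxNye add0e leey.
Qed.

Lemma iint_prod k (g : nat -> R -> R) (c : nat -> R) :
  (forall i x, 0 <= g i x) -> (forall i, measurable_fun setT (g i)) ->
  (forall i, (i < k)%N -> \int[mu]_x (g i x)%:E = (c i)%:E)%E ->
  iint mu k (fun v => (\prod_(i < k) g i (v i))%:E) = (\prod_(i < k) c i)%:E.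
Proof.
elim: k g c => [|k IH] g c g0 mg gc /=; first by rewrite !big_ord0.
rewrite big_ord_recl.
have H x : iint mu k (fun v => (\prod_(i < k.+1) g i (scons x v i))%:E) =
   ((\prod_(i < k) c i.+1)%:E * (g 0%N x)%:E)%E.
  rewrite -(IH (fun i => g i.+1) (fun i => c i.+1))//; last first.
    by move=> i ik; exact: gc.
  rewrite muleC -iintZ//.
  - by apply: eq_iint => v; rewrite big_ord_recl.
  - by move=> v; rewrite lee_fin prodr_ge0.
  - move=> d S y my; apply/measurable_EFinP; apply: measurable_prod => i.
    by move=> _; apply: measurableT_comp.
under eq_integral do rewrite H.
have c0 i : (i < k.+1)%N -> 0 <= c i.
  by move=> ik; rewrite -lee_fin -gc//; apply: integral_ge0 => x _; rewrite lee_fin.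
rewrite ge0_integralZl//.
- by rewrite gc// -EFinM mulrC.
- exact/measurable_EFinP.
- by move=> x _; rewrite lee_fin.
- by rewrite lee_fin; apply: prodr_ge0 => i _; apply: c0; rewrite ltnS.
Qed.

Lemma le1_iint_prod k (g : nat -> R -> R) :
  (forall i x, 0 <= g i x) -> (forall i, measurable_fun setT (g i)) ->
  (forall i, (\int[mu]_x (g i x)%:E <= 1)%E) ->
  (iint mu k (fun v => (\prod_(i < k) g i (v i))%:E) <= 1)%E.
Proof.
move=> g0 mg g1.
have g0' i : (0 <= \int[mu]_x (g i x)%:E)%E by apply: integral_ge0 => x _; rewrite lee_fin.
rewrite (@iint_prod k g (fun i => fine (\int[mu]_x (g i x)%:E)%E))//.
  rewrite lee_fin; apply: Num.Theory.prodr_ile1 => i _.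
  rewrite fine_ge0//= -lee_fin fineK// ge0_fin_numE//.
  by apply: le_lt_trans (g1 _) _; rewrite ltry.
move=> i _; rewrite fineK// ge0_fin_numE//.
by apply: le_lt_trans (g1 _) _; rewrite ltry.
Qed.

Definition catn (n : nat) (u v : nat -> R) : nat -> R :=
  fun i => if (i < n)%N then u i else v (i - n)%N.

Lemma iint_addn n m F : iint mu (n + m) F =
  iint mu n (fun u => iint mu m (fun v => F (catn n u v))).
Proof.
elim: n F => [|n IH] F /=.
  by apply: eq_iint => v; congr F; apply/funext => i; rewrite /catn subn0.
apply: eq_integral => x _; rewrite IH; apply: eq_iint => u; apply: eq_iint => v.
by congr F; apply/funext => -[|i].
Qed.

(** Independence of the [N] blocks. Locality of [g j] allows the first block of [catn n u v] to be
    read as [u]. *)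
Lemma iint_blocks n N (g : nat -> (nat -> R) -> R) (c : nat -> R) :
  (forall j v, 0 <= g j v) -> (forall j, seqmfun (EFin \o g j)) ->
  (forall j u v, (forall i, (i < n)%N -> u i = v i) -> g j u = g j v) ->
  (forall j, (j < N)%N -> iint mu n (EFin \o g j) = (c j)%:E) ->
  iint mu (n * N) (fun w => (\prod_(j < N) g j (fun i => w (j * n + i)%N))%:E) =
  (\prod_(j < N) c j)%:E.
Proof.
elim: N g c => [|N IH] g c g0 mg loc gc; first by rewrite muln0 /= !big_ord0.
rewrite mulnS iint_addn big_ord_recl.
have H u : iint mu (n * N) (fun v => (\prod_(j < N.+1)
    g j (fun i => catn n u v (j * n + i)%N))%:E) =
    ((\prod_(j < N) c j.+1)%:E * (g 0%N u)%:E)%E.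
  rewrite -(IH (fun j => g j.+1) (fun j => c j.+1) (fun j => g0 j.+1) (fun j => mg j.+1)
    (fun j => loc j.+1) (fun j => gc j.+1)).
  rewrite muleC -iintZ//.
  - apply: eq_iint => v; rewrite big_ord_recl -EFinM; congr ((_ * _)%:E).
      by apply: loc => i ik; rewrite /catn /= mul0n add0n ik.
    apply: eq_bigr => j _; congr g; apply/funext => i.
    rewrite /catn /= /bump /= add1n mulSn -addnA ltnNge leq_addr /=.
    by congr v; rewrite addKn.
  - by move=> v; rewrite lee_fin prodr_ge0.
  - move=> d S y my; apply/measurable_EFinP; apply: measurable_prod => j _.
    by apply/measurable_EFinP; apply: mg => i.
have c0 j : (j < N.+1)%N -> 0 <= c j.
  by move=> jN; rewrite -lee_fin -gc// iint_ge0// => v; rewrite lee_fin.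
rewrite (eq_iint _ H) iintZ//.
- by rewrite [X in (_ * X)%E]gc// -EFinM mulrC.
- by apply: prodr_ge0 => j _; apply: c0; rewrite ltnS.
- by move=> v; rewrite lee_fin.
- exact: mg.
Qed.

Lemma iint_block n N (g : (nat -> R) -> R) (c : R) j : (j < N)%N ->
  (forall v, 0 <= g v) -> seqmfun (EFin \o g) ->
  (forall u v, (forall i, (i < n)%N -> u i = v i) -> g u = g v) ->
  iint mu n (EFin \o g) = c%:E ->
  iint mu (n * N) (fun w => (g (fun i => w (j * n + i)%N))%:E) = c%:E.
Proof.
move=> jN g0 mg loc gc.
pose h i := if i == j then g else fun=> 1.
have := @iint_blocks n N h (fun i => if i == j then c else 1).
have -> : \prod_(i < N) (if i == j :> nat then c else 1) = c.
  by rewrite (bigD1 (Ordinal jN))//= eqxx big1 ?mulr1// => i; rewrite -val_eqE /= => /negbTE ->.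
move=> <-.
- apply: eq_iint => w; congr (_%:E).
  rewrite (bigD1 (Ordinal jN))//= /h eqxx big1 ?mulr1// => i.
  by rewrite -val_eqE /= => /negbTE ->.
- by move=> i v; rewrite /h; case: eqP.
- move=> i; rewrite /h; case: eqP => // _ d S y my.
  exact: measurable_cst.
- by move=> i u v; rewrite /h; case: eqP => // _; exact: loc.
- by move=> i _; rewrite /h; case: eqP => // _; exact: iint_cst.
Qed.

End IteratedIntegral.

(** * Gordan's alternative *)

Section Gordan.
Variable R : realType.

Definition dot n (u v : 'I_n -> R) := \sum_i u i * v i.

Lemma dot_linl n s t (u v w : 'I_n -> R) :
  dot (fun i => s * u i + t * v i) w = s * dot u w + t * dot v w.
Proof.
rewrite /dot !mulr_sumr -big_split; apply: eq_bigr => i _ /=; ring.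
Qed.

Lemma dotC n (u v : 'I_n -> R) : dot u v = dot v u.
Proof. by apply: eq_bigr => i _; rewrite mulrC. Qed.

Lemma dot_gt0 n (u : 'I_n -> R) i : u i != 0 -> 0 < dot u u.
Proof.
move=> ui; rewrite /dot (bigD1 i)//=; apply: ltr_wpDr.
  by apply: sumr_ge0 => j _; rewrite -expr2 sqr_ge0.
by rewrite -expr2 exprn_even_gt0.
Qed.

Lemma neg_perturb N (x y : 'I_N -> R) : (forall j, x j < 0) ->
  exists2 e, 0 < e & forall j, x j + e * y j < 0.
Proof.
move=> x0.
suff [e e0 H] : exists2 e, 0 < e & forall j, e * `|y j| < - x j.
  exists e => // j; have := H j; have := ler_norm (y j).
  rewrite -(ler_pM2l e0); lra.
elim: N x y x0 => [|N IH] x y x0; first by exists 1 => // -[].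
have [e e0 H] := IH (fun j => x (lift ord0 j)) (fun j => y (lift ord0 j))
  (fun j => x0 (lift ord0 j)).
have y1 : 0 < `|y ord0| + 1 by rewrite ltr_wpDl.
have f0 : 0 < - x ord0 / (`|y ord0| + 1) by rewrite divr_gt0// oppr_gt0.
exists (Num.min e (- x ord0 / (`|y ord0| + 1))) => [|j].
  by rewrite lt_min e0.
have [->|[k ->]] : j = ord0 \/ exists k, j = lift ord0 k.
  by case: (unliftP ord0 j) => [k ->|->]; [right; exists k|left].
- apply: (@le_lt_trans _ _ (- x ord0 / (`|y ord0| + 1) * `|y ord0|)).
    by rewrite ler_wpM2r// ge_min lexx orbT.
  rewrite -mulrA gtr_pMr ?oppr_gt0// mulrC ltr_pdivrMr// mul1r; lra.
- apply: le_lt_trans (H k); rewrite ler_wpM2r// ge_min lexx//.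
Qed.

(* Gordan's alternative, by induction on the number of vectors: when theta
   separates all but the first vector, the other ones are replaced by their
   combinations with the first that are orthogonal to theta. *)
Lemma gordan n N (a : 'I_N -> 'I_n -> R) :
  (exists l : 'I_N -> R, [/\ forall j, 0 <= l j, \sum_j l j = 1 &
     forall i, \sum_j l j * a j i = 0]) \/
  (exists theta, forall j, dot theta (a j) < 0).
Proof.
elim: N a => [|N IH] a; first by right; exists (fun=> 0) => -[].
pose b j := a (lift ord0 j); pose a0 := a ord0.
have ordP (P : 'I_N.+1 -> Prop) : P ord0 -> (forall j, P (lift ord0 j)) -> forall j, P j.
  by move=> P0 PS j; case: (unliftP ord0 j) => [k ->|->].
have mk (l0 : R) (l : 'I_N -> R) : exists l' : 'I_N.+1 -> R,
    l' ord0 = l0 /\ forall j, l' (lift ord0 j) = l j.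
  exists (fun j => if unlift ord0 j is Some k then l k else l0).
  by split=> [|j]; rewrite ?unlift_none ?liftK.
have [[l [l0 l1 la]]|[theta th]] := IH b.
  left; have [l' [l'0 l'S]] := mk 0 l; exists l'; split.
  - by apply: ordP => [|j]; rewrite ?l'0 ?l'S.
  - by rewrite big_ord_recl l'0 add0r -l1; apply: eq_bigr => j _; rewrite l'S.
  - move=> i; rewrite big_ord_recl l'0 mul0r add0r -[RHS](la i).
    by apply: eq_bigr => j _; rewrite l'S.
have [al0|al0] := ltP (dot theta a0) 0.
  by right; exists theta; exact: ordP.
have [/existsP[i a0i]|/existsPn a00] := boolP [exists i, a0 i != 0]; last first.
  left; have [l' [l'0 l'S]] := mk 1 (fun=> 0); exists l'; split.
  - by apply: ordP => [|j]; rewrite ?l'0 ?l'S.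
  - by rewrite big_ord_recl l'0 big1 ?addr0// => j _; rewrite l'S.
  - move=> i; rewrite big_ord_recl l'0 big1 ?addr0 => [|j _]; last by rewrite l'S mul0r.
    by have := a00 i; rewrite negbK mul1r => /eqP.
move: al0; rewrite le_eqVlt => /orP[/eqP/esym al0|al0].
  (* [theta] is orthogonal to the nonzero vector [a0]: subtracting a small multiple of [a0] makes
     the product with [a0] negative and keeps the others negative. *)
  have [e e0 H] := @neg_perturb N (fun j => dot theta (b j)) (fun j => - dot a0 (b j)) th.
  right; exists (fun i => 1 * theta i + (- e) * a0 i); apply: ordP => [|j].
    by rewrite dot_linl al0 mulr0 add0r mulNr oppr_lt0 mulr_gt0// (dot_gt0 a0i).
  by rewrite dot_linl; have := H j; rewrite -/(b j); lra.
pose al := dot theta a0.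
pose c j i := al * b j i + (- dot theta (b j)) * a0 i.
have [[l [l0 l1 la]]|[phi ph]] := IH c.
  (* [s] is the weight that falls on [a0] when each [c j] is expanded; the weights on the [b j] add
     up to [al], hence the normalisation by [s + al]. *)
  pose s := \sum_j l j * (- dot theta (b j)).
  have s0 : 0 <= s.
    by apply: sumr_ge0 => j _; rewrite mulr_ge0// oppr_ge0 ltW.
  have t0 : 0 < s + al by rewrite ltr_wpDl.
  left; have [l' [l'0 l'S]] := mk (s / (s + al)) (fun j => l j * al / (s + al)).
  exists l'; split.
  - apply: ordP => [|j]; rewrite ?l'0 ?l'S ?divr_ge0// ?(ltW t0)//.
    by rewrite mulr_ge0// ltW.
  - rewrite big_ord_recl l'0 (eq_bigr (fun j => l j * (al / (s + al)))); last first.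
      by move=> j _; rewrite l'S mulrA.
    by rewrite -mulr_suml l1 mul1r -mulrDl divff// gt_eqF.
  - move=> k; rewrite big_ord_recl l'0.
    rewrite (eq_bigr (fun j => (l j * c j k + l j * dot theta (b j) * a0 k) / (s + al))).
      rewrite -mulr_suml big_split /= la add0r -mulr_suml.
      have -> : \sum_j l j * dot theta (b j) = - s.
        by rewrite /s -sumrN; apply: eq_bigr => j _; rewrite mulrN opprK.
      by rewrite -/a0; ring.
    by move=> j _; rewrite l'S /c -/(b j); ring.
have [e e0 H] := @neg_perturb N (fun j => dot phi (c j) / al)
  (fun j => - dot theta (b j)) (fun j => ltac:(by rewrite pmulr_llt0 ?invr_gt0)).
(* The multiple of [theta] is such that the product with [a0] is [- (e * al)], while the product
   with [b j] is [dot phi (c j) / al - e * dot theta (b j)], negative by the choice of [e]. *)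
right; exists (fun i => 1 * phi i + (- (dot phi a0 / al) - e) * theta i).
apply: ordP => [|j]; rewrite dot_linl.
  rewrite -/a0 -/al mulrBl mulNr divfK ?gt_eqF//.
  suff : 0 < e * al by lra.
  by rewrite mulr_gt0.
have := H j; rewrite (dotC phi (c j)) dot_linl -/(b j) !(dotC _ phi).
have -> : (al * dot phi (b j) + - dot theta (b j) * dot phi a0) / al =
  dot phi (b j) - dot theta (b j) * (dot phi a0 / al).
  by field; rewrite gt_eqF.
by lra.
Qed.

End Gordan.

(** * Tilting finite distributions *)

Section Tilting.
Variable R : realType.

(** Follows from [expR x * (1 - x) <= 1] and [(1 + x + 2 * x ^+ 2) * (1 - x) >= 1], the latter
    because [x <= 1/2]. *)
Lemma expR_le_quad (x : R) : x <= 2^-1 -> expR x <= 1 + x + 2 * x ^+ 2.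
Proof.
move=> x2; have h := expR_ge1Dx (- x).
have h0 : 0 < expR x by exact: expR_gt0.
have hN : expR x * expR (- x) = 1 by rewrite -expRD subrr expR0.
have h1 : expR x * (1 - x) <= 1.
  by rewrite -[leRHS]hN ler_wpM2l// ltW.
have x1 : 0 < 1 - x by lra.
rewrite -(ler_pM2r x1); apply: le_trans h1 _.
have -> : (1 + x + 2 * x ^+ 2) * (1 - x) = 1 + x ^+ 2 * (1 - 2 * x) by ring.
by rewrite lerDl mulr_ge0 ?sqr_ge0//; lra.
Qed.

Lemma expr_cvg0 (r : R) : 0 <= r < 1 -> forall d, 0 < d ->
  exists n0, forall n, (n0 <= n)%N -> r ^+ n <= d.
Proof.
move=> /andP[r0 r1] d d0.
have : (fun n => r ^+ n) @ \oo --> (0 : R).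
  by apply: cvg_expr; rewrite ger0_norm.
move/cvgrPdist_le => /(_ d d0) [n0 _ H]; exists n0 => n nn.
have := H n nn; rewrite sub0r normrN ger0_norm// exprn_ge0//.
Qed.

(* The rate at which a centred variable bounded by [B] exceeds its mean by
   [eps] on average, uniformly in its law. *)
Lemma chernoff_rate (eps B : R) : 0 < eps -> 0 < B ->
  exists lr : R * R, [/\ 0 < lr.1, lr.1 * B <= 2^-1, 0 <= lr.2 < 1 &
    expR (- (lr.1 * eps)) * (1 + 2 * (lr.1 * B) ^+ 2) <= lr.2].
Proof.
(* The first bound gives [l * B <= 1/2]; the second makes [2 * (l * B) ^+ 2] at most half of
   [l * eps], so the other half is left as the rate. *)
move=> e0 B0; pose l := Num.min (2 * B)^-1 (eps / (4 * B ^+ 2)).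
have B20 : 0 < 4 * B ^+ 2 by rewrite mulr_gt0// exprn_gt0.
have l0 : 0 < l by rewrite lt_min invr_gt0 mulr_gt0//= divr_gt0.
exists (l, expR (- (l * eps / 2))); split => //=.
- rewrite -ler_pdivlMr// -invfM; by rewrite /l ge_min lexx.
- rewrite expR_ge0/= -[ltRHS]expR0 ltr_expR oppr_lt0 divr_gt0// mulr_gt0//.
- apply: (@le_trans _ _ (expR (- (l * eps)) * expR (2 * (l * B) ^+ 2))).
    by rewrite ler_wpM2l ?expR_ge0// expR_ge1Dx.
  rewrite -expRD ler_expR.
  have h : l * (4 * B ^+ 2) <= eps.
    by rewrite -ler_pdivlMr// /l ge_min lexx orbT.
  have : l * (l * (4 * B ^+ 2)) <= l * eps by rewrite ler_wpM2l// ltW.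
  by rewrite exprMn; lra.
Qed.

Lemma chernoff_fin (K : nat) (nu e : 'I_K -> R) (eps B l : R) :
  (forall k, 0 <= nu k) -> \sum_k nu k = 1 -> \sum_k nu k * e k <= 0 ->
  (forall k, `|e k| <= B) -> 0 < l -> l * B <= 2^-1 ->
  \sum_k nu k * expR (l * (e k - eps)) <= expR (- (l * eps)) * (1 + 2 * (l * B) ^+ 2).
Proof.
move=> nu0 nu1 nue eB l0 lB.
have step k : nu k * expR (l * (e k - eps)) <=
    expR (- (l * eps)) * (nu k * (1 + 2 * (l * B) ^+ 2) + l * (nu k * e k)).
  rewrite mulrBr expRD mulrA mulrC ler_wpM2l ?expR_ge0//.
  have -> : nu k * (1 + 2 * (l * B) ^+ 2) + l * (nu k * e k) =
    nu k * (1 + l * e k + 2 * (l * B) ^+ 2) by ring.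
  rewrite ler_wpM2l//.
  have le2 : l * `|e k| <= l * B by rewrite ler_wpM2l// ltW.
  have le3 : `|l * e k| <= l * B by rewrite normrM (gtr0_norm l0).
  apply: le_trans (expR_le_quad _) _.
    by apply: le_trans lB; apply: le_trans le3; exact: ler_norm.
  rewrite lerD2l ler_wpM2l// -(real_normK (num_real (l * e k))).
  by rewrite lerXn2r// nnegrE// (le_trans _ le3).
apply: le_trans (ler_sum _ (fun k _ => step k)) _.
rewrite -mulr_sumr ler_wpM2l ?expR_ge0// big_split/= -mulr_suml nu1 mul1r.
by rewrite -mulr_sumr gerDl pmulr_rle0.
Qed.

(** [g] is absorbed into the factor of index [i0]; the sum of products is then a product of sums,
    all equal to 1 except that one. *)
Lemma sum_ffun_marginal n K (nu : 'I_n -> 'I_K -> R) (g : 'I_K -> R) i0 :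
  (forall i, \sum_k nu i k = 1) ->
  \sum_(f : {ffun 'I_n -> 'I_K}) (\prod_i nu i (f i)) * g (f i0) =
  \sum_k nu i0 k * g k.
Proof.
move=> nu1; pose F i k := if i == i0 then nu i k * g k else nu i k.
transitivity (\sum_(f : {ffun 'I_n -> 'I_K}) \prod_i F i (f i)).
  apply: eq_bigr => f _; rewrite (bigD1 i0)//= [RHS](bigD1 i0)//= /F eqxx.
  rewrite -!mulrA; congr (_ * _); rewrite mulrC; congr (_ * _).
  by apply: eq_bigr => i ii0; rewrite (negbTE ii0).
rewrite -bigA_distr_bigA (bigD1 i0)//= [X in _ * X]big1 ?mulr1; last first.
  by move=> i ii0; rewrite -[RHS](nu1 i); apply: eq_bigr => k _; rewrite /F (negbTE ii0).
by apply: eq_bigr => k _; rewrite /F eqxx.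
Qed.

(* Change of measure to the product of the [nu i], followed by a first moment
   bound on the half-space event and a Chernoff bound on the density. *)
Lemma tilt_lower_bound (eps B gap R0 : R) : 0 < eps -> 0 < B -> 0 < gap -> gap <= R0 ->
  exists n0, forall n, (n0 <= n)%N ->
  forall K (p nu e z : 'I_n -> 'I_K -> R) (c A : 'I_n -> R),
  (forall i k, 0 <= p i k) -> (forall i k, 0 <= nu i k) ->
  (forall i, \sum_k nu i k = 1) ->
  (forall i k, nu i k <= p i k * expR (c i + e i k)) ->
  (forall i, \sum_k nu i k * e i k <= 0) -> (forall i k, `|e i k| <= B) ->
  (forall i k, `|z i k| <= A i * R0) ->
  (forall i, A i * gap <= \sum_k nu i k * z i k) ->
  gap / (4 * R0) * expR (- \sum_i c i - eps * n%:R) <=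
  \sum_(f : {ffun 'I_n -> 'I_K} | gap / 2 * \sum_i A i <= \sum_i z i (f i))
    \prod_i p i (f i).
Proof.
move=> eps0 B0 gap0 gapR.
have R00 : 0 < R0 by exact: lt_le_trans gapR.
have [[l r] /= [l0 lB r01 lr]] := chernoff_rate eps0 B0.
have c00 : 0 < gap / (4 * R0) by rewrite divr_gt0// mulr_gt0.
have [n0 Hn0] := expr_cvg0 r01 c00.
exists n0 => n nn K p nu e z c A p0 nu0 nu1 nup nue eB zA zgap.
pose W (f : {ffun 'I_n -> 'I_K}) := \prod_i nu i (f i).
pose Z (f : {ffun 'I_n -> 'I_K}) := \sum_i z i (f i).
pose S (f : {ffun 'I_n -> 'I_K}) := \sum_i e i (f i).
pose SA := \sum_i A i.
have W0 f : 0 <= W f by apply: prodr_ge0.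
have sW : \sum_f W f = 1.
  by rewrite /W -bigA_distr_bigA big1.
have A0 i : 0 <= A i.
  have [k _] : exists k : 'I_K, True.
    apply/not_existsP => H; have := nu1 i; rewrite big1 => [|k _]; last by case: (H k).
    by move/esym/eqP; rewrite oner_eq0.
  by rewrite -(pmulr_lge0 _ R00); exact: le_trans (zA i k).
have SA0 : 0 <= SA by apply: sumr_ge0.
pose good f := gap / 2 * SA <= Z f.
pose a := \sum_(f | good f) W f.
have EZ : gap * SA <= \sum_f W f * Z f.
  rewrite (eq_bigr (fun f => \sum_i W f * z i (f i))) => [|f _]; last by rewrite mulr_sumr.
  rewrite exchange_big /= mulr_sumr; apply: ler_sum => i _.
  by rewrite sum_ffun_marginal// mulrC.
have ZR f : Z f <= R0 * SA.
  rewrite mulr_sumr; apply: ler_sum => i _; rewrite mulrC.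
  by apply: le_trans (zA i (f i)); exact: ler_norm.
have aE : \sum_f W f * Z f <= R0 * SA * a + gap / 2 * SA.
  rewrite (bigID good) /= lerD//.
    rewrite /a mulr_sumr; apply: ler_sum => f _; rewrite mulrC.
    by rewrite ler_wpM2r.
  apply: (@le_trans _ _ (\sum_(f | ~~ good f) (gap / 2 * SA) * W f)).
    by apply: ler_sum => f; rewrite /good -ltNge => /ltW H; rewrite mulrC ler_wpM2r.
  have h0 : 0 <= gap / 2 * SA by rewrite mulr_ge0// divr_ge0// ltW.
  rewrite -mulr_sumr -[leRHS]mulr1 ler_wpM2l//.
  by rewrite -sW [leRHS](bigID good)/= lerDr sumr_ge0.
(* Reverse Markov inequality: [Z] has tilted mean at least [gap * SA] and never exceeds [R0 * SA],
   so it reaches half of the former with probability at least [gap / (2 * R0)]. If [SA = 0], all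
   [z i] vanish and [a = 1]. *)
have ca : gap / (2 * R0) <= a.
  move: SA0; rewrite le_eqVlt => /orP[/eqP SA0|SA0].
    have -> : a = 1.
      rewrite -sW /a; apply: eq_bigl => f; rewrite /good -SA0 mulr0.
      suff -> : Z f = 0 by rewrite lexx.
      rewrite /Z big1// => i _; apply/eqP; rewrite -normr_le0.
      apply: le_trans (zA i (f i)) _.
      have /eqP := esym SA0; rewrite /SA psumr_eq0// => /allP /(_ i (mem_index_enum i)).
      by move=> /= /eqP ->; rewrite mul0r.
    by rewrite ler_pdivrMr ?mulr_gt0// mul1r; lra.
  rewrite ler_pdivrMr ?mulr_gt0//.
  have : gap * SA <= R0 * SA * a + gap / 2 * SA by exact: le_trans aE.
  rewrite -[R0 * SA * a]mulrAC -mulrDl ler_pM2r//; lra.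
(* Exponential Markov inequality under the tilted law; [n0] was chosen so that this event takes away
   at most half of [gap / (2 * R0)]. *)
have bad : \sum_(f | eps * n%:R < S f) W f <= gap / (4 * R0).
  apply: le_trans (Hn0 n nn).
  apply: (@le_trans _ _ (\sum_(f : {ffun 'I_n -> 'I_K}) \prod_i (nu i (f i) * expR (l * (e i (f i) - eps))))).
    rewrite [leRHS](bigID (fun f => eps * n%:R < S f))/=.
    rewrite -[leLHS]addr0 lerD//; last first.
      by apply: sumr_ge0 => f _; apply: prodr_ge0 => i _; rewrite mulr_ge0 ?expR_ge0.
    apply: ler_sum => f Sf; rewrite big_split /= -expR_sum.
    rewrite -[leLHS]mulr1 ler_wpM2l//.
    rewrite -expR0 ler_expR -mulr_sumr mulr_ge0 ?ltW// sumrB subr_gt0.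
    by rewrite sumr_const card_ord -[eps *+ n]mulr_natr.
  rewrite -(bigA_distr_bigA (fun i k => nu i k * expR (l * (e i k - eps)))) /=.
  rewrite -[X in r ^+ X](card_ord n) -prodr_const.
  apply: ler_prod => i _; apply/andP; split.
    by apply: sumr_ge0 => k _; rewrite mulr_ge0 ?expR_ge0.
  by apply: le_trans lr; apply: chernoff_fin.
pose good2 f := good f && (S f <= eps * n%:R).
have g2 : gap / (4 * R0) <= \sum_(f | good2 f) W f.
  have : a <= \sum_(f | good2 f) W f + \sum_(f | eps * n%:R < S f) W f.
    rewrite /a (bigID (fun f => S f <= eps * n%:R)) /= lerD//.
    rewrite [leRHS](bigID good)/=.
    rewrite (eq_bigl (fun f => (eps * n%:R < S f) && good f)); last first.
      by move=> f; rewrite -ltNge andbC.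
    by rewrite lerDl sumr_ge0.
  have h : gap / (2 * R0) = 2 * (gap / (4 * R0)) by field; rewrite gt_eqF.
  by move: ca bad; rewrite h; lra.
apply: (@le_trans _ _ (\sum_(f | good2 f) \prod_i p i (f i))); last first.
  rewrite [leRHS](bigID (fun f => S f <= eps * n%:R))/= lerDl.
  by apply: sumr_ge0 => f _; apply: prodr_ge0.
rewrite mulrC.
apply: (@le_trans _ _ (expR (- \sum_i c i - eps * n%:R) * \sum_(f | good2 f) W f)).
  by rewrite ler_wpM2l ?expR_ge0.
(* On the remaining event the density of the tilted law with respect to the product of the [p i] is
   at most [expR (\sum_i c i + eps * n)], which converts tilted mass back into [p]-mass. *)
rewrite mulr_sumr; apply: ler_sum => f /andP[_ Sf].
have Wp : W f <= (\prod_i p i (f i)) * expR (\sum_i c i + S f).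
  rewrite -big_split expR_sum -big_split /=; apply: ler_prod => i _.
  by rewrite nu0/= nup.
rewrite -ler_pdivlMl ?expR_gt0// -expRN; apply: le_trans Wp _.
rewrite mulrC ler_wpM2r ?prodr_ge0// ler_expR; lra.
Qed.

End Tilting.

(** * Convex hulls *)

Section Hull.
Variable R : realType.

Lemma notin_hull_separation n N (X : 'I_N -> 'I_n -> R) v : ~ hull X v ->
  exists theta : 'I_n -> R, forall j, \sum_i theta i * (X j i - v i) < 0.
Proof.
move=> nH; have [[l [l0 l1 la]]|//] := gordan (fun j i => X j i - v i).
case: nH; exists l; split=> // i; have := la i.
rewrite (eq_bigr (fun j => l j * X j i - l j * v i)); last by move=> j _; rewrite mulrBr.
by rewrite sumrB -mulr_suml l1 mul1r => /eqP; rewrite subr_eq0 => /eqP.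
Qed.

Lemma hull_halfspace n N (X : 'I_N -> 'I_n -> R) v (theta : 'I_n -> R) : hull X v ->
  exists j, 0 <= \sum_i theta i * (X j i - v i).
Proof.
move=> [l [l0 l1 lv]]; apply: contrapT => /forallNP H.
have H' j : \sum_i theta i * (X j i - v i) < 0 by rewrite ltNge; apply/negP/H.
have E : \sum_j l j * (\sum_i theta i * (X j i - v i)) = 0.
  rewrite (eq_bigr (fun j => \sum_i theta i * (l j * X j i - l j * v i))).
    rewrite exchange_big big1//= => i _; rewrite -mulr_sumr sumrB -mulr_suml.
    by rewrite l1 mul1r lv subrr mulr0.
  by move=> j _; rewrite mulr_sumr; apply: eq_bigr => i _; ring.
have l00 j : l j = 0.
  have /eqP := E; rewrite -oppr_eq0 -sumrN psumr_eq0; last first.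
    by move=> i _; rewrite -mulrN mulr_ge0// oppr_ge0 ltW.
  move=> /allP /(_ j (mem_index_enum j)) /=; rewrite oppr_eq0 mulf_eq0.
  by rewrite (lt_eqF (H' j)) orbF => /eqP.
by move/eqP: l1; rewrite big1// eq_sym oner_eq0.
Qed.

End Hull.

Ltac mfun_tac := repeat first [ done | exact: measurable_cst | apply: measurable_funB
  | apply: measurable_funD | apply: measurable_funN | apply: measurable_funM ].

(** * Concentration of averages of bounded functions *)

Section OneDim.
Variables (R : realType) (mu : probability R R).
Local Notation E f := (Rintegral mu setT f).

Lemma integral_prob_cst (c : R) : (\int[mu]_x c%:E = c%:E)%E.
Proof. by rewrite integral_cst//= [X in (_ * X)%E]probability_setT mule1. Qed.

Lemma bounded_mu_integrable (f : R -> R) (B : R) : measurable_fun setT f ->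
  (forall x, `|f x| <= B) -> mu.-integrable setT (EFin \o f).
Proof.
move=> mf fB; apply: measurable_bounded_integrable => //.
  by rewrite [ltLHS]probability_setT ltry.
by exists B; split; [exact: num_real | move=> M BM x _ /=; apply: le_trans (fB x) (ltW BM)].
Qed.

Lemma integral_bounded (f : R -> R) (B : R) : measurable_fun setT f ->
  (forall x, `|f x| <= B) -> (\int[mu]_x (f x)%:E = (E f)%:E)%E.
Proof.
move=> mf fB; rewrite /Rintegral fineK//; apply: integrable_fin_num => //.
exact: bounded_mu_integrable fB.
Qed.

Lemma Rintegral_prob_cst (c : R) : E (fun=> c) = c.
Proof. by rewrite Rintegral_cst//= [X in fine X]probability_setT mulr1. Qed.

Lemma chernoff_int (f : R -> R) (eps B l : R) : measurable_fun setT f ->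
  (forall x, `|f x - E f| <= B) -> 0 < l -> l * B <= 2^-1 ->
  (\int[mu]_x (expR (l * (f x - E f - eps)))%:E <=
   (expR (- (l * eps)) * (1 + 2 * (l * B) ^+ 2))%:E)%E.
Proof.
move=> mf fB l0 lB.
set C := expR (- (l * eps)); set m := E f.
have step x : expR (l * (f x - m - eps)) <=
    C * (1 + 2 * (l * B) ^+ 2) + C * l * (f x - m).
  have -> : l * (f x - m - eps) = - (l * eps) + l * (f x - m) by ring.
  have -> : C * (1 + 2 * (l * B) ^+ 2) + C * l * (f x - m) =
    C * (1 + l * (f x - m) + 2 * (l * B) ^+ 2) by ring.
  rewrite expRD ler_wpM2l ?expR_ge0//.
  have le3 : `|l * (f x - m)| <= l * B.
    by rewrite normrM (gtr0_norm l0) ler_wpM2l// ltW.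
  apply: le_trans (expR_le_quad _) _.
    by apply: le_trans lB; apply: le_trans le3; exact: ler_norm.
  rewrite lerD2l ler_wpM2l// -(real_normK (num_real (l * _))).
  by rewrite lerXn2r// nnegrE// (le_trans _ le3).
have mfm : measurable_fun setT (fun x => f x - m).
  by mfun_tac.
have fmB x : `|f x| <= B + `|m|.
  by rewrite -[f x](subrK m); apply: le_trans (ler_normD _ _) _; rewrite lerD2r.
have ifm := bounded_mu_integrable mfm fB.
have Em : E (fun x => f x - m) = 0.
  rewrite RintegralB//; last exact: finite_measure_integrable_cst.
    by rewrite Rintegral_prob_cst subrr.
  exact: bounded_mu_integrable fmB.
set g := fun x => C * (1 + 2 * (l * B) ^+ 2) + C * l * (f x - m).
have mg : measurable_fun setT g.
  by mfun_tac.
have gB x : `|g x| <= `|C * (1 + 2 * (l * B) ^+ 2)| + `|C * l| * B.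
  by apply: le_trans (ler_normD _ _) _; rewrite lerD2l normrM ler_wpM2l.
apply: (@le_trans _ _ (\int[mu]_x (g x)%:E)%E).
  by apply: ge0_le_integralT => x; rewrite lee_fin ?expR_ge0// step.
rewrite (integral_bounded mg gB) lee_fin /g RintegralD//.
- by rewrite Rintegral_prob_cst RintegralZl// Em mulr0 addr0.
- exact: finite_measure_integrable_cst.
- apply: (@bounded_mu_integrable _ (`|C * l| * B)) => [|x].
    by mfun_tac.
  by rewrite normrM ler_wpM2l.
Qed.

(** The product is at least 1 wherever the sum of the [f (v i)] reaches [n * (E f + eps)], so it can
    replace the indicator of that event in a majorant, and its integral factorises. *)
Lemma iint_chernoff (f : R -> R) (eps B : R) : 0 < eps -> measurable_fun setT f ->
  (forall x, `|f x| <= B) ->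
  exists lr : R * R, [/\ 0 < lr.1, 0 <= lr.2 < 1 & forall n,
    (iint mu n (fun v => (\prod_(i < n) expR (lr.1 * (f (v i) - E f - eps)))%:E) <=
      (lr.2 ^+ n)%:E)%E].
Proof.
move=> e0 mf fB.
have B0 : 0 <= B by apply: le_trans (fB 0).
have EB : `|E f| <= B.
  apply: le_trans (le_normr_Rintegral _ _) _ => //; first exact: bounded_mu_integrable fB.
  rewrite -[leRHS]Rintegral_prob_cst; apply: le_Rintegral => //.
  - apply: (@bounded_mu_integrable _ B); first exact: measurableT_comp.
    by move=> x; rewrite normr_id.
  - exact: finite_measure_integrable_cst.
(* The extra 1 keeps the bound positive when [B = 0]. *)
have fEB x : `|f x - E f| <= 2 * B + 1.
  by apply: le_trans (ler_normB _ _) _; have := fB x; lra.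
have B1 : 0 < 2 * B + 1 by lra.
have [[l r] /= [l0 lB r01 lr]] := chernoff_rate e0 B1.
exists (l, r); split => //= n.
set g := fun x => expR (l * (f x - E f - eps)).
have mg : measurable_fun setT g.
  by apply: measurableT_comp => //; mfun_tac.
have gr : (\int[mu]_x (g x)%:E <= r%:E)%E.
  by apply: le_trans (chernoff_int eps mf fEB l0 lB) _; rewrite lee_fin.
have g0 x : 0 <= g x by exact: expR_ge0.
have gf : (0 <= \int[mu]_x (g x)%:E)%E by apply: integral_ge0 => x _; rewrite lee_fin.
rewrite (@iint_prod _ _ n (fun=> g) (fun=> fine (\int[mu]_x (g x)%:E)%E))//.
  rewrite prodr_const card_ord lee_fin lerXn2r ?nnegrE ?fine_ge0//.
    by case/andP: r01.
  by rewrite -lee_fin fineK// ge0_fin_numE//; apply: le_lt_trans gr _; rewrite ltry.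
by move=> i _; rewrite fineK// ge0_fin_numE//; apply: le_lt_trans gr _; rewrite ltry.
Qed.

End OneDim.

(** * Few points *)

Section Upper.
Variables (R : realType) (mu : probability R R).
Local Notation E f := (Rintegral mu setT f).

(** [t v] is the slope used in a coordinate with value [v], [Lam v] bounds the logarithm of the
    moment generating function there, and [ell v] is the rate which that coordinate guarantees. The
    indicator of the hull is majorised by [Psi], whose terms factorise. One [e] pays for atypical x,
    the other for the union over the [N] points. *)
Lemma Emu_small (t Lam ell : R -> R) (B e delta : R) :
  measurable_fun setT t -> measurable_fun setT Lam -> measurable_fun setT ell ->
  (forall v, `|ell v| <= B) ->
  (forall v, (\int[mu]_w (expR (t v * w))%:E <= (expR (Lam v))%:E)%E) ->
  (forall v, ell v <= t v * v - Lam v) -> 0 < e -> 0 < delta ->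
  exists n0, forall n, (n0 <= n)%N -> forall N,
    N%:R <= expR ((E ell - 2 * e) * n%:R) -> (Emu mu n N <= delta%:E)%E.
Proof.
move=> mt mLam mell ellB tLam ellt e0 d0.
pose f x := - ell x.
have mf : measurable_fun setT f by exact: measurable_funN.
have fB x : `|f x| <= B by rewrite normrN.
have Ef : E f = - E ell.
  have -> : f = (fun x => (-1) * ell x) by apply/funext => x; rewrite mulN1r.
  rewrite RintegralZl//; last exact: bounded_mu_integrable ellB.
  by rewrite mulN1r.
have [[l r] /= [l0 r01 lr]] := iint_chernoff mu e0 mf fB.
have d20 : 0 < delta / 2 by rewrite divr_gt0.
have [n1 Hn1] := expr_cvg0 r01 d20.
have er : 0 <= expR (- e) < 1.
  by rewrite expR_ge0/= -[ltRHS]expR0 ltr_expR oppr_lt0.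
have [n2 Hn2] := expr_cvg0 er d20.
exists (maxn n1 n2) => n; rewrite geq_max => /andP[nn1 nn2] N HN.
pose Psi1 (v : nat -> R) := \prod_(i < n) expR (l * (f (v i) - E f - e)).
pose phi v w := expR (t v * w - Lam v).
pose Psi2 (j : nat) (w v : nat -> R) := \prod_(i < n) phi (v i) (w (j * n + i)%N).
(* If the rates of x sum to more than [(E ell - e) * n], then [C * Psi2 j] is at least 1 as soon as
   the j-th point lies in the half-space; [Psi2 j] itself has integral at most 1. *)
pose C := expR (- ((E ell - e) * n%:R)).
have Psi10 v : 0 <= Psi1 v by apply: prodr_ge0 => i _; exact: expR_ge0.
have Psi20 j w v : 0 <= Psi2 j w v by apply: prodr_ge0 => i _; exact: expR_ge0.
have C0 : 0 <= C by exact: expR_ge0.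
pose Psi w v := ((Psi1 v)%:E + \sum_(j < N) C%:E * (Psi2 j w v)%:E)%E.
have CPsi0 w v (j : 'I_N) : (0 <= C%:E * (Psi2 j w v)%:E)%E.
  by rewrite -EFinM lee_fin mulr_ge0.
have Psi0 w v : (0 <= Psi w v)%E.
  by rewrite adde_ge0 ?lee_fin// sume_ge0.
have mphi d (S : measurableType d) (a b : S -> R) : measurable_fun setT a ->
    measurable_fun setT b -> measurable_fun setT (fun s => phi (a s) (b s)).
  move=> ma mb; apply: measurableT_comp => //; apply: measurable_funB.
    by apply: measurable_funM => //; exact: measurableT_comp.
  exact: measurableT_comp.
have mPsi2 j : seqmfun2 (fun w v => (Psi2 j w v)%:E).
  move=> d S x y mx my; apply/measurable_EFinP; apply: measurable_prod => i _.
  exact: mphi.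
have mPsi1 : seqmfun (fun v => (Psi1 v)%:E).
  move=> d S y my; apply/measurable_EFinP; apply: measurable_prod => i _.
  apply: measurableT_comp => //; mfun_tac.
  exact: (measurableT_comp mell).
have mPsi : seqmfun2 Psi.
  move=> d S x y mx my; apply: emeasurable_funD; first exact: mPsi1.
  apply: emeasurable_sum => j; apply: emeasurable_funM => //; exact: mPsi2.
have key (w v : nat -> R) : ((\1_(hull (fun (j : 'I_N) (i : 'I_n) => w (j * n + i)%N)) (fun i : 'I_n => v i) : R)%:E
    <= Psi w v)%E.
  rewrite indicE; have [|_] := boolP (_ \in _); last by rewrite Psi0.
  rewrite inE => hv.
  have [j Hj] := hull_halfspace (fun i : 'I_n => t (v i)) hv.
  have [H|H] := leP (\sum_(i < n) ell (v i)) ((E ell - e) * n%:R).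
    apply: (@le_trans _ _ (Psi1 v)%:E); last by rewrite leeDl// sume_ge0.
    rewrite lee_fin /Psi1 -expR_sum -[leLHS]expR0 ler_expR -mulr_sumr.
    apply: mulr_ge0; first exact: ltW.
    rewrite 2!sumrB !sumr_const card_ord sumrN Ef.
    by move: H; rewrite -(mulr_natr (- E ell)) -(mulr_natr e); lra.
  apply: (@le_trans _ _ (\sum_(j < N) C%:E * (Psi2 j w v)%:E)%E); last by rewrite leeDr// lee_fin.
  rewrite (bigD1 j)//= -[leLHS]adde0 leeD ?sume_ge0//.
  rewrite -EFinM lee_fin /C /Psi2 /phi -expR_sum -expRD -[leLHS]expR0 ler_expR.
  have H2 : \sum_(i < n) ell (v i) <= \sum_(i < n) (t (v i) * w (j * n + i)%N - Lam (v i)).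
    apply: (@le_trans _ _ (\sum_(i < n) (t (v i) * v i - Lam (v i)))).
      by apply: ler_sum => i _.
    rewrite -subr_ge0 -sumrB; apply: le_trans Hj _; rewrite le_eqVlt; apply/orP; left.
    by apply/eqP/eq_bigr => i _; ring.
  by lra.
apply: (@le_trans _ _ (iint mu (n * N) (fun w => iint mu n (Psi w)))).
  apply: le_iint => w; first by apply: iint_ge0 => v; rewrite lee_fin.
  by apply: le_iint => v; rewrite ?lee_fin// key.
rewrite iint_swap//.
have phi1 v : (\int[mu]_w (phi v w)%:E <= 1)%E.
  have -> : (fun w => (phi v w)%:E) = (fun w => (expR (- Lam v))%:E * (expR (t v * w))%:E)%E.
    by apply/funext => w; rewrite -EFinM -expRD /phi addrC.
  rewrite ge0_integralZl//.
  - apply: (@le_trans _ _ ((expR (- Lam v))%:E * (expR (Lam v))%:E)%E).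
      by apply: lee_wpmul2l; [rewrite lee_fin expR_ge0 | exact: tLam].
    by rewrite -EFinM -expRD addNr expR0.
  - apply/measurable_EFinP; apply: measurableT_comp => //; by mfun_tac.
have inner v : (iint mu (n * N) (fun w => Psi w v) <= (Psi1 v + C * N%:R)%:E)%E.
  rewrite iintD//; first last.
  - move=> d S y my; apply: emeasurable_sum => j; apply: emeasurable_funM => //.
    by apply: (mPsi2 j _ _ y (fun=> v)).
  - by move=> w; rewrite sume_ge0.
  - by move=> w; rewrite lee_fin.
  rewrite iint_cst EFinD leeD2l// iint_sum//; last first.
    move=> j d S y my; apply: emeasurable_funM => //.
    by apply: (mPsi2 j _ _ y (fun=> v)).
  have -> : C * N%:R = \sum_(j < N) C by rewrite sumr_const card_ord mulr_natr.
  rewrite -sumEFin.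
  apply: lee_sum => j _.
  have mj : seqmfun (fun w => (Psi2 j w v)%:E).
    by move=> d S y my; apply: (mPsi2 j _ _ y (fun=> v)).
  rewrite iintZ//; last by move=> u; rewrite lee_fin.
  rewrite -[leRHS]mule1; apply: lee_wpmul2l; first by rewrite lee_fin.
  pose g (u : nat -> R) := \prod_(i < n) phi (v i) (u i).
  have g0 u : 0 <= g u by apply: prodr_ge0 => i _; exact: expR_ge0.
  have g1 : (iint mu n (EFin \o g) <= 1)%E.
    apply: (@le1_iint_prod _ _ n (fun i => phi (v i))) => [i x|i|i].
    - exact: expR_ge0.
    - by apply: (mphi _ _ (fun=> v i)).
    - exact: phi1.
  have gf : iint mu n (EFin \o g) \is a fin_num.
    rewrite ge0_fin_numE; last by apply: iint_ge0 => u; rewrite lee_fin.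
    by apply: le_lt_trans g1 _; rewrite ltry.
  rewrite (@iint_block _ _ n N g (fine (iint mu n (EFin \o g))) j)//.
  - by rewrite fineK.
  - move=> d S y my; apply/measurable_EFinP; apply: measurable_prod => i _.
    by apply: (mphi _ _ (fun=> v i)).
  - by move=> u u' uu'; apply: eq_bigr => i _; rewrite uu'.
  - by rewrite fineK.
apply: (@le_trans _ _ (iint mu n (fun v => (Psi1 v)%:E + (C * N%:R)%:E)%E)).
  by apply: le_iint => v; [apply: iint_ge0 => w | rewrite -EFinD inner].
rewrite iintD//; first last.
  by move=> v; rewrite lee_fin mulr_ge0.
rewrite iint_cst (_ : delta = delta / 2 + delta / 2); last by field.
rewrite EFinD leeD//.
  by apply: le_trans (lr n) _; rewrite lee_fin; exact: Hn1.
rewrite lee_fin; apply: le_trans (Hn2 n nn2).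
rewrite -expRM_natl; apply: (@le_trans _ _ (C * expR ((E ell - 2 * e) * n%:R))).
  by rewrite ler_wpM2l.
by rewrite /C -expRD ler_expR; lra.
Qed.

End Upper.

(** * Caps *)

Section Separation.
Variables (R : realType) (z0 L1 eta : R).

(* [box] localises [w] around [v]: coordinates with [|v| <= z0] stay bounded,
   the others only have to lie on the side of [v] given by the sign of [a]. *)
Definition box (v w a : R) : R :=
  if `|v| <= z0 then (`|w| <= L1)%R%:R
  else if 0 <= a then (v <= w)%R%:R else (w <= v)%R%:R.

(** Contribution of a coordinate to the half-space inequality, lowered by [eta * |a|] to leave room
    for rounding [a]. Coordinates with [|v| > z0] contribute 0, since [box] already settles their
    sign. *)
Definition margin (v w a : R) : R :=
  if `|v| <= z0 then a * (w - v) - eta * `|a| else 0.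

(** For [eta >= 0], the indicator of a subset of the half-space through [v] in direction [a]. *)
Definition cap n (a : 'I_n -> R) (v w : nat -> R) : R :=
  (\prod_(i < n) box (v i) (w i) (a i)) *
  (0 <= \sum_(i < n) margin (v i) (w i) (a i))%R%:R.

Definition gridpt n M (k : {ffun 'I_n -> 'I_(2 * M).+1}) (i : 'I_n) : R :=
  (k i)%:R / M%:R - 1.

Lemma box_ge0 v w a : 0 <= box v w a.
Proof. by rewrite /box; case: ifP => // _; case: ifP. Qed.

Lemma box_le1 v w a : box v w a <= 1.
Proof. by rewrite /box; do ?case: ifP => _; rewrite lern1 leq_b1. Qed.

Lemma cap_ge0 n (a : 'I_n -> R) v w : 0 <= cap a v w.
Proof. by rewrite mulr_ge0// prodr_ge0// => i _; exact: box_ge0. Qed.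

Lemma cap_le1 n (a : 'I_n -> R) v w : cap a v w <= 1.
Proof.
rewrite mulr_ile1//; last by rewrite lern1 leq_b1.
  by apply: prodr_ge0 => i _; exact: box_ge0.
by apply: Num.Theory.prodr_ile1 => i _; rewrite box_ge0 box_le1.
Qed.

Lemma cap_neq0 n (a : 'I_n -> R) v w : cap a v w != 0 ->
  (forall i : 'I_n, box (v i) (w i) (a i) != 0) /\
  0 <= \sum_(i < n) margin (v i) (w i) (a i).
Proof.
rewrite mulf_eq0 negb_or => /andP[/prodf_neq0 H]; rewrite pnatr_eq0 eqb0 negbK => H2.
by split => // i; exact: H.
Qed.

Lemma gridpt_approx n M (th : 'I_n -> R) : (0 < M)%N -> (forall i, `|th i| <= 1) ->
  exists k : {ffun 'I_n -> 'I_(2 * M).+1}, forall i, `|gridpt k i - th i| <= M%:R^-1.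
Proof.
move=> M0 th1; have M0' : 0 < M%:R :> R by rewrite ltr0n.
exists [ffun i => inord (Num.truncn (M%:R * (th i + 1)))] => i.
have /ler_normlP[h1 h2] := th1 i.
have x0 : 0 <= M%:R * (th i + 1) by rewrite mulr_ge0// ; lra.
have /andP[t1 t2] := Num.Theory.truncn_itv x0.
rewrite /gridpt ffunE inordK; last first.
  rewrite ltnS -(ler_nat R); apply: le_trans t1 _.
  rewrite natrM mulrC ler_wpM2r//; lra.
set T := (Num.truncn _)%:R in t1 *.
have -> : T / M%:R - 1 - th i = (T - M%:R * (th i + 1)) / M%:R.
  by field; rewrite gt_eqF.
rewrite normrM (ger0_norm (x := M%:R^-1)) ?invr_ge0// -[leRHS]mul1r ler_wpM2r ?invr_ge0//.
rewrite -natr1 in t2; rewrite ler_norml; apply/andP; split; lra.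
Qed.

Hypotheses (z00 : 0 <= z0) (L10 : 0 <= L1) (eta0 : 0 < eta).

(** The separating direction is scaled so that its largest entry among coordinates with
    [|v i| <= z0] is 1 in absolute value; elsewhere only its sign is kept, and rounding by at most
    1/2 preserves it. If some [w j] were in the cap of the rounded direction, rounding errors would
    total at most [n * (L1 + z0) / M <= eta / 2], while the slack of the largest entry, still at
    least 1/2 after rounding, is at least [eta / 2]: so [w j] would lie on the forbidden side. If
    all these entries vanish, the signs suffice. *)
Lemma cap_separation n N M (v : nat -> R) (w : 'I_N -> nat -> R) :
  (0 < M)%N -> 2 <= M%:R :> R -> 2 * n%:R * (L1 + z0) <= eta * M%:R ->
  ~ hull (fun j (i : 'I_n) => w j i) (fun i : 'I_n => v i) ->
  exists k : {ffun 'I_n -> 'I_(2 * M).+1}, forall j, cap (gridpt k) v (w j) = 0.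
Proof.
move=> M0 M2 HM /notin_hull_separation[th0 Hth0].
have M0' : 0 < M%:R :> R by rewrite ltr0n.
pose I1 (i : 'I_n) := `|v i| <= z0.
have [th [Hth th1 thcase]] : exists th : 'I_n -> R, [/\
    forall j, \sum_i th i * (w j i - v i) < 0, forall i, I1 i -> `|th i| <= 1 &
    (forall i, I1 i -> th i = 0) \/ exists2 i, I1 i & `|th i| = 1].
  have [/existsP[i1 /andP[Ii1 ti1]]|/existsPn H] :=
      boolP [exists i, I1 i && (th0 i != 0)]; last first.
    exists th0; split => //; last left.
      by move=> i Ii; have := H i; rewrite Ii/= negbK => /eqP ->; rewrite normr0.
    by move=> i Ii; have := H i; rewrite Ii/= negbK => /eqP ->.
  pose i0 := [arg max_(i > i1 | I1 i) `|th0 i|]%O.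
  have [Ii0 Hi0] : I1 i0 /\ forall i, I1 i -> `|th0 i| <= `|th0 i0|.
    by rewrite /i0; case: arg_maxP.
  have t0 : 0 < `|th0 i0| by apply: lt_le_trans (Hi0 _ Ii1); rewrite normr_gt0.
  exists (fun i => th0 i / `|th0 i0|); split.
  - move=> j; rewrite (eq_bigr (fun i => (th0 i * (w j i - v i)) / `|th0 i0|)); last first.
      by move=> i _; rewrite mulrAC.
    by rewrite -mulr_suml pmulr_llt0 ?invr_gt0.
  - by move=> i Ii; rewrite normrM normfV normr_id ler_pdivrMr// mul1r Hi0.
  - by right; exists i0 => //; rewrite normrM normfV normr_id divff// gt_eqF.
pose th' i := if I1 i then th i else if 0 <= th i then 1 else -1.
have th'1 i : `|th' i| <= 1.
  rewrite /th'; case: ifP => [/th1//|_]; case: ifP => _; first by rewrite normr1.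
  by rewrite normrN1.
have [k Hk] := gridpt_approx M0 th'1.
have Mi : M%:R^-1 <= 2^-1 :> R by rewrite lef_pV2 ?posrE.
exists k => j; apply/eqP; apply: contraT => /cap_neq0[hbox hm].
have := Hth j; rewrite ltNge => /negP; case.
have sgn_side i : ~~ I1 i -> 0 <= th i * (w j i - v i).
  have := hbox i; rewrite /box; have := Hk i; rewrite /th' -/(I1 i) => + + nI.
  rewrite (negbTE nI).
  case: ifPn => [th0'|]; [|rewrite -ltNge => th0']; move=> /ler_normlP[k1 k2].
    have -> : 0 <= gridpt k i by lra.
    by rewrite pnatr_eq0 eqb0 negbK => vw; rewrite mulr_ge0// subr_ge0.
  have -> : (0 <= gridpt k i) = false by apply/negbTE; rewrite -ltNge; lra.
  by rewrite pnatr_eq0 eqb0 negbK => vw; rewrite mulr_le0// ?subr_le0// ltW.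
have [thz|[i0 Ii0 ti0]] := thcase.
  apply: sumr_ge0 => i _; have [Ii|/sgn_side//] := boolP (I1 i).
  by rewrite thz// mul0r.
pose c := M%:R^-1 * (L1 + z0).
have c0 : 0 <= c by rewrite mulr_ge0 ?invr_ge0 ?addr_ge0.
have Hj (i : 'I_n) : margin (v i) (w j i) (gridpt k i) +
    ((if I1 i then eta * `|gridpt k i| else 0) - c) <= th i * (w j i - v i).
  rewrite /margin -/(I1 i); have [Ii|nI] := boolP (I1 i); last first.
    by have := sgn_side i nI; lra.
  have := hbox i; rewrite /box; have := Hk i; rewrite /th' -/(I1 i) Ii.
  rewrite pnatr_eq0 eqb0 negbK => kM wL.
  have wv : `|w j i - v i| <= L1 + z0.
    by apply: le_trans (ler_normB _ _) _; rewrite lerD.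
  have : `|(gridpt k i - th i) * (w j i - v i)| <= c by rewrite normrM ler_pM.
  by move=> /ler_normlP[]; lra.
apply: le_trans (ler_sum _ (fun i _ => Hj i)).
rewrite big_split/= addr_ge0// sumrB sumr_const card_ord subr_ge0.
apply: (@le_trans _ _ (eta / 2)).
  rewrite -(mulr_natr c) /c.
  have -> : M%:R^-1 * (L1 + z0) * n%:R = 2 * n%:R * (L1 + z0) / M%:R / 2.
    by field; rewrite gt_eqF.
  by rewrite ler_pM2r// ler_pdivrMr.
rewrite (bigD1 i0)//= Ii0; apply: ler_wpDr.
  by apply: sumr_ge0 => i _; case: ifP => // _; rewrite mulr_ge0// ltW.
rewrite ler_wpM2l ?(ltW eta0)//.
have := Hk i0; rewrite /th' Ii0.
have := ler_normD (gridpt k i0) (th i0 - gridpt k i0).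
rewrite (addrC (gridpt k i0)) subrK ti0 (distrC (th i0)); lra.
Qed.

End Separation.

(** * Many points *)

Section CapProbability.
Variables (R : realType) (mu : probability R R).

Lemma iint_ecst k (c : \bar R) : (0 <= c)%E -> iint mu k (fun=> c) = c.
Proof.
move=> c0; elim: k => //= k IH; rewrite (_ : (fun=> _) = cst c); last first.
  by apply/funext => x; rewrite IH.
by rewrite integral_cst//= [X in (_ * X)%E]probability_setT mule1.
Qed.

Lemma iint_coord k (F : R -> \bar R) (i : nat) : (i < k)%N ->
  (forall x, (0 <= F x)%E) -> iint mu k (fun v => F (v i)) = (\int[mu]_x F x)%E.
Proof.
move=> + F0; elim: k i => [//|k IH] [|i] ik /=.
  by apply: eq_integral => x _; rewrite iint_ecst.
rewrite (_ : (fun x => _) = cst (\int[mu]_x F x)%E); last first.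
  by apply/funext => x; rewrite /= IH.
by rewrite integral_cst//= [X in (_ * X)%E]probability_setT mule1.
Qed.

(** The quadratic exponent comes from counting grid directions; it is beaten by the cubic lower
    bound [(e * n / 3) ^+ 3] of [expR (e * n)]. *)
Lemma double_exp_beats (a b c e d : R) : 0 < c -> 0 < e -> 0 < d ->
  exists n0, forall n, (n0 <= n)%N ->
    expR (n%:R * (a * n%:R + b) - c * expR (e * n%:R)) <= d.
Proof.
move=> c0 e0 d0.
have e3 : 0 < c * (e / 3) ^+ 3 by rewrite mulr_gt0// exprn_gt0// divr_gt0.
have er : 0 <= expR (-1 : R) < 1 by rewrite expR_ge0/= -[ltRHS]expR0 ltr_expR oppr_lt0.
have [n1 Hn1] := expr_cvg0 er d0.
pose D := `|a| + `|b| + 1.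
exists (maxn 1 (maxn n1 (Num.truncn (D / (c * (e / 3) ^+ 3))).+1)) => n.
rewrite !geq_max => /and3P[n0 nn1 nn2]; apply: le_trans (Hn1 n nn1).
rewrite -expRM_natl ler_expR mulrN1.
have n1' : 1 <= n%:R :> R by rewrite ler1n.
have nD : D / (c * (e / 3) ^+ 3) <= n%:R.
  by apply: ltW; apply: lt_le_trans (Num.Theory.truncnS_gt _) _; rewrite ler_nat.
rewrite ler_pdivrMr// in nD.
have ex3 : (e / 3 * n%:R) ^+ 3 <= expR (e * n%:R).
  have -> : e * n%:R = 3%:R * (e / 3 * n%:R) by field.
  rewrite expRM_natl lerXn2r ?nnegrE ?expR_ge0//.
    by rewrite mulr_ge0// divr_ge0// ltW.
  by have := expR_ge1Dx (e / 3 * n%:R); lra.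
have H1 : D * n%:R ^+ 2 <= c * expR (e * n%:R).
  apply: (@le_trans _ _ (c * (e / 3 * n%:R) ^+ 3)); last by rewrite ler_wpM2l// ltW.
  have -> : c * (e / 3 * n%:R) ^+ 3 = n%:R * (c * (e / 3) ^+ 3) * n%:R ^+ 2 by ring.
  by rewrite ler_wpM2r// sqr_ge0.
have nn : n%:R <= n%:R ^+ 2 :> R by rewrite expr2 ler_peMl.
have h1 : a * n%:R ^+ 2 <= `|a| * n%:R ^+ 2 by rewrite ler_wpM2r ?sqr_ge0// ler_norm.
have h2 : b * n%:R <= `|b| * n%:R by rewrite ler_wpM2r// ler_norm.
have h3 : `|b| * n%:R <= `|b| * n%:R ^+ 2 by rewrite ler_wpM2l.
have -> : n%:R * (a * n%:R + b) = a * n%:R ^+ 2 + b * n%:R by ring.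
by move: H1; rewrite /D; lra.
Qed.

Lemma fine_muE (A : set R) : measurable A -> (fine (mu A))%:E = mu A.
Proof. by move=> mA; rewrite fineK// fin_num_measure. Qed.

Lemma fine_mu_ge0 (A : set R) : 0 <= fine (mu A).
Proof. by rewrite fine_ge0. Qed.

Lemma fine_mu_mono (A B : set R) : measurable A -> measurable B -> A `<=` B ->
  fine (mu A) <= fine (mu B).
Proof. by move=> mA mB AB; rewrite fine_le ?fin_num_measure// le_measure// inE. Qed.

Lemma integral_indicE (A : set R) : measurable A ->
  (\int[mu]_x (\1_A x : R)%:E = (fine (mu A))%:E)%E.
Proof. by move=> mA; rewrite integral_indic// setIT fine_muE. Qed.

Lemma measurable_le_r (v : R) : measurable [set w : R | v <= w].
Proof. by rewrite -set_itvcy; exact: measurable_itv. Qed.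

Lemma measurable_le_l (v : R) : measurable [set w : R | w <= v].
Proof. by rewrite -set_itvNyc; exact: measurable_itv. Qed.

Lemma measurable_box d (S : measurableType d) (z0 L1 : R) (v w : S -> R) (a : R) :
  measurable_fun setT v -> measurable_fun setT w ->
  measurable_fun setT (fun s => box z0 L1 (v s) (w s) a).
Proof.
move=> mv mw; have b2r (f : S -> bool) : measurable_fun setT f ->
    measurable_fun setT (fun s => (f s)%:R : R).
  move=> mf; have -> : (fun s => (f s)%:R : R) = (fun s => if f s then 1 else 0).
    by apply/funext => s; case: (f s).
  by apply: measurable_fun_ifT => //; exact: measurable_cst.
apply: measurable_fun_ifT; first by apply: measurable_fun_ler => //; exact: measurableT_comp.
  by apply: b2r; apply: measurable_fun_ler => //; exact: measurableT_comp.
by case: (0 <= a); apply: b2r; apply: measurable_fun_ler.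
Qed.

Lemma measurable_margin d (S : measurableType d) (z0 eta : R) (v w : S -> R) (a : R) :
  measurable_fun setT v -> measurable_fun setT w ->
  measurable_fun setT (fun s => margin z0 eta (v s) (w s) a).
Proof.
move=> mv mw.
apply: measurable_fun_ifT; first by apply: measurable_fun_ler => //; exact: measurableT_comp.
  by mfun_tac.
exact: measurable_cst.
Qed.

Lemma measurable_cap d (S : measurableType d) n (z0 L1 eta : R) (a : 'I_n -> R)
    (v w : S -> nat -> R) :
  (forall i, measurable_fun setT (fun s => v s i)) ->
  (forall i, measurable_fun setT (fun s => w s i)) ->
  measurable_fun setT (fun s => cap z0 L1 eta a (v s) (w s)).
Proof.
move=> mv mw; apply: measurable_funM.
  by apply: measurable_prod => i _; exact: measurable_box.
rewrite (_ : (fun s => _) = (fun s => if 0 <= \sum_(i < n) margin z0 eta (v s i) (w s i) (a i)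
  then 1 else 0)); last by apply/funext => s; case: ifP.
apply: measurable_fun_ifT; do ?exact: measurable_cst.
apply: measurable_fun_ler; first exact: measurable_cst.
by apply: measurable_sum => i; exact: measurable_margin.
Qed.

Variables (z0 L1 h gap B : R) (K : nat) (y : 'I_K.+1 -> R) (C : 'I_K.+1 -> set R).
Variables (nu De : bool -> R -> 'I_K.+1 -> R) (u : R -> R) (hr : R -> \bar R).
Let sg (s : bool) : R := if s then 1 else -1.
Hypothesis mu_even : even_measure mu.
Hypotheses (z00 : 0 <= z0) (L10 : 0 <= L1) (gap0 : 0 < gap) (h0 : h <= gap / 4) (B0 : 0 < B).
Hypotheses (mC : forall k, measurable (C k)) (C1 : forall x, \sum_k (\1_(C k) x : R) <= 1).
Hypotheses (Ch : forall k x, C k x -> `|x - y k| <= h) (CL : forall k x, C k x -> `|x| <= L1).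
Hypothesis (yL : forall k, `|y k| <= L1).
Hypothesis Hnu : forall s v, `|v| <= z0 -> [/\ forall k, 0 <= nu s v k,
  \sum_k nu s v k = 1, forall k, nu s v k <= fine (mu (C k)) * expR (u v + De s v k),
  \sum_k nu s v k * De s v k <= 0 & (forall k, `|De s v k| <= B) /\
  gap <= sg s * (\sum_k nu s v k * y k - v)].
Hypothesis Htail : forall v r, z0 < `|v| -> hr v = r%:E ->
  expR (- r) <= fine (mu `[`|v|, +oo[%classic).

Definition cost v : R := if `|v| <= z0 then u v else fine (hr v).

(** A coordinate with [|v i| <= z0] is discretised and tilted towards the sign of [a i]; any other
    one is reduced to the single state [ord0], of mass [mu (T i)], with a trivial tilt and weight 0
    in the half-space sum. Each good choice of states gives a product event inside the cap, and
    these events are disjoint. *)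
Lemma cap_prob_ge eps : 0 < eps -> exists n0, forall n, (n0 <= n)%N ->
  forall (a : 'I_n -> R) (v : nat -> R),
  (forall i : 'I_n, z0 < `|v i| -> hr (v i) \is a fin_num) ->
  ((gap / (4 * (L1 + z0 + gap)) * expR (- \sum_(i < n) cost (v i) - eps * n%:R))%:E <=
   iint mu n (fun w => (cap z0 L1 (gap / 4) a v w)%:E))%E.
Proof.
(* [L1 + z0 + gap] serves as the bound on [|y k - v i|] and is at least [gap], as [tilt_lower_bound]
   demands. *)
move=> eps0; have gapR : gap <= L1 + z0 + gap by rewrite lerDr addr_ge0.
have [n0 Hn0] := tilt_lower_bound eps0 B0 gap0 gapR.
exists n0 => n nn a v hfin.
pose I1 (i : 'I_n) := `|v i| <= z0.
pose T (i : 'I_n) := if 0 <= a i then [set w | v i <= w] else [set w | w <= v i].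
have mT i : measurable (T i).
  by rewrite /T; case: ifP => _; [exact: measurable_le_r | exact: measurable_le_l].
have muT (i : 'I_n) : fine (mu `[`|v i|, +oo[%classic) <= fine (mu (T i)).
  have m1 : measurable (`[`|v i|, +oo[%classic : set R) by exact: measurable_itv.
  rewrite /T; case: ifP => _.
    apply: fine_mu_mono => //; first exact: measurable_le_r.
    by move=> x /=; rewrite in_itv/= andbT; apply: le_trans; exact: ler_norm.
  rewrite -(mu_even m1); apply: fine_mu_mono => //.
  - rewrite -[X in measurable X]setTI; exact: oppr_measurable.
  - exact: measurable_le_l.
  - move=> x /=; rewrite in_itv/= andbT => vx.
    by have := ler_norm (- v i); rewrite normrN; lra.
pose g (i : 'I_n) (k : 'I_K.+1) : R -> R := if I1 i then \1_(C k) else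
  if k == ord0 then \1_(T i) else fun=> 0.
pose p (i : 'I_n) (k : 'I_K.+1) : R := if I1 i then fine (mu (C k)) else
  if k == ord0 then fine (mu (T i)) else 0.
pose nu' (i : 'I_n) (k : 'I_K.+1) : R := if I1 i then nu (0 <= a i) (v i) k else (k == ord0)%:R.
pose e' (i : 'I_n) (k : 'I_K.+1) : R := if I1 i then De (0 <= a i) (v i) k else 0.
pose z' (i : 'I_n) (k : 'I_K.+1) : R := if I1 i then a i * (y k - v i) else 0.
pose A' (i : 'I_n) : R := if I1 i then `|a i| else 0.
have g0 i k x : 0 <= g i k x.
  rewrite /g; case: ifP => _; first by rewrite indicE.
  by case: ifP => _ //; rewrite indicE.
have mg i k : measurable_fun setT (g i k).
  rewrite /g; case: ifP => _; first exact: measurable_indic.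
  by case: ifP => _; [exact: measurable_indic | exact: measurable_cst].
have gp i k : (\int[mu]_x (g i k x)%:E = (p i k)%:E)%E.
  rewrite /g /p; case: ifP => _; first exact: integral_indicE.
  by case: ifP => _; [exact: integral_indicE | rewrite integral_prob_cst].
have sumd (F : 'I_K.+1 -> R) : \sum_k (k == ord0)%:R * F k = F ord0.
  rewrite (bigD1 ord0)//= mul1r big1 ?addr0// => k /negbTE ->; by rewrite mul0r.
have H : gap / (4 * (L1 + z0 + gap)) * expR (- \sum_(i < n) cost (v i) - eps * n%:R) <=
  \sum_(f : {ffun 'I_n -> 'I_K.+1} | gap / 2 * \sum_i A' i <= \sum_i z' i (f i))
  \prod_i p i (f i).
  apply: (Hn0 n nn K.+1 p nu' e' z' (fun i : 'I_n => cost (v i)) A').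
  - by move=> i k; rewrite /p; do ?case: ifP => _ //; rewrite fine_mu_ge0.
  - by move=> i k; rewrite /nu'; case: ifPn => // /(Hnu (0 <= a i))[].
  - move=> i; rewrite /nu'; case: (boolP (I1 i)) => [/(Hnu (0 <= a i))[]//|_].
    by rewrite -[RHS](sumd (fun=> 1)); apply: eq_bigr => k _; rewrite mulr1.
  - move=> i k; rewrite /nu' /p /e' /cost -/(I1 i); case: ifPn => [/(Hnu (0 <= a i))[]//|nI].
    have [_|_] := eqVneq k ord0; last by rewrite mul0r.
    have vz : z0 < `|v i| by rewrite ltNge.
    have := Htail vz (esym (fineK (hfin i vz))).
    move=> /le_trans /(_ (muT i)) H1.
    by rewrite addr0 -ler_pdivrMr ?expR_gt0// mul1r -expRN.
  - move=> i; rewrite /nu' /e'; case: (boolP (I1 i)) => [/(Hnu (0 <= a i))[]//|_].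
    by rewrite big1// => k _; rewrite mulr0.
  - move=> i k; rewrite /e'; case: ifPn => [/(Hnu (0 <= a i))[_ _ _ _ []]//|_].
    by rewrite normr0 ltW.
  - move=> i k; rewrite /z' /A'; case: ifPn => [Ii|_]; last by rewrite normr0 mul0r.
    rewrite normrM ler_wpM2l//; apply: le_trans (ler_normB _ _) _.
    by rewrite -[leLHS]addr0; apply: lerD (ltW gap0); exact: lerD (yL k) Ii.
  - move=> i; rewrite /nu' /z' /A'; case: (boolP (I1 i)) => [Ii|_]; last first.
      by rewrite mul0r big1// => k _; rewrite mulr0.
    have [n0' n1 _ _ [_ hg]] := Hnu (0 <= a i) Ii.
    have -> : \sum_k nu (0 <= a i) (v i) k * (a i * (y k - v i)) =
        a i * (\sum_k nu (0 <= a i) (v i) k * y k - v i).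
      rewrite -[X in _ - X]mul1r -[X in _ - X * _]n1 mulr_suml -sumrB mulr_sumr.
      by apply: eq_bigr => k _; ring.
    move: hg; rewrite /sg; case: ifPn => [a0|].
      by rewrite mul1r (ger0_norm a0) => ?; rewrite ler_wpM2l.
    rewrite -ltNge mulN1r => a0; rewrite (ltr0_norm a0) => hg.
    by rewrite -[leRHS]mulrNN ler_wpM2l// oppr_ge0 ltW.
rewrite -lee_fin in H; apply: le_trans H _.
pose G (f : {ffun 'I_n -> 'I_K.+1}) (w : nat -> R) := \prod_(i < n) g i (f i) (w i).
have G0 f w : 0 <= G f w by apply: prodr_ge0.
have mG f : seqmfun (fun w => (G f w)%:E).
  move=> d S x mx; apply/measurable_EFinP; apply: measurable_prod => i _.
  by apply: measurableT_comp.
(* Replacing the cell point [y (f i)] by [w i] costs at most [gap / 4] per unit of [|a i|], so the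
   slack [gap / 2] of the discretised event leaves the slack [gap / 4] of the cap. *)
have Gcap (f : {ffun 'I_n -> 'I_K.+1}) (w : nat -> R) : gap / 2 * \sum_i A' i <= \sum_i z' i (f i) ->
    G f w <= G f w * cap z0 L1 (gap / 4) a v w.
  move=> fgood; have [->|Gn0] := eqVneq (G f w) 0; first by rewrite mul0r.
  have gi (i : 'I_n) : g i (f i) (w i) != 0 by have /prodf_neq0 := Gn0; exact.
  suff -> : cap z0 L1 (gap / 4) a v w = 1 by rewrite mulr1.
  have gC (i : 'I_n) : I1 i -> C (f i) (w i).
    move=> Ii; have := gi i; rewrite /g Ii indicE pnatr_eq0 eqb0 negbK inE//.
  rewrite /cap big1 ?mul1r.
    suff -> : (0 <= \sum_(i < n) margin z0 (gap / 4) (v i) (w i) (a i))%R by [].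
    have mz (i : 'I_n) : z' i (f i) - gap / 2 * A' i <= margin z0 (gap / 4) (v i) (w i) (a i).
      rewrite /margin /z' /A' -/(I1 i); case: ifPn => [Ii|_]; last by rewrite mulr0 subr0.
      have wy : `|a i * (w i - y (f i))| <= `|a i| * (gap / 4).
        by rewrite normrM ler_wpM2l//; apply: le_trans (Ch (gC i Ii)) h0.
      by move: wy => /ler_normlP[]; lra.
    apply: le_trans (ler_sum _ (fun i _ => mz i)).
    by rewrite sumrB -mulr_sumr subr_ge0.
  move=> i _; rewrite /box -/(I1 i); have [Ii|nI] := boolP (I1 i).
    by rewrite (CL (gC i Ii)).
  have := gi i; rewrite /g (negbTE nI); case: ifP => _; last by rewrite eqxx.
  rewrite indicE pnatr_eq0 eqb0 negbK inE /T.
  by case: ifP => _ /= ->.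
pose good (f : {ffun 'I_n -> 'I_K.+1}) := gap / 2 * \sum_i A' i <= \sum_i z' i (f i).
pose mid (w : nat -> R) := (\sum_(f | good f) (G f w)%:E)%E.
rewrite -/(good _); apply: (@le_trans _ _ (iint mu n mid)).
  have -> : mid = fun w => (\sum_(f <- [seq f <- index_enum _ | good f]) (G f w)%:E)%E.
    by apply/funext => w; rewrite big_filter.
  rewrite iint_sum; [|by move=> f w; rewrite lee_fin|exact: mG].
  rewrite -sumEFin -[leLHS]big_filter; apply: lee_sum => f _.
  have [i0|nz] := posnP n.
    subst n; rewrite /= /G !big_ord0//.
  pose gg (i : nat) : R -> R := if insub i is Some j then g j (f j) else fun=> 0.
  pose pp (i : nat) : R := if insub i is Some j then p j (f j) else 0.
  have ggE (i : 'I_n) : gg i = g i (f i) by rewrite /gg valK.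
  have ppE (i : 'I_n) : pp i = p i (f i) by rewrite /pp valK.
  have := @iint_prod _ mu n gg pp.
  rewrite (eq_bigr (fun i : 'I_n => p i (f i))) => [<-|i _]//.
  - by apply: le_iint => w; rewrite lee_fin /G; [apply: prodr_ge0 => i _; rewrite ggE
      | rewrite le_eqVlt; apply/orP; left; apply/eqP/eq_bigr => i _; rewrite ggE].
  - by move=> i x; rewrite /gg; case: insub.
  - by move=> i; rewrite /gg; case: insub => [j|]; [exact: mg | exact: measurable_cst].
  - move=> i ik; rewrite /gg /pp; case: insubP => [j _ _|]; first exact: gp.
    by rewrite ik.
apply: le_iint => w; first by apply: sume_ge0 => f _; rewrite lee_fin.
rewrite /mid sumEFin lee_fin.
apply: (@le_trans _ _ (\sum_(f : {ffun 'I_n -> 'I_K.+1}) G f w * cap z0 L1 (gap / 4) a v w)).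
  rewrite big_mkcond; apply: ler_sum => f _; case: ifPn => [|_]; first exact: Gcap.
  by rewrite mulr_ge0// cap_ge0.
rewrite -mulr_suml -[leRHS]mul1r ler_wpM2r ?cap_ge0// /G.
rewrite -(bigA_distr_bigA (fun (i : 'I_n) k => g i k (w i))).
apply: Num.Theory.prodr_ile1 => i _; rewrite sumr_ge0//=.
rewrite /g; case: (I1 i); first exact: C1.
rewrite (bigD1 ord0)//= big1 ?addr0 => [|k /negbTE -> //].
by rewrite indicE lern1 leq_b1.
Qed.

Hypotheses (mu_meas : measurable_fun setT u) (hr_meas : measurable_fun setT hr).
Hypothesis hr0 : forall v, (0 <= hr v)%E.
Let u1 v : R := if `|v| <= z0 then u v else 0.
Variable Bu : R.
Hypothesis u1B : forall v, `|u1 v| <= Bu.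
Local Notation E f := (Rintegral mu setT f).

(** The complement of the hull is majorised by [Psi1] (atypical sum of [u1]), [Psi2] (Markov for the
    tail costs) and [Psi3] (union over grid directions of the event that every point misses the
    cap), each of integral at most [delta / 3]. Of the four [eps], two bound the total cost, one is
    lost in the change of measure, and the last makes [N] times the cap probability grow like
    [expR (eps * n)]. *)
Lemma Emu_large eps delta : 0 < eps -> 0 < delta ->
  (\int[mu]_x hr x <= (eps * (delta / 3))%:E)%E ->
  exists n0, forall n, (n0 <= n)%N -> forall N,
    expR ((E u1 + 4 * eps) * n%:R) <= N%:R -> ((1 - delta)%:E <= Emu mu n N)%E.
Proof.
move=> eps0 d0 hrd.
have d30 : 0 < delta / 3 by rewrite divr_gt0.
have mu1 : measurable_fun setT u1.
  by apply: measurable_fun_ifT => //; apply: measurable_fun_ler => //; exact: measurableT_comp.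
have [[l r] /= [l0 r01 lr]] := iint_chernoff mu eps0 mu1 u1B.
have [n1 Hn1] := expr_cvg0 r01 d30.
have [n2 Hn2] := cap_prob_ge eps0.
set c0 := gap / (4 * (L1 + z0 + gap)) in Hn2.
have c00 : 0 < c0 by rewrite divr_gt0// mulr_gt0// ltr_wpDl// addr_ge0.
(* With [M = A * n + 2] the mesh condition of [cap_separation] holds for [eta = gap / 4], and there
   are [(2 * A * n + 5) ^ n] directions, hence the constants passed to [double_exp_beats]. *)
pose A := (Num.truncn (8 * (L1 + z0) / gap)).+1.
have [n3 Hn3] := double_exp_beats (2 * A%:R) 5 c00 eps0 d30.
exists (maxn (maxn n1 1) (maxn n2 n3)) => n.
rewrite !geq_max => /andP[/andP[nn1 n_gt0] /andP[nn2 nn3]] N HN.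
have n0' : 0 < n%:R :> R by rewrite ltr0n.
pose M := (A * n + 2)%N.
have M0 : (0 < M)%N by rewrite /M addn2.
have M2 : 2 <= M%:R :> R by rewrite /M natrD lerDr.
have HM : 2 * n%:R * (L1 + z0) <= gap / 4 * M%:R.
  have A1 : 8 * (L1 + z0) / gap <= A%:R.
    by rewrite ltW// /A; apply: Num.Theory.truncnS_gt.
  have A2 : 8 * (L1 + z0) <= A%:R * gap by rewrite -ler_pdivrMr.
  have A3 : n%:R * (8 * (L1 + z0)) <= n%:R * (A%:R * gap) by rewrite ler_wpM2l.
  have -> : M%:R = A%:R * n%:R + 2 :> R by rewrite /M natrD natrM.
  move: A3 gap0; move: (A%:R : R) => rA; lra.
pose GOOD := [set v : nat -> R | \sum_(i < n) u1 (v i) <= (E u1 + eps) * n%:R /\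
  (\sum_(i < n) hr (v i) <= (eps * n%:R)%:E)%E].
(* The cap probability is bounded below only for [v] in [GOOD], so [Psi3] carries this indicator. *)
pose gi (v : nat -> R) : R := \1_GOOD v.
pose Psi1 (v : nat -> R) := \prod_(i < n) expR (l * (u1 (v i) - E u1 - eps)).
pose Psi2 (v : nat -> R) := (((eps * n%:R)^-1)%:E * \sum_(i < n) hr (v i))%E.
pose miss (v w : nat -> R) (k : {ffun 'I_n -> 'I_(2 * M).+1}) (j : nat) :=
  1 - cap z0 L1 (gap / 4) (gridpt R k) v (fun i => w (j * n + i)%N).
pose Psi3 (w v : nat -> R) := gi v * \sum_(k : {ffun 'I_n -> 'I_(2 * M).+1})
  \prod_(j < N) miss v w k j.
pose Psi w v := ((Psi1 v)%:E + Psi2 v + (Psi3 w v)%:E)%E.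
have miss0 v w k j : 0 <= miss v w k j by rewrite subr_ge0 cap_le1.
have gi0 v : 0 <= gi v by rewrite /gi indicE.
have Psi10 v : 0 <= Psi1 v by apply: prodr_ge0 => i _; exact: expR_ge0.
have en0 : 0 <= (eps * n%:R)^-1 by rewrite invr_ge0 mulr_ge0// ltW.
have shr0 (v : nat -> R) : (0 <= \sum_(i < n) hr (v i))%E by apply: sume_ge0.
have Psi20 v : (0 <= Psi2 v)%E by rewrite mule_ge0.
have Psi30 w v : 0 <= Psi3 w v.
  by rewrite mulr_ge0// sumr_ge0// => k _; rewrite prodr_ge0.
have Psi0 w v : (0 <= Psi w v)%E by rewrite !adde_ge0 ?lee_fin.
have mPsi1 : seqmfun (fun v => (Psi1 v)%:E).
  move=> d S x mx; apply/measurable_EFinP; apply: measurable_prod => i _.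
  apply: measurableT_comp => //; mfun_tac.
  exact: (measurableT_comp mu1).
have mshr : seqmfun (fun v => \sum_(i < n) hr (v i))%E.
  by move=> d S x mx; apply: emeasurable_sum => i; exact: (measurableT_comp hr_meas).
have mPsi2 : seqmfun Psi2.
  by move=> d S x mx; apply: emeasurable_funM => //; exact: mshr.
have mgi d (S : measurableType d) (x : S -> nat -> R) :
    (forall i, measurable_fun setT (fun s => x s i)) ->
    measurable_fun setT (fun s => gi (x s)).
  move=> mx; rewrite (_ : (fun s => _) = \1_(x @^-1` GOOD)); last first.
    by apply/funext => s; rewrite /gi !indicE; congr (_%:R); apply/idP/idP; rewrite !inE.
  apply: measurable_indic; apply: measurableI.
    have : measurable_fun setT (fun s => \sum_(i < n) u1 (x s i)).
      by apply: measurable_sum => i; exact: (measurableT_comp mu1).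
    move=> /(_ measurableT _ (measurable_le_l ((E u1 + eps) * n%:R))).
    by rewrite setTI.
  have /emeasurable_fun_infty_c /(_ (eps * n%:R)%:E) : measurable_fun setT
    (fun s => \sum_(i < n) hr (x s i))%E by exact: mshr.
  by rewrite setTI; apply.
have mcap d (S : measurableType d) (x y' : S -> nat -> R) k (j : nat) :
    (forall i, measurable_fun setT (fun s => x s i)) ->
    (forall i, measurable_fun setT (fun s => y' s i)) ->
    measurable_fun setT (fun s => miss (y' s) (x s) k j).
  move=> mx my; apply: measurable_funB; first exact: measurable_cst.
  by apply: (measurable_cap _ _ _ _ my (w := fun s i => x s (j * n + i)%N)).
have mPsi3 : seqmfun2 (fun w v => (Psi3 w v)%:E).
  move=> d S x y' mx my; apply/measurable_EFinP; apply: measurable_funM; first exact: mgi.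
  apply: measurable_sum => k; apply: measurable_prod => j _; exact: mcap.
have mPsi : seqmfun2 Psi.
  move=> d S x y' mx my; apply: emeasurable_funD; last exact: mPsi3.
  by apply: emeasurable_funD; [exact: mPsi1 | exact: mPsi2].
have key (w v : nat -> R) : (1%:E <=
    ((\1_(hull (fun (j : 'I_N) (i : 'I_n) => w (j * n + i)%N)) (fun i : 'I_n => v i) : R)%:E
    + Psi w v))%E.
  set H := hull _; have [|nH] := pselect (H (fun i : 'I_n => v i)).
    by move=> ?; rewrite indicE mem_set// leeDl.
  rewrite indicE memNset// add0e.
  have [Hu|Hu] := leP (\sum_(i < n) u1 (v i)) ((E u1 + eps) * n%:R); last first.
    apply: (@le_trans _ _ (Psi1 v)%:E); last by rewrite /Psi -addeA leeDl// adde_ge0 ?lee_fin.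
    rewrite lee_fin /Psi1 -expR_sum -[leLHS]expR0 ler_expR -mulr_sumr.
    apply: mulr_ge0; first exact: ltW.
    rewrite 2!sumrB !sumr_const card_ord -(mulr_natr eps) -(mulr_natr (E u1)).
    by move: Hu; lra.
  have [Hh|Hh] := leP (\sum_(i < n) hr (v i))%E (eps * n%:R)%:E; last first.
    apply: (@le_trans _ _ (Psi2 v)); last first.
      by rewrite /Psi addeAC leeDr// adde_ge0 ?lee_fin.
    rewrite /Psi2 (_ : 1%:E = ((eps * n%:R)^-1)%:E * (eps * n%:R)%:E)%E; last first.
      by rewrite -EFinM mulVf// gt_eqF// mulr_gt0.
    by rewrite lee_wpmul2l// ltW.
  apply: (@le_trans _ _ (Psi3 w v)%:E); last by rewrite /Psi leeDr// adde_ge0 ?lee_fin.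
  rewrite lee_fin /Psi3 /gi indicE mem_set// mul1r.
  have g40 : 0 < gap / 4 by rewrite divr_gt0.
  have [k Hk] := @cap_separation _ _ _ _ z00 L10 g40 n N M v
    (fun (j : 'I_N) i => w (j * n + i)%N) M0 M2 HM nH.
  rewrite (bigD1 k)//= [X in X + _]big1 ?lerDl ?sumr_ge0//.
    by move=> k' _; rewrite prodr_ge0.
  by move=> j _; rewrite /miss Hk subr0.
(* [iint_mixed] is used twice, in x for a fixed sample and then in the sample: in both places only
   the error term enters as a measurable function. *)
have step (w : nat -> R) : (1%:E <= mu_n mu (hull (fun (j : 'I_N) (i : 'I_n) => w (j * n + i)%N))
    + iint mu n (Psi w))%E.
  apply: iint_mixed => // d S x mx.
  by apply: mPsi => // i; exact: measurable_cst.
have all1 : (1%:E <= Emu mu n N + iint mu (n * N) (fun w => iint mu n (Psi w)))%E.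
  apply: iint_mixed => [w|w||//].
  - by apply: iint_ge0 => v; rewrite lee_fin.
  - by apply: iint_ge0 => v.
  - exact: seqmfun2_iint.
suff PsiS : (iint mu (n * N) (fun w => iint mu n (Psi w)) <= delta%:E)%E.
  rewrite EFinB leeBlDr//; apply: le_trans all1 _; rewrite leeD2l//.
rewrite iint_swap//.
have inner v : (iint mu (n * N) (fun w => Psi w v) <= (Psi1 v)%:E + Psi2 v + (delta / 3)%:E)%E.
  have -> : (fun w => Psi w v) = (fun w => ((Psi1 v)%:E + Psi2 v) + (Psi3 w v)%:E)%E by [].
  rewrite iintD//; first last.
  - by move=> d S x mx; apply: mPsi3 => // i; exact: measurable_cst.
  - by move=> w; rewrite lee_fin.
  - by move=> w; rewrite adde_ge0 ?lee_fin.
  rewrite iint_ecst ?adde_ge0 ?lee_fin// leeD2l//.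
  have [Gv|nGv] := pselect (GOOD v); last first.
    rewrite (@eq_iint _ _ _ _ (fun=> 0%:E)) ?iint_cst ?lee_fin ?ltW// => w.
    by rewrite /Psi3 /gi indicE memNset// mul0r.
  have [Gu Gh] := Gv.
  have hfin (i : 'I_n) : hr (v i) \is a fin_num.
    rewrite ge0_fin_numE//; apply: le_lt_trans (ltry (eps * n%:R)).
    by apply: le_trans Gh; rewrite (bigD1 i)//= leeDl// sume_ge0.
  have cost_le : \sum_(i < n) cost (v i) <= (E u1 + 2 * eps) * n%:R.
    apply: (@le_trans _ _ (\sum_(i < n) u1 (v i) + \sum_(i < n) fine (hr (v i)))).
      rewrite -big_split; apply: ler_sum => i _ /=; rewrite /cost /u1.
      by case: ifP => _; rewrite ?add0r// lerDl fine_ge0.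
    have : \sum_(i < n) fine (hr (v i)) <= eps * n%:R.
      rewrite -lee_fin -sumEFin; apply: le_trans Gh; apply: lee_sum => i _.
      by rewrite fineK.
    by move: Gu; lra.
  pose beta (k : {ffun 'I_n -> 'I_(2 * M).+1}) :=
    fine (iint mu n (fun w => (cap z0 L1 (gap / 4) (gridpt R k) v w)%:E)).
  have mc k : seqmfun (fun w => (cap z0 L1 (gap / 4) (gridpt R k) v w)%:E).
    by move=> d S x mx; apply/measurable_EFinP; apply: measurable_cap => // i; exact: measurable_cst.
  have cap1 k : (iint mu n (fun w => (cap z0 L1 (gap / 4) (gridpt R k) v w)%:E) <= 1)%E.
    rewrite -[leRHS](iint_cst mu n 1); apply: le_iint => w; rewrite lee_fin.
      exact: cap_ge0.
    exact: cap_le1.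
  have capE k : iint mu n (fun w => (cap z0 L1 (gap / 4) (gridpt R k) v w)%:E) = (beta k)%:E.
    rewrite /beta fineK// ge0_fin_numE.
      by apply: (@le_lt_trans _ _ 1%E) => //; rewrite ltry.
    by apply: iint_ge0 => w; rewrite lee_fin cap_ge0.
  have missE k : iint mu n (fun w => (1 - cap z0 L1 (gap / 4) (gridpt R k) v w)%:E) =
      (1 - beta k)%:E.
    have : (iint mu n (fun w => (1 - cap z0 L1 (gap / 4) (gridpt R k) v w)%:E) + (beta k)%:E
        = 1%:E)%E.
      rewrite -capE -iintD//.
      - rewrite -[RHS](iint_cst mu n 1); apply: eq_iint => w.
        by rewrite -EFinD subrK.
      - by move=> w; rewrite lee_fin subr_ge0 cap_le1.
      - by move=> w; rewrite lee_fin cap_ge0.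
      - move=> d S x mx; apply/measurable_EFinP; apply: measurable_funB.
          exact: measurable_cst.
        by apply: measurable_cap => // i; exact: measurable_cst.
    by case: (iint _ _ _) => [q| |] //= [] H; congr (_%:E); lra.
  have beta1 k : 0 <= 1 - beta k by rewrite subr_ge0 -lee_fin -capE.
  have beta_ge k : c0 * expR (- (E u1 + 3 * eps) * n%:R) <= beta k.
    rewrite -lee_fin -capE; apply: le_trans (Hn2 n nn2 (gridpt R k) v _); last by move=> i _.
    rewrite lee_fin ler_wpM2l ?ler_expR ?(ltW c00)//; move: cost_le; lra.
  rewrite /Psi3 /gi indicE mem_set//.
  have -> : (fun w => (1%:R * \sum_(k : {ffun 'I_n -> 'I_(2 * M).+1}) \prod_(j < N) miss v w k j)%:E) =
    (fun w => \sum_(k : {ffun 'I_n -> 'I_(2 * M).+1}) (\prod_(j < N) miss v w k j)%:E)%E.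
    by apply/funext => w; rewrite mul1r sumEFin.
  rewrite iint_sum; first last.
  - move=> k d S x mx; apply/measurable_EFinP; apply: measurable_prod => j _.
    by apply: mcap => // i; exact: measurable_cst.
  - by move=> k w; rewrite lee_fin prodr_ge0.
  have blk k : iint mu (n * N) (fun w => (\prod_(j < N) miss v w k j)%:E) = ((1 - beta k) ^+ N)%:E.
    rewrite -[in RHS](card_ord N) -prodr_const.
    apply: (iint_blocks (g := fun=> fun w => 1 - cap z0 L1 (gap / 4) (gridpt R k) v w)
      (c := fun=> 1 - beta k)).
    - by move=> _ w; rewrite subr_ge0 cap_le1.
    - move=> _ d S x mx; apply/measurable_EFinP; apply: measurable_funB.
        exact: measurable_cst.
      by apply: measurable_cap => // i; exact: measurable_cst.
    - move=> _ w w' ww'; congr (1 - _); rewrite /cap; congr (_ * _).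
        by apply: eq_bigr => i _; rewrite ww'.
      by congr (nat_of_bool (0 <= _))%:R; apply: eq_bigr => i _; rewrite ww'.
    - by move=> _ _; exact: missE.
  have bN k : (1 - beta k) ^+ N <= expR (- c0 * expR (eps * n%:R)).
    apply: (@le_trans _ _ (expR (- beta k) ^+ N)).
      by rewrite lerXn2r ?nnegrE ?expR_ge0//; have := expR_ge1Dx (- beta k); lra.
    rewrite -expRM_natl ler_expR mulNr mulrN lerN2.
    apply: (@le_trans _ _ (expR ((E u1 + 4 * eps) * n%:R) * (c0 * expR (- (E u1 + 3 * eps) * n%:R)))).
      rewrite mulrCA -expRD ler_wpM2l ?(ltW c00)// ler_expR; lra.
    by rewrite ler_pM// ?expR_ge0// mulr_ge0 ?expR_ge0 ?(ltW c00).
  apply: (@le_trans _ _ (\sum_(k : {ffun 'I_n -> 'I_(2 * M).+1}) (expR (- c0 * expR (eps * n%:R)))%:E)%E).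
    by apply: lee_sum => k _; rewrite blk lee_fin.
  rewrite sumEFin lee_fin sumr_const card_ffun !card_ord -(mulr_natr (expR _)) natrX.
  have cnt : ((2 * M).+1%:R : R) ^+ n <= expR (n%:R * (2 * A%:R * n%:R + 5)).
    rewrite -[X in expR X]/(_ * _) expRM_natl lerXn2r ?nnegrE ?expR_ge0//.
    have := expR_ge1Dx (2 * A%:R * n%:R + 5 : R).
    have -> : (2 * M).+1%:R = 2 * (A%:R * n%:R + 2) + 1 :> R.
      by rewrite -addn1 natrD natrM /M natrD natrM.
    move: (A%:R : R) => rA; lra.
  apply: le_trans (Hn3 n nn3); rewrite mulrC.
  apply: (@le_trans _ _ (expR (n%:R * (2 * A%:R * n%:R + 5)) * expR (- c0 * expR (eps * n%:R)))).
    by rewrite ler_wpM2r ?expR_ge0.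
  by rewrite -expRD mulNr.
apply: (@le_trans _ _ (iint mu n (fun v => ((Psi1 v)%:E + Psi2 v) + (delta / 3)%:E)%E)).
  by apply: le_iint => v; [apply: iint_ge0 => w | exact: inner].
rewrite iintD//; first last.
- by move=> d S x mx; apply: emeasurable_funD; [exact: mPsi1 | exact: mPsi2].
- by move=> v; rewrite lee_fin ltW.
- by move=> v; rewrite adde_ge0 ?lee_fin.
rewrite iint_cst iintD//.
rewrite [leRHS](_ : _ = (delta / 3 + delta / 3 + delta / 3)%:E); last first.
  by congr (_%:E); field.
rewrite !EFinD leeD2r// leeD//.
  by apply: le_trans (lr n) _; rewrite lee_fin Hn1.
rewrite iintZ// iint_sum//; last first.
  by move=> i d S x mx; exact: (measurableT_comp hr_meas).
apply: (@le_trans _ _ (((eps * n%:R)^-1)%:E * \sum_(i < n) (eps * (delta / 3))%:E)%E).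
  by rewrite lee_wpmul2l ?lee_fin//; apply: lee_sum => i _; rewrite iint_coord.
rewrite sumEFin sumr_const card_ord -EFinM lee_fin -mulr_natr le_eqVlt; apply/orP; left.
by apply/eqP; field; rewrite !gt_eqF.
Qed.

End CapProbability.

(** * Tails *)

Section Tail.
Variables (R : realType) (mu : probability R R).

Definition tail (x : R) : R := fine (mu `[x, +oo[%classic).

Lemma tailE x : (tail x)%:E = mu `[x, +oo[%classic.
Proof. by rewrite fine_muE. Qed.

Lemma tail_ge0 x : 0 <= tail x. Proof. exact: fine_mu_ge0. Qed.

Lemma tail_nincr x y : x <= y -> tail y <= tail x.
Proof.
move=> xy; apply: fine_mu_mono => // z /=; rewrite !in_itv/= !andbT.
exact: le_trans.
Qed.

Lemma measurable_tail : measurable_fun setT tail.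
Proof. by apply: nonincreasing_measurable => // x y; exact: tail_nincr. Qed.

Lemma mu_bigcup_le (F : (set R)^nat) (c : \bar R) : (forall n, measurable (F n)) ->
  {homo F : n m / (n <= m)%N >-> (n <= m)%O} -> (forall n, (mu (F n) <= c)%E) ->
  (mu (\bigcup_n F n) <= c)%E.
Proof.
move=> mF homoF Fc.
have H : mu \o F @ \oo --> mu (\bigcup_n F n).
  exact: (nondecreasing_cvg_mu (mu := mu) mF (bigcup_measurable (fun n _ => mF n)) homoF).
rewrite -(cvg_lim _ H)//; apply: lime_le; last by near=> n; exact: Fc.
by apply/cvg_ex; eexists; exact: H.
Unshelve. all: by end_near. Qed.

Lemma mu_bigcap_small (F : (set R)^nat) : (forall n, measurable (F n)) ->
  {homo F : n m / (n <= m)%N >-> (m <= n)%O} -> mu (\bigcap_n F n) = 0%E ->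
  forall e, 0 < e -> exists n, (mu (F n) <= e%:E)%E.
Proof.
move=> mF homoF F0 e e0.
have fin : (mu (F 0%N) < +oo)%E by rewrite -ge0_fin_numE// fin_num_measure.
have H : mu \o F @ \oo --> mu (\bigcap_n F n).
  exact: (nonincreasing_cvg_mu (mu := mu) fin mF (bigcapT_measurable mF) homoF).
have {}H : mu \o F @ \oo --> (0%:E : \bar R) by move: H; rewrite F0.
have /fine_cvgP[_ /cvgrPdist_le /(_ e e0)[n _ Hn]] := H.
exists n; have := Hn n (leqnn n); rewrite sub0r normrN /= ger0_norm; last exact: fine_mu_ge0.
by rewrite -lee_fin fine_muE.
Qed.

(** Let y be the infimum of the set. Either [tail y <= s] and the set lies in the half-line from y,
    or y itself is excluded and the set is covered by the increasing half-lines from [y + 1/(n+1)],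
    each of mass at most [s]. *)
Lemma mu_low_tail (s : R) : 0 <= s ->
  (mu [set v : R | ((0 <= v) && (tail v <= s))%R] <= s%:E)%E.
Proof.
move=> s0; set Q := [set v | _].
have mQ : measurable Q.
  rewrite (_ : Q = [set v | 0 <= v] `&` (tail @^-1` [set w | w <= s])); last first.
    by apply/seteqP; split => v; [move=> /andP[]|move=> [h1 h2]; apply/andP].
  apply: measurableI; first exact: measurable_le_r.
  by rewrite -[X in measurable X]setTI; apply: measurable_tail => //; exact: measurable_le_l.
have [[q Qq]|nQ] := pselect (Q !=set0); last first.
  have -> : Q = set0 by apply/seteqP; split => // v Qv; case: nQ; exists v.
  by rewrite measure0 lee_fin.
have hiQ : has_inf Q by split; [exists q | exists 0 => v /andP[]].
have lbQ v : Q v -> inf Q <= v by move=> Qv; apply: ge_inf => //; case: hiQ.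
have yinf : 0 <= inf Q by apply: lb_le_inf; [exists q | move=> v /andP[]].
have [Gy|Gy] := leP (tail (inf Q)) s.
  apply: (@le_trans _ _ (mu `[inf Q, +oo[%classic)); last by rewrite -tailE lee_fin.
  apply: le_measure; rewrite ?inE//.
  by move=> v Qv /=; rewrite in_itv/= andbT lbQ.
pose F n := `[inf Q + n.+1%:R^-1, +oo[%classic.
apply: (@le_trans _ _ (mu (\bigcup_n F n))).
  apply: le_measure; rewrite ?inE//; first by apply: bigcup_measurable => n _; exact: measurable_itv.
  move=> v Qv; have vy : inf Q < v.
    rewrite lt_neqAle lbQ// andbT; apply/eqP => vE.
    by move: Qv => /andP[_]; rewrite -vE leNgt Gy.
  have : 0 < v - inf Q by rewrite subr_gt0.
  move=> /ltr_add_invr[n]; rewrite add0r => Hn.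
  by exists n => //; rewrite /F /= in_itv/= andbT -lerBrDl ltW.
apply: mu_bigcup_le => [n|n m nm|n].
- exact: measurable_itv.
- apply/subsetPset => v; rewrite /F /= !in_itv/= !andbT; apply: le_trans.
  by rewrite lerD2l lef_pV2 ?posrE// ler_nat.
- rewrite -tailE lee_fin.
  have n10 : 0 < n.+1%:R^-1 :> R by rewrite invr_gt0.
  have [v Qv vn] := inf_adherent n10 hiQ.
  by move: Qv => /andP[_]; apply: le_trans; apply: tail_nincr; exact: ltW.
Qed.

Hypothesis mu_even : even_measure mu.

Lemma mu_low_tail_abs (s : R) : 0 <= s ->
  (mu [set v : R | (tail `|v| <= s)%R] <= (2 * s)%:E)%E.
Proof.
move=> s0; set Q := [set v : R | ((0 <= v) && (tail v <= s))%R].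
have mQ : measurable Q.
  rewrite (_ : Q = [set v | 0 <= v] `&` (tail @^-1` [set w | w <= s])); last first.
    by apply/seteqP; split => v; [move=> /andP[]|move=> [h1 h2]; apply/andP].
  apply: measurableI; first exact: measurable_le_r.
  by rewrite -[X in measurable X]setTI; apply: measurable_tail => //; exact: measurable_le_l.
have mQN : measurable ((fun x : R => - x) @^-1` Q).
  by rewrite -[X in measurable X]setTI; exact: oppr_measurable.
have QE : [set v : R | (tail `|v| <= s)%R] = Q `|` ((fun x => - x) @^-1` Q).
  apply/seteqP; split => v /=.
    have [v0|v0] := leP 0 v.
      by rewrite (ger0_norm v0) => H; left; rewrite /Q /= v0 H.
    by rewrite (ltr0_norm v0) => H; right; rewrite /Q /= H oppr_ge0 ltW.
  by move=> [|] /andP[v0 H]; [rewrite (ger0_norm v0) | rewrite -normrN (ger0_norm v0)].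
rewrite QE; apply: le_trans (measureU2 _ mQ mQN) _.
rewrite [X in (_ + X)%E](mu_even mQ) mulr2n mulrDl mul1r EFinD.
by rewrite leeD// mu_low_tail.
Qed.

Variables (z0 : R) (J : nat).

Let S k := [set v : R | (z0 < `|v|) && (tail `|v| <= 2 ^- (J + k))].

(* For [|v| > z0] this dominates [- log2 (tail |v|)]: the series counts the [k]
   with [tail |v| <= 2 ^- (J + k)]. *)
Definition tail_cost (v : R) : \bar R :=
  ((J%:R * \1_[set v : R | z0 < `|v|] v : R)%:E + \sum_(0 <= k <oo) (\1_(S k) v : R)%:E)%E.

Let mS k : measurable (S k).
Proof.
rewrite (_ : S k = ((@Num.norm _ R) @^-1` ~` [set w | w <= z0]) `&`
    ((tail \o (@Num.norm _ R)) @^-1` [set w | w <= 2 ^- (J + k)])).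
  apply: measurableI; rewrite -[X in measurable X]setTI.
    by apply: normr_measurable => //; apply: measurableC; exact: measurable_le_l.
  have : measurable_fun setT (tail \o (@Num.norm _ R)).
    by apply: measurableT_comp; [exact: measurable_tail | exact: normr_measurable].
  by apply => //; exact: measurable_le_l.
apply/seteqP; split => v /=; rewrite /S/=.
  by move=> /andP[h1 h2]; split => //; apply/negP; rewrite -ltNge.
by move=> [/negP h1 h2]; rewrite ltNge h1.
Qed.

Let mz : measurable [set v : R | z0 < `|v|].
Proof.
rewrite (_ : [set v | _] = (@Num.norm _ R) @^-1` ~` [set w | w <= z0]).
  rewrite -[X in measurable X]setTI.
  by apply: normr_measurable => //; apply: measurableC; exact: measurable_le_l.
apply/seteqP; split => v /=; first by move=> h; apply/negP; rewrite -ltNge.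
by move=> /negP h; rewrite ltNge h.
Qed.

Let ind0 k v : (0 <= (\1_(S k) v : R)%:E)%E.
Proof. by rewrite lee_fin indicE. Qed.

Lemma tail_cost_ge0 v : (0 <= tail_cost v)%E.
Proof.
apply: adde_ge0; first by rewrite lee_fin mulr_ge0// indicE.
by apply: nneseries_ge0 => k _ _.
Qed.

Let mser : measurable_fun setT (fun v => \sum_(0 <= k <oo) (\1_(S k) v : R)%:E)%E.
Proof.
apply: (ge0_emeasurable_sum (P := xpredT)) => // k _.
by apply/measurable_EFinP; exact: measurable_indic.
Qed.

Let mfst : measurable_fun setT (fun v => (J%:R * \1_[set v : R | z0 < `|v|] v : R)%:E).
Proof.
apply/measurable_EFinP; apply: measurable_funM; first exact: measurable_cst.
exact: measurable_indic.
Qed.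

Lemma measurable_tail_cost : measurable_fun setT tail_cost.
Proof. exact: emeasurable_funD. Qed.

(** For the least m with [2 ^- (J + m) < tail |v|], the first m terms of the series are 1, so
    [r >= J + m], and [expR (- (J + m)) <= 2 ^- (J + m)]. If no such m existed, the series would
    diverge, against the finiteness of [r]. *)
Lemma tail_cost_bound v r : z0 < `|v| -> tail_cost v = r%:E -> expR (- r) <= tail `|v|.
Proof.
move=> vz; rewrite /tail_cost indicE mem_set// mulr1 => E.
have part m : (forall k, (k < m)%N -> tail `|v| <= 2 ^- (J + k)) -> (J + m)%:R <= r.
  move=> H; rewrite -lee_fin -E natrD EFinD leeD2l//.
  apply: le_trans (nneseries_lim_ge m _); last by move=> k _ _.
  rewrite sumEFin lee_fin big_mkord (eq_bigr (fun=> 1)).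
    by rewrite sumr_const card_ord.
  by move=> k _; rewrite indicE mem_set//; apply/andP; split => //; exact: H.
have e2 m : expR (- m%:R) <= 2 ^- m :> R.
  rewrite expRN lef_pV2 ?posrE ?expR_gt0// ?exprn_gt0//.
  rewrite -[m%:R]mulr1 expRM_natl lerXn2r ?nnegrE ?expR_ge0//.
  by have := expR_ge1Dx (1 : R); lra.
have [[m Hm]|H] := pselect (exists m, 2 ^- (J + m) < tail `|v|).
  have ex : exists m, (2 ^- (J + m) < tail `|v|) by exists m.
  have Hmin := ex_minnP ex; case: Hmin => m0 Hm0 m0min.
  have rm : (J + m0)%:R <= r.
    apply: part => k km; rewrite leNgt; apply/negP => /m0min; rewrite leqNgt km//.
  apply: (@le_trans _ _ (expR (- (J + m0)%:R))); first by rewrite ler_expR lerN2.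
  by apply: le_trans (e2 _) (ltW Hm0).
have rm m : (J + m)%:R <= r.
  by apply: part => k km; rewrite leNgt; apply/negP => Hk; apply: H; exists k.
have r0 : 0 <= r by apply: le_trans (rm 0%N).
have := rm (Num.truncn r).+1; rewrite natrD leNgt => /negP; case.
by apply: lt_le_trans (Num.Theory.truncnS_gt r) _; rewrite lerDr.
Qed.

(** By [mu_low_tail_abs] the k-th set has mass at most [2 * 2 ^- (J + k)]; these sum to
    [4 * 2 ^- J]. *)
Lemma integral_tail_cost : (\int[mu]_v tail_cost v <=
  (J%:R * fine (mu [set v : R | (z0 < `|v|)%R]) + 4 * 2 ^- J)%:E)%E.
Proof.
rewrite ge0_integralD//; last by move=> v _; apply: nneseries_ge0 => k _ _.
rewrite EFinD leeD//.
  have -> : (fun v => (J%:R * \1_[set v : R | z0 < `|v|] v)%:E) =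
    (fun v => J%:R%:E * (\1_[set v : R | z0 < `|v|] v : R)%:E)%E.
    by apply/funext => v; rewrite EFinM.
  rewrite ge0_integralZl//.
  - by rewrite integral_indicE// -EFinM.
  - by apply/measurable_EFinP; exact: measurable_indic.
rewrite integral_nneseries//; last first.
  by move=> k; apply/measurable_EFinP; exact: measurable_indic.
have h4 : 0 <= 4 * 2 ^- J :> R by rewrite mulr_ge0// invr_ge0 exprn_ge0.
apply: le_trans (epsilon_trick0 xpredT h4); apply: lee_nneseries => [k _ _|k _].
  by apply: integral_ge0 => v _.
rewrite integral_indicE// fine_muE//.
apply: (@le_trans _ _ (mu [set v : R | (tail `|v| <= 2 ^- (J + k))%R])).
  apply: le_measure; rewrite ?inE//; last by move=> v /andP[].
  have : measurable_fun setT (tail \o (@Num.norm _ R)).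
    by apply: measurableT_comp; [exact: measurable_tail | exact: normr_measurable].
  move=> /(_ measurableT _ (measurable_le_l (2 ^- (J + k)))); by rewrite setTI.
apply: le_trans (mu_low_tail_abs _) _; first by rewrite invr_ge0 exprn_ge0.
rewrite lee_fin natrX exprD exprS le_eqVlt; apply/orP; left; apply/eqP.
by field; rewrite !expf_neq0.
Qed.

End Tail.

(** * Tilts of a discretised law *)

Section FiniteTilt.
Variables (R : realType) (m : nat) (p y : 'I_m -> R) (L : R).
Hypotheses (p0 : forall k, 0 <= p k) (yL : forall k, `|y k| <= L) (sp : 0 < \sum_k p k).
Hypotheses (p_sym : forall k, p (rev_ord k) = p k) (y_sym : forall k, y (rev_ord k) = - y k).

Definition Zf t : R := \sum_k p k * expR (t * y k).
Definition tilt t k : R := p k * expR (t * y k) / Zf t.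
Definition tmean t : R := \sum_k tilt t k * y k.
(** The Legendre transform of [ln Zf] at the point [tmean t]. *)
Definition tcost t : R := t * tmean t - ln (Zf t).

Lemma rev_sum (F : 'I_m -> R) : \sum_k F (rev_ord k) = \sum_k F k.
Proof. by rewrite [RHS](reindex_inj rev_ord_inj). Qed.

Lemma Zf_even t : Zf (- t) = Zf t.
Proof.
rewrite /Zf -rev_sum; apply: eq_bigr => k _.
by rewrite p_sym y_sym mulrNN.
Qed.

(** Averaging with the reflected sum turns each exponential into a hyperbolic cosine, which is at
    least 1. *)
Lemma Zf_ge t : \sum_k p k <= Zf t.
Proof.
have -> : Zf t = \sum_k p k * ((expR (t * y k) + expR (- (t * y k))) / 2).
  apply: (@mulfI _ 2); first by [].
  rewrite mulr_natl mulr2n -{2}Zf_even -big_split mulr_sumr /=.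
  by apply: eq_bigr => k _; rewrite mulNr; field.
apply: ler_sum => k _; rewrite -[leLHS]mulr1 ler_wpM2l//.
have := expR_ge1Dx (t * y k); have := expR_ge1Dx (- (t * y k)); lra.
Qed.

Lemma Zf_gt0 t : 0 < Zf t.
Proof. by have := sp; have := Zf_ge t; lra. Qed.

Lemma tilt_ge0 t k : 0 <= tilt t k.
Proof. by rewrite divr_ge0 ?mulr_ge0 ?expR_ge0// ltW// Zf_gt0. Qed.

Lemma tilt_sum1 t : \sum_k tilt t k = 1.
Proof. by rewrite -mulr_suml -/(Zf t) divff// gt_eqF// Zf_gt0. Qed.

(** The log-density is the constant [tcost t] plus a fluctuation of tilted mean 0, the form required
    by [tilt_lower_bound]. *)
Lemma tiltE t k : tilt t k = p k * expR (tcost t + t * (y k - tmean t)).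
Proof.
have -> : tcost t + t * (y k - tmean t) = t * y k - ln (Zf t) by rewrite /tcost; ring.
by rewrite expRD expRN lnK ?posrE ?Zf_gt0// /tilt mulrA.
Qed.

Lemma tilt_center t : \sum_k tilt t k * (t * (y k - tmean t)) = 0.
Proof.
rewrite (eq_bigr (fun k => t * (tilt t k * y k) - t * tmean t * tilt t k)); last first.
  by move=> k _; ring.
by rewrite sumrB -!mulr_sumr tilt_sum1 mulr1 -/(tmean t) subrr.
Qed.

Lemma tmean0 : tmean 0 = 0.
Proof.
apply/eqP; rewrite -[_ == 0](mulrn_eq0 _ 2) mulr2n; apply/eqP.
rewrite {2}/tmean -rev_sum -big_split big1//= => k _.
by rewrite /tilt p_sym y_sym !mul0r; ring.
Qed.

Lemma tmean_le t : `|tmean t| <= L.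
Proof.
apply: le_trans (ler_norm_sum _ _ _) _.
rewrite -[leRHS]mul1r -(tilt_sum1 t) mulr_suml; apply: ler_sum => k _.
by rewrite normrM (ger0_norm (tilt_ge0 _ _)) ler_wpM2l// tilt_ge0.
Qed.

Lemma Zf_ratio s t tau : `|t - s| <= tau -> Zf t <= expR (tau * L) * Zf s.
Proof.
move=> st; rewrite mulr_sumr; apply: ler_sum => k _.
rewrite mulrCA ler_wpM2l// -expRD ler_expR.
have : `|(t - s) * y k| <= tau * L by rewrite normrM ler_pM.
by have := ler_norm ((t - s) * y k); lra.
Qed.

Lemma tilt_ratio s t tau k : `|t - s| <= tau -> tilt t k <= expR (2 * tau * L) * tilt s k.
Proof.
move=> st; rewrite /tilt mulrA ler_pdivlMr ?Zf_gt0// mulrAC ler_pdivrMr ?Zf_gt0//.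
have st' : `|s - t| <= tau by rewrite distrC.
have Zr := Zf_ratio st'.
have h : `|(t - s) * y k| <= tau * L by rewrite normrM ler_pM.
have e1 : expR (t * y k) <= expR (tau * L) * expR (s * y k).
  by rewrite -expRD ler_expR; have := ler_norm ((t - s) * y k); lra.
have -> : expR (2 * tau * L) = expR (tau * L) * expR (tau * L).
  by rewrite -expRD; congr expR; ring.
apply: (@le_trans _ _ (p k * (expR (tau * L) * expR (s * y k)) * (expR (tau * L) * Zf t))).
  apply: ler_pM => //; first by rewrite mulr_ge0 ?expR_ge0.
    exact: ltW (Zf_gt0 _).
  by rewrite ler_wpM2l.
by rewrite le_eqVlt; apply/orP; left; apply/eqP; ring.
Qed.

(** Adding [L] to the values makes them nonnegative, so that the comparison of weights in
    [tilt_ratio] applies term by term. *)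
Lemma tmean_lip s t tau : `|t - s| <= tau ->
  tmean t - tmean s <= (expR (2 * tau * L) - 1) * (2 * L).
Proof.
move=> st.
have tau0 : 0 <= tau by exact: le_trans st.
have L0 : 0 <= L by exact: le_trans (tmean_le 0).
have E r : \sum_k tilt r k * L = L.
  by rewrite -[RHS]mul1r -(tilt_sum1 r) mulr_suml.
have -> : tmean t - tmean s = \sum_k (tilt t k - tilt s k) * (y k + L).
  rewrite (eq_bigr (fun k => tilt t k * y k - tilt s k * y k + (tilt t k * L - tilt s k * L))).
    by rewrite big_split /= !sumrB !E subrr addr0.
  by move=> k _; ring.
rewrite -[leRHS]mul1r -[X in X * _](tilt_sum1 s) mulr_suml; apply: ler_sum => k _.
have yk := yL k; have /ler_normlP[y1 y2] := yk.
apply: (@le_trans _ _ ((expR (2 * tau * L) - 1) * tilt s k * (y k + L))).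
  rewrite ler_wpM2r//; first lra.
  by have := tilt_ratio k st; lra.
have -> : tilt s k * ((expR (2 * tau * L) - 1) * (2 * L)) =
  (expR (2 * tau * L) - 1) * tilt s k * (2 * L) by ring.
apply: ler_wpM2l; last by lra.
rewrite mulr_ge0 ?tilt_ge0// subr_ge0 -[leLHS]expR0 ler_expR.
by rewrite !mulr_ge0.
Qed.

Lemma tcost_lip T s t tau : 0 <= s -> s <= t -> t <= T -> t - s <= tau ->
  tcost t - tcost s <= T * ((expR (2 * tau * L) - 1) * (2 * L)) + 2 * tau * L.
Proof.
move=> s0 st tT sttau.
have ab : `|t - s| <= tau by rewrite ger0_norm// subr_ge0.
have ab' : `|s - t| <= tau by rewrite distrC.
have lip := tmean_lip ab.
have L0 : 0 <= L by exact: le_trans (tmean_le 0).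
have tau0 : 0 <= tau by exact: le_trans ab.
have lnr : ln (Zf s) <= tau * L + ln (Zf t).
  rewrite -[X in X + _]expRK -lnM ?posrE ?expR_gt0 ?Zf_gt0//.
  by rewrite ler_ln ?posrE ?mulr_gt0 ?expR_gt0 ?Zf_gt0// Zf_ratio.
have t0 : 0 <= t by exact: le_trans st.
have h1 : t * (tmean t - tmean s) <= T * ((expR (2 * tau * L) - 1) * (2 * L)).
  apply: (@le_trans _ _ (t * ((expR (2 * tau * L) - 1) * (2 * L)))).
    by rewrite ler_wpM2l.
  rewrite ler_wpM2r// mulr_ge0//; last by rewrite mulr_ge0.
  by rewrite subr_ge0 -[leLHS]expR0 ler_expR !mulr_ge0.
have h2 : (t - s) * tmean s <= tau * L.
  have : `|(t - s) * tmean s| <= tau * L by rewrite normrM ler_pM// tmean_le.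
  exact: le_trans (ler_norm _).
have -> : tcost t - tcost s = t * (tmean t - tmean s) + (t - s) * tmean s
  + (ln (Zf s) - ln (Zf t)) by rewrite /tcost; ring.
by lra.
Qed.

Lemma tilt_grid T eps : 0 < T -> 0 < eps -> exists2 q : nat, (0 < q)%N &
  forall i, (i < q)%N ->
    tcost (T * i.+1%:R / q%:R) - tcost (T * i%:R / q%:R) <= eps.
Proof.
move=> T0 e0.
have L0 : 0 <= L by exact: le_trans (tmean_le 0).
(* The mesh [tau = T / q] satisfies [tau * (4 * L) <= 1], whence
   [expR (2 * tau * L) - 1 <= 4 * tau * L]; the bound of [tcost_lip] then becomes
   [tau * (8 * T * L * L + 2 * L)], which [r] keeps below [eps]. *)
pose r := T * (8 * T * L * L + 2 * L) / eps.
have r0 : 0 <= r.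
  rewrite divr_ge0 ?(ltW e0)// mulr_ge0 ?(ltW T0)// addr_ge0 ?mulr_ge0//.
  exact: ltW.
pose D := T * (4 * L) + r + 1.
have TL0 : 0 <= T * (4 * L) by rewrite !mulr_ge0// ltW.
pose q := (Num.truncn D).+1.
have qD : D <= q%:R by rewrite ltW// Num.Theory.truncnS_gt.
have q0 : 0 < q%:R :> R by rewrite ltr0n.
exists q => // i iq; pose tau := T / q%:R.
have tau0 : 0 < tau by rewrite divr_gt0.
have tq : tau * q%:R = T by rewrite /tau divfK// gt_eqF.
have h1 : tau * (4 * L) <= 1.
  have : T * (4 * L) <= q%:R by move: qD; rewrite /D; lra.
  by rewrite -{1}tq mulrAC -[leRHS]mul1r ler_pM2r.
have h2 : tau * (8 * T * L * L + 2 * L) <= eps.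
  have : r <= q%:R by move: qD; rewrite /D; lra.
  by rewrite /r ler_pdivrMr// -{1}tq mulrAC [leLHS]mulrC ler_pM2l.
apply: le_trans (tcost_lip (T := T) (tau := tau) _ _ _ _) _.
- by rewrite divr_ge0// mulr_ge0// ltW.
- by rewrite ler_pM2r ?invr_gt0// ler_pM2l// ler_nat.
- by rewrite ler_pdivrMr// ler_pM2l// ler_nat.
- by rewrite -mulrBl -mulrBr -natrB// subSnn mulr1.
have e1 : expR (2 * tau * L) - 1 <= 4 * tau * L.
  have x0 : 0 <= tau * L by rewrite mulr_ge0// ltW.
  have : (tau * L) ^+ 2 <= 4^-1 * (tau * L).
    by rewrite expr2 ler_wpM2r//; move: h1; lra.
  have := @expR_le_quad _ (2 * tau * L); rewrite expr2 => /(_ _) H.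
  have : expR (2 * tau * L) <= 1 + 2 * tau * L + 2 * (2 * tau * L * (2 * tau * L)).
    by apply: H; move: h1; lra.
  rewrite expr2; lra.
have e2 : T * ((expR (2 * tau * L) - 1) * (2 * L)) <= T * (4 * tau * L * (2 * L)).
  by rewrite ler_wpM2l ?(ltW T0)// ler_wpM2r// mulr_ge0.
by move: h2; lra.
Qed.

End FiniteTilt.

(** * Measurability of a first index *)

Section FindMeasurable.
Variable R : realType.

Lemma measurable_find (P : R -> nat -> bool) (s : seq nat) (g : nat -> R) :
  (forall i, measurable_fun setT (fun v => P v i)) ->
  measurable_fun setT (fun v => g (find (P v) s)).
Proof.
move=> mP; elim: s g => [|a s IH] g /=; first exact: measurable_cst.
have -> : (fun v => g (if P v a then 0%N else (find (P v) s).+1)) =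
  (fun v => if P v a then g 0%N else g (find (P v) s).+1).
  by apply/funext => v; case: (P v a).
apply: measurable_fun_ifT => //.
exact: (IH (fun i => g i.+1)).
Qed.

End FindMeasurable.

(** * Symmetric cells of a bounded interval *)

Section Cells.
Variables (R : realType) (h : R) (Kn : nat).
Hypothesis h0 : 0 < h.

Definition cpt (k : 'I_(2 * Kn).+1) : R := (k%:R - Kn%:R) * h.
(* [x] is rounded towards 0 to a multiple of [h]. *)
Definition cell (k : 'I_(2 * Kn).+1) : set R :=
  [set x | (`|x - cpt k| < h) && (`|cpt k| <= `|x|)].

Lemma cpt_sym k : cpt (rev_ord k) = - cpt k.
Proof.
rewrite /cpt /= subSS natrB; last by rewrite -ltnS.
by rewrite natrM; ring.
Qed.

Lemma cpt_le k : `|cpt k| <= Kn%:R * h.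
Proof.
rewrite normrM (gtr0_norm h0) ler_wpM2r ?(ltW h0)//.
have : k%:R <= (2 * Kn)%:R :> R by rewrite ler_nat -ltnS.
rewrite natrM => k2; have k0 : 0 <= k%:R :> R by [].
by rewrite ler_norml; apply/andP; split; lra.
Qed.

(** Rounding towards 0, unlike rounding down, commutes with reflection; the discretised law thus
    inherits the symmetry of [mu]. *)
Lemma cell_sym k x : cell (rev_ord k) x <-> cell k (- x).
Proof.
rewrite /cell /= cpt_sym normrN (normrN x) opprK -(normrN (x + _)) opprD.
by [].
Qed.

Lemma cell_dist k x : cell k x -> `|x - cpt k| <= h.
Proof. by move=> /andP[/ltW]. Qed.

Lemma cell_bound k x : cell k x -> `|x| <= (Kn%:R + 1) * h.
Proof.
move=> ck; have := cell_dist ck; have := cpt_le k.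
have := ler_normD (x - cpt k) (cpt k); rewrite subrK; lra.
Qed.

Lemma measurable_cell k : measurable (cell k).
Proof.
have -> : cell k = (fun x => (`|x - cpt k| < h) && (`|cpt k| <= `|x|)) @^-1` [set true].
  by apply/seteqP; split.
rewrite -[X in measurable X]setTI; set f := (fun _ => _).
have mf : measurable_fun setT f.
  apply: measurable_and.
    apply: measurable_fun_ltr; last exact: measurable_cst.
    apply: measurableT_comp => //; mfun_tac; exact: measurable_id.
  apply: measurable_fun_ler; first exact: measurable_cst.
  exact: normr_measurable.
by apply: mf.
Qed.

Lemma cell_inj k k' x : cell k x -> cell k' x -> k = k'.
Proof.
wlog kk' : k k' / (k <= k')%N.
  move=> H c c'; have [/H|/ltnW/H] := leqP k k'; first exact.
  by move=> /(_ c' c).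
move=> /andP[d1 b1] /andP[d2 b2]; apply/val_inj/eqP; rewrite /= eqn_leq kk' leqNgt.
apply/negP => klt; have : k%:R + 1 <= k'%:R :> R by rewrite natr1 ler_nat.
move=> kk1; have yy : cpt k + h <= cpt k'.
  have : (k%:R + 1) * h <= k'%:R * h by rewrite ler_wpM2r// ltW.
  by rewrite /cpt; lra.
have := ler_norm (cpt k'); have := ler_norm (- cpt k); rewrite normrN.
move: d1 d2; rewrite !ltr_norml => /andP[d11 d12] /andP[d21 d22].
by have [x0|x0] := leP 0 x; [move: b1 b2; rewrite (ger0_norm x0) | move: b1 b2; rewrite (ltr0_norm x0)]; lra.
Qed.

Lemma cell_sum_le1 x : \sum_k (\1_(cell k) x : R) <= 1.
Proof.
have [[k ck]|nk] := pselect (exists k, cell k x).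
  rewrite (bigD1 k)//= big1 ?addr0 ?indicE ?lern1 ?leq_b1// => k' kk'.
  rewrite indicE memNset// => ck'; move/eqP: kk'; apply; exact: cell_inj ck' ck.
by rewrite big1// => k _; rewrite indicE memNset// => ck; apply: nk; exists k.
Qed.

Lemma cell_cover x : `|x| < (Kn%:R + 1) * h -> exists k, cell k x.
Proof.
move=> xL.
have xh : 0 <= `|x| / h by rewrite divr_ge0// ltW.
pose j := Num.truncn (`|x| / h).
have /andP[j1 j2] := Num.Theory.truncn_itv xh; rewrite -/j in j1 j2.
rewrite -natr1 in j2.
rewrite ler_pdivlMr// in j1; rewrite ltr_pdivrMr// in j2.
have jK : (j <= Kn)%N.
  rewrite -ltnS -(ltr_nat R) -natr1 -(ltr_pM2r h0).
  exact: le_lt_trans j1 xL.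
have jh0 : 0 <= j%:R * h by rewrite mulr_ge0// ltW.
have [x0|x0] := leP 0 x.
  have kb : (Kn + j < (2 * Kn).+1)%N by rewrite ltnS mul2n -addnn leq_add2l.
  exists (Ordinal kb); apply/andP.
  rewrite /cpt /= natrD addrAC subrr add0r (ger0_norm jh0) ltr_norml.
  by move: j1 j2; rewrite (ger0_norm x0) => j1 j2; split => //; apply/andP; split; lra.
have kb : (Kn - j < (2 * Kn).+1)%N by rewrite ltnS mul2n -addnn; apply: leq_trans (leq_subr _ _) (leq_addr _ _).
exists (Ordinal kb); apply/andP.
rewrite /cpt /= natrB// addrAC subrr add0r mulNr normrN (ger0_norm jh0) ltr_norml.
by move: j1 j2; rewrite (ltr0_norm x0) => j1 j2; split => //; apply/andP; split; lra.
Qed.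

End Cells.

(** * The discretised law *)

Section Discretisation.
Variables (R : realType) (mu : probability R R) (h : R) (Kn : nat).
Hypothesis mu_even : even_measure mu.
Hypothesis h0 : 0 < h.
Local Notation cell := (@cell R h Kn).
Local Notation cpt := (@cpt R h Kn).
Let L1 : R := (Kn%:R + 1) * h.

Definition cmass (k : 'I_(2 * Kn).+1) : R := fine (mu (cell k)).

Lemma cmass_ge0 k : 0 <= cmass k. Proof. exact: fine_mu_ge0. Qed.

Lemma cmass_sym k : cmass (rev_ord k) = cmass k.
Proof.
rewrite /cmass -(mu_even (measurable_cell h k)); congr (fine (mu _)).
by apply/predeqP => x; apply: cell_sym.
Qed.

Lemma cmass_le1 : \sum_k cmass k <= 1.
Proof.
rewrite -lee_fin -sumEFin -[leRHS](integral_prob_cst mu 1).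
rewrite (eq_bigr (fun k => \int[mu]_x (\1_(cell k) x : R)%:E)%E); last first.
  by move=> k _; rewrite integral_indicE//; exact: measurable_cell.
rewrite -ge0_integral_sum//; first last.
- by move=> k; apply/measurable_EFinP; apply: measurable_indic; exact: measurable_cell.
apply: ge0_le_integralT => x; first by apply: sume_ge0.
by rewrite sumEFin lee_fin cell_sum_le1.
Qed.

Lemma integral_step (c : 'I_(2 * Kn).+1 -> R) : (forall k, 0 <= c k) ->
  (\int[mu]_x (\sum_k \1_(cell k) x * c k)%:E = (\sum_k cmass k * c k)%:E)%E.
Proof.
move=> c0.
transitivity (\int[mu]_x (\sum_k (c k)%:E * (\1_(cell k) x : R)%:E))%E.
  by apply: eq_integral => x _; rewrite -sumEFin; apply: eq_bigr => k _; rewrite -EFinM mulrC.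
rewrite ge0_integral_sum//.
- rewrite -sumEFin; apply: eq_bigr => k _; rewrite ge0_integralZl//.
  + by rewrite integral_indicE; [rewrite -EFinM mulrC | exact: measurable_cell].
  + by apply/measurable_EFinP; apply: measurable_indic; exact: measurable_cell.
  + by rewrite lee_fin.
- move=> k; apply/measurable_EFinP; apply: measurable_funM; first exact: measurable_cst.
  by apply: measurable_indic; exact: measurable_cell.
- by move=> k x _; rewrite mule_ge0 ?lee_fin// indicE.
Qed.

(** Dominates [expR (t * x)] for [|t| <= T] in the region [|x| >= L], which the cells do not cover
    when [L = L1]. *)
Definition far (T L : R) (x : R) : R := expR (T * `|x|) * (L <= `|x|)%R%:R.

Lemma measurable_far T L : measurable_fun setT (far T L).
Proof.
rewrite (_ : far T L = fun x => if L <= `|x| then expR (T * `|x|) else 0); last first.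
  by apply/funext => x; rewrite /far; case: ifP => _; rewrite ?mulr1 ?mulr0.
apply: measurable_fun_ifT; last exact: measurable_cst.
  by apply: measurable_fun_ler => //; exact: normr_measurable.
apply: measurableT_comp => //; apply: measurable_funM; first exact: measurable_cst.
exact: normr_measurable.
Qed.

Lemma far_ge0 T L x : 0 <= far T L x.
Proof. by rewrite mulr_ge0 ?expR_ge0. Qed.

(** Within a cell x moves by at most [h] from the cell point, hence the factor [expR (|t| * h)];
    everything outside the cells is charged to [far]. *)
Lemma mgf_discretised T eta t : `|t| <= T ->
  (\int[mu]_x (far T L1 x)%:E <= eta%:E)%E ->
  (\int[mu]_x (expR (t * x))%:E <= (expR (`|t| * h) * Zf cmass cpt t + eta)%:E)%E.
Proof.
move=> tT Heta.
pose G x := \sum_k \1_(cell k) x * (expR (`|t| * h) * expR (t * cpt k)).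
have G0 x : 0 <= G x.
  by apply: sumr_ge0 => k _; rewrite mulr_ge0 ?indicE// mulr_ge0 ?expR_ge0.
have mG : measurable_fun setT G.
  apply: measurable_sum => k; apply: measurable_funM; last exact: measurable_cst.
  by apply: measurable_indic; exact: measurable_cell.
have tG x : expR (t * x) <= G x + far T L1 x.
  have [xL|xL] := leP L1 `|x|.
    rewrite -[leLHS]add0r lerD//; rewrite /far xL mulr1 ler_expR.
    apply: le_trans (ler_norm _) _; rewrite normrM ler_wpM2r//.
  have [k ck] := cell_cover h0 xL.
  rewrite -[leLHS]addr0 lerD ?far_ge0// /G (bigD1 k)//= indicE mem_set// mul1r.
  rewrite -expRD; apply: ler_wpDr.
    by apply: sumr_ge0 => k' _; rewrite mulr_ge0 ?indicE// mulr_ge0 ?expR_ge0.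
  rewrite ler_expR -lerBlDr -mulrBr; apply: le_trans (ler_norm _) _.
  by rewrite normrM ler_wpM2l// cell_dist.
apply: (@le_trans _ _ (\int[mu]_x ((G x)%:E + (far T L1 x)%:E))%E).
  by apply: ge0_le_integralT => x; rewrite -?EFinD lee_fin ?expR_ge0.
rewrite ge0_integralD//; first last.
- by apply/measurable_EFinP; exact: measurable_far.
- by move=> x _; rewrite lee_fin far_ge0.
- by apply/measurable_EFinP.
- by move=> x _; rewrite lee_fin.
rewrite EFinD leeD// /G integral_step; last by move=> k; rewrite mulr_ge0 ?expR_ge0.
rewrite lee_fin /Zf mulr_sumr le_eqVlt; apply/orP; left.
by apply/eqP/eq_bigr => k _; rewrite mulrCA.
Qed.

Lemma cmass_sum_ge T eta : 0 <= T -> (\int[mu]_x (far T L1 x)%:E <= eta%:E)%E ->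
  1 - eta <= \sum_k cmass k.
Proof.
move=> T0 Heta; have := @mgf_discretised T eta 0; rewrite normr0 => /(_ T0 Heta).
rewrite (_ : (fun x => _) = (fun=> 1%:E)); last first.
  by apply/funext => x; rewrite mul0r expR0.
rewrite integral_prob_cst lee_fin mul0r expR0 mul1r /Zf.
rewrite (eq_bigr cmass); last by move=> k _; rewrite mul0r expR0 mulr1.
by lra.
Qed.

(** The claim amounts to the nonnegativity of the sum of [cmass k * (cpt k - z1) * expR (T * cpt
    k)]. Since [x <= expR x], no cell point contributes less than [- Q] with
    [Q = expR (T * z1) / T], and the total mass is at most 1. For x in [[z', L0[] the cell point
    exceeds [z1] by at least [(z' - z1) / 2] and its exponential is at least half of [expR (T * x)],
    so these cells compensate [Q]. *)
Lemma tmean_discretised_ge T z1 z' L0 : 0 < T -> z1 < z' ->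
  h <= (z' - z1) / 2 -> T * h <= 2^-1 -> L0 <= L1 -> - L1 < z' ->
  ((expR (T * z1) / T)%:E <=
    ((z' - z1) / 4)%:E * \int[mu]_x (expR (T * x) * \1_(`[z', L0[%classic) x)%:E)%E ->
  0 < \sum_k cmass k -> z1 <= tmean cmass cpt T.
Proof.
move=> T0 z1z' hz Th L0L1 z'L1 HI sp.
have Z0 : 0 < Zf cmass cpt T by apply: Zf_gt0 => //; [exact: cmass_ge0 | exact: cmass_sym | exact: cpt_sym].
set Q := expR (T * z1) / T.
have Qge k : - ((cpt k - z1) * expR (T * cpt k)) <= Q.
  have e1 : T * (z1 - cpt k) <= expR (T * (z1 - cpt k)).
    by have := expR_ge1Dx (T * (z1 - cpt k)); lra.
  rewrite /Q ler_pdivlMr//.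
  have -> : - ((cpt k - z1) * expR (T * cpt k)) * T = T * (z1 - cpt k) * expR (T * cpt k) by ring.
  apply: le_trans (_ : expR (T * (z1 - cpt k)) * expR (T * cpt k) <= _).
    by rewrite ler_wpM2r// expR_ge0.
  by rewrite -expRD ler_expR; lra.
pose c k := (cpt k - z1) * expR (T * cpt k) + Q.
have c0 k : 0 <= c k by have := Qge k; rewrite /c; lra.
have low x : (z' - z1) / 4 * (expR (T * x) * \1_(`[z', L0[%classic) x) <=
    \sum_k \1_(cell k) x * c k.
  have s0 : 0 <= \sum_k \1_(cell k) x * c k.
    by apply: sumr_ge0 => k _; rewrite mulr_ge0 ?indicE.
  rewrite indicE; have [|_] := boolP (x \in _); last by rewrite !mulr0.
  rewrite inE /= in_itv /= mulr1 => /andP[zx xL].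
  have xL1 : `|x| < L1.
    by rewrite ltr_norml; apply/andP; split; [exact: lt_le_trans zx | exact: lt_le_trans L0L1].
  have [k ck] := cell_cover h0 xL1.
  rewrite (bigD1 k)//= indicE mem_set// mul1r; apply: ler_wpDr.
    by apply: sumr_ge0 => k' _; rewrite mulr_ge0 ?indicE.
  have := cell_dist ck => /ler_normlP[d1 d2].
  have Q0 : 0 <= Q by rewrite divr_ge0 ?expR_ge0// ltW.
  apply: (@le_trans _ _ ((cpt k - z1) * expR (T * cpt k))); last by rewrite lerDl.
  have -> : (z' - z1) / 4 * expR (T * x) = (z' - z1) / 2 * (2^-1 * expR (T * x)) by field.
  apply: ler_pM.
  - by rewrite divr_ge0// subr_ge0 ltW.
  - by rewrite mulr_ge0 ?expR_ge0.
  - lra.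
  - have e2 : 2^-1 <= expR (- (T * h)) by have := expR_ge1Dx (- (T * h)); lra.
    apply: le_trans (_ : expR (- (T * h)) * expR (T * x) <= _).
      by rewrite ler_wpM2r ?expR_ge0.
    rewrite -expRD ler_expR.
    have : T * (x - h) <= T * cpt k by rewrite ler_wpM2l ?(ltW T0)//; lra.
    lra.
have Qc : Q <= \sum_k cmass k * c k.
  rewrite -lee_fin -integral_step//; apply: le_trans HI _.
  rewrite -ge0_integralZl//; first last.
  - by rewrite lee_fin divr_ge0// subr_ge0 ltW.
  - apply/measurable_EFinP; apply: measurable_funM; last exact: measurable_indic.
    by apply: measurableT_comp => //; mfun_tac; exact: measurable_id.
  apply: ge0_le_integralT => x; rewrite -EFinM lee_fin//.
  by rewrite mulr_ge0 ?divr_ge0 ?subr_ge0 ?(ltW z1z')// mulr_ge0 ?expR_ge0 ?indicE.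
have H : 0 <= \sum_k cmass k * ((cpt k - z1) * expR (T * cpt k)).
  have : \sum_k cmass k * c k = \sum_k cmass k * ((cpt k - z1) * expR (T * cpt k)) + (\sum_k cmass k) * Q.
    by rewrite mulr_suml -big_split; apply: eq_bigr => k _; rewrite /c /=; ring.
  have : (\sum_k cmass k) * Q <= Q.
    by rewrite -[leRHS]mul1r ler_wpM2r ?cmass_le1// divr_ge0 ?expR_ge0// ltW.
  by lra.
rewrite /tmean (eq_bigr (fun k => cmass k * cpt k * expR (T * cpt k) / Zf cmass cpt T)); last first.
  by move=> k _; rewrite /tilt; ring.
rewrite -mulr_suml ler_pdivlMr// /Zf mulr_sumr -subr_ge0 -sumrB; apply: le_trans H _.
rewrite le_eqVlt; apply/orP; left; apply/eqP/eq_bigr => k _; ring.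
Qed.

End Discretisation.

(** * The threshold window *)

Section Window.
Variables (R : realType) (mu : probability R R).
Hypothesis mu_even : even_measure mu.
Local Notation E f := (Rintegral mu setT f).

(** The hypothesis on [far] lets finitely many cells carry the exponential moments up to order [T],
    the inequality with [L0] forces the discretised tilt at [T] to have mean at least [z1], and the
    one with [J] makes the expected tail cost small. *)
Lemma Emu_window (z0 z1 z' T L0 eps delta : R) (J : nat) :
  0 <= z0 -> z0 < z1 -> z1 < z' -> 0 < T -> 0 < eps -> 0 < delta ->
  (forall eta, 0 < eta -> exists L, forall L', L <= L' ->
     (\int[mu]_x (far T L' x)%:E <= eta%:E)%E) ->
  ((expR (T * z1) / T)%:E <=
    ((z' - z1) / 4)%:E * \int[mu]_x (expR (T * x) * \1_(`[z', L0[%classic) x)%:E)%E ->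
  J%:R * fine (mu [set v : R | z0 < `|v|]) + 4 * 2 ^- J <= eps * (delta / 3) ->
  exists a b : R, b - a <= 10 * eps /\ exists n0, forall n, (n0 <= n)%N -> forall N,
    (N%:R <= expR (a * n%:R) -> (Emu mu n N <= delta%:E)%E) /\
    (expR (b * n%:R) <= N%:R -> ((1 - delta)%:E <= Emu mu n N)%E).
Proof.
move=> z00 z01 z1z' T0 eps0 d0 Hfar HI HJ.
(* The first bound ensures that the last grid point [T] has mean at least [|v| + gap] whenever
   [|v| <= z0]; the second, that [gap] changes exponents by at most [eps]. *)
pose gap := Num.min (z1 - z0) (eps / T).
have gap0 : 0 < gap by rewrite lt_min subr_gt0 z01 divr_gt0.
have gap1 : gap <= z1 - z0 by rewrite ge_min lexx.
have gapT : T * gap <= eps by rewrite mulrC -ler_pdivlMr// ge_min lexx orbT.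
(* The four bounds serve the slack of the caps, the error [expR (T * h)] in the moment generating
   function, and the two mesh conditions of [tmean_discretised_ge]. *)
pose h := Num.min (Num.min (gap / 4) (eps / T)) (Num.min ((z' - z1) / 2) (2^-1 / T)).
have h0 : 0 < h.
  by rewrite !lt_min !divr_gt0// subr_gt0.
have hgap : h <= gap / 4 by rewrite !ge_min lexx.
have hT : T * h <= eps by rewrite mulrC -ler_pdivlMr// !ge_min lexx !orbT.
have hz : h <= (z' - z1) / 2 by rewrite !ge_min lexx !orbT.
have hT2 : T * h <= 2^-1 by rewrite mulrC -ler_pdivlMr// !ge_min lexx !orbT.
pose eta := Num.min (eps / 2) 2^-1.
have eta0 : 0 < eta by rewrite lt_min divr_gt0/=.
have eta1 : 2 * eta <= eps by rewrite mulrC -ler_pdivlMr// ge_min lexx.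
have eta2 : eta <= 2^-1 by rewrite ge_min lexx orbT.
have [L HL] := Hfar eta eta0.
pose Kn := (Num.truncn ((`|L| + `|L0|) / h)).+1.
pose L1 := (Kn%:R + 1) * h.
have LL1 : `|L| + `|L0| <= L1.
  have : (`|L| + `|L0|) / h <= Kn%:R by rewrite ltW// Num.Theory.truncnS_gt.
  rewrite ler_pdivrMr// /L1 mulrDl mul1r; lra.
have L10 : 0 <= L1 by apply: le_trans LL1; rewrite addr_ge0.
have far1 : (\int[mu]_x (far T L1 x)%:E <= eta%:E)%E.
  by apply: HL; apply: le_trans (ler_norm L) _; have := normr_ge0 L0; lra.
pose p := @cmass R mu h Kn; pose y := @cpt R h Kn.
have p0 k : 0 <= p k by exact: cmass_ge0.
have p_sym k : p (rev_ord k) = p k by exact: cmass_sym.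
have y_sym k : y (rev_ord k) = - y k by exact: cpt_sym.
have yL k : `|y k| <= L1.
  by apply: le_trans (cpt_le h0 k) _; rewrite /L1 mulrDl mul1r lerDl ltW.
have sp2 : 2^-1 <= \sum_k p k.
  by have := cmass_sum_ge h0 (ltW T0) far1; rewrite -/p; lra.
have sp : 0 < \sum_k p k by apply: lt_le_trans sp2.
have z10 : 0 < z1 by exact: le_lt_trans z01.
have mT : z1 <= tmean p y T.
  apply: (tmean_discretised_ge mu_even h0 T0 z1z' hz hT2 _ _ HI sp).
    by apply: le_trans (ler_norm L0) _; have := normr_ge0 L; rewrite -/L1; lra.
  rewrite -/L1; lra.
have [q q0 Hq] := tilt_grid p0 yL sp p_sym y_sym T0 eps0.
have q0' : 0 < q%:R :> R by rewrite ltr0n.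
pose tt (i : nat) : R := T * i%:R / q%:R.
have tt0 i : 0 <= tt i by rewrite divr_ge0 ?mulr_ge0// ltW.
have ttT i : (i <= q)%N -> tt i <= T.
  by move=> iq; rewrite ler_pdivrMr// ler_wpM2l ?(ltW T0)// ler_nat.
pose P (v : R) (i : nat) := `|v| + gap <= tmean p y (tt i).
(* [tt (ka v)] is s(v). The index is never 0, since the mean at 0 is 0 and [gap > 0]; its
   predecessor therefore exists and has mean below [|v| + gap]. *)
pose ka (v : R) := find (P v) (iota 0 q.+1).
have ka_spec v : `|v| <= z0 -> exists i, [/\ ka v = i.+1, (i < q)%N, P v i.+1 & ~~ P v i].
  move=> vz; have hasP : has (P v) (iota 0 q.+1).
    apply/hasP; exists q; first by rewrite mem_iota add0n ltnS leqnn.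
    by rewrite /P /tt mulfK ?gt_eqF//; lra.
  have kq : (ka v < q.+1)%N by move: hasP; rewrite has_find size_iota.
  have Pk : P v (ka v) by have := nth_find 0%N hasP; rewrite -/(ka v) nth_iota// add0n.
  case E : (ka v) => [|i].
    move: Pk; rewrite E /P /tt mulr0 mul0r (tmean0 p_sym y_sym).
    by have := normr_ge0 v; lra.
  exists i; split => //; first by rewrite E ltnS in kq.
    by rewrite -E.
  have iq : (i < ka v)%N by rewrite E.
  have := before_find 0%N iq; rewrite nth_iota ?add0n; last by rewrite E in kq; exact: ltnW.
  by move=> ->.
have mP i : measurable_fun setT (fun v => P v i).
  apply: measurable_fun_ler; last exact: measurable_cst.
  by apply: measurable_funD; [exact: normr_measurable | exact: measurable_cst].
have mka (g : nat -> R) : measurable_fun setT (fun v => g (ka v)) by exact: measurable_find.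
pose u (v : R) := tcost p y (tt (ka v)).
(* For negative directions the tilt is reflected through [rev_ord], at the same cost. *)
pose nu (s : bool) (v : R) k := tilt p y (tt (ka v)) (if s then k else rev_ord k).
pose De (s : bool) (v : R) k := tt (ka v) * (y (if s then k else rev_ord k) - tmean p y (tt (ka v))).
have revF (s : bool) (F : 'I_(2 * Kn).+1 -> R) : \sum_k F (if s then k else rev_ord k) = \sum_k F k.
  by case: s => //; exact: rev_sum.
pose B := T * (2 * L1) + 1.
have B0 : 0 < B by rewrite ltr_wpDl// mulr_ge0 ?(ltW T0)// mulr_ge0.
have Hnu s v : `|v| <= z0 -> [/\ forall k, 0 <= nu s v k,
    \sum_k nu s v k = 1, forall k, nu s v k <= fine (mu (cell h k)) * expR (u v + De s v k),
    \sum_k nu s v k * De s v k <= 0 & (forall k, `|De s v k| <= B) /\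
    gap <= (if s then 1 else -1) * (\sum_k nu s v k * y k - v)].
  move=> vz; have [i [kai iq Pi _]] := ka_spec v vz.
  split.
  - by move=> k; exact: tilt_ge0.
  - by rewrite /nu revF tilt_sum1.
  - move=> k; rewrite /nu /De /u (tiltE p0 sp p_sym y_sym) -/(cmass mu h k) -/(p k).
    by rewrite le_eqVlt; apply/orP; left; case: s => //; rewrite p_sym.
  - by rewrite /nu /De (revF s (fun k => tilt p y (tt (ka v)) k *
      (tt (ka v) * (y k - tmean p y (tt (ka v)))))) (tilt_center p0 sp p_sym y_sym).
  - split.
      move=> k; rewrite /De normrM (ger0_norm (tt0 _)).
      apply: (@le_trans _ _ (T * (2 * L1))); last by rewrite /B lerDl.
      apply: ler_pM => //; first by apply: ttT; rewrite kai.
      apply: le_trans (ler_normB _ _) _.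
      have := tmean_le p0 yL sp p_sym y_sym (tt (ka v)).
      by have := yL (if s then k else rev_ord k); clear; lra.
    have mE : \sum_k nu s v k * y k = (if s then 1 else -1) * tmean p y (tt (ka v)).
      case: s; rewrite /nu /tmean ?mul1r//.
      rewrite mulN1r -sumrN -rev_sum; apply: eq_bigr => k _.
      by rewrite rev_ordK y_sym mulrN.
    rewrite mE kai; move: Pi; rewrite /P.
    have := ler_norm v; have := ler_norm (- v); rewrite normrN.
    by clear; case: s; lra.
pose u1 (v : R) := if `|v| <= z0 then u v else 0.
pose Bu := \sum_(i < q.+1) `|tcost p y (tt i)|.
have u1B v : `|u1 v| <= Bu.
  rewrite /u1; case: ifPn => [vz|_]; last by rewrite normr0 sumr_ge0.
  have [i [kai iq _ _]] := ka_spec v vz.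
  have iq' : (i.+1 < q.+1)%N by rewrite ltnS.
  by rewrite /u kai /Bu (bigD1 (Ordinal iq'))//= lerDl sumr_ge0.
have mu_ : measurable_fun setT u by exact: (mka (fun i => tcost p y (tt i))).
have mz0 : measurable_fun setT (fun v : R => `|v| <= z0).
  by apply: measurable_fun_ler; [exact: normr_measurable | exact: measurable_cst].
have mu1 : measurable_fun setT u1.
  by apply: measurable_fun_ifT => //; exact: measurable_cst.
have hrd : (\int[mu]_x tail_cost mu z0 J x <= (eps * (delta / 3))%:E)%E.
  by apply: le_trans (integral_tail_cost mu_even z0 J) _; rewrite lee_fin.
have [n1 Hn1] := Emu_large (K := (2 * Kn)%N) mu_even z00 L10 gap0 hgap B0 (measurable_cell h (Kn := Kn))
  (cell_sum_le1 Kn h0) (@cell_dist R h Kn) (cell_bound h0) yL Hnu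
  (@tail_cost_bound _ mu z0 J) mu_ (measurable_tail_cost mu z0 J)
  (tail_cost_ge0 mu z0 J) u1B eps0 d0 hrd.
pose t (v : R) := if `|v| <= z0 then (if 0 <= v then 1 else -1) * tt (ka v).-1 else 0.
(* The [2 * eps] covers the factor [expR (tt i * h)] and the part [eta] outside the cells. In [ell]
   two further [eps] are lost: one for [gap], one for the grid step from the predecessor to
   [ka v]. *)
pose Lam (v : R) := if `|v| <= z0 then ln (Zf p y (tt (ka v).-1)) + 2 * eps else 0.
pose ell (v : R) := if `|v| <= z0 then u v - 4 * eps else 0.
have mt : measurable_fun setT t.
  apply: measurable_fun_ifT => //.
  apply: measurable_funM; last exact: (mka (fun i => tt i.-1)).
  apply: measurable_fun_ifT; do ?exact: measurable_cst.
  by apply: measurable_fun_ler; [exact: measurable_cst | exact: measurable_id].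
have mLam : measurable_fun setT Lam.
  apply: measurable_fun_ifT => //.
  exact: (mka (fun i => ln (Zf p y (tt i.-1)) + 2 * eps)).
have mell : measurable_fun setT ell.
  apply: measurable_fun_ifT => //.
  exact: (mka (fun i => tcost p y (tt i) - 4 * eps)).
have ellB v : `|ell v| <= Bu + 4 * eps.
  have := u1B v; rewrite /u1 /ell; case: ifP => _ H.
    apply: le_trans (ler_normB _ _) _; rewrite (ger0_norm (x := 4 * eps)) ?lerD2r//.
    by rewrite mulr_ge0// ltW.
  by rewrite normr0 in H *; rewrite addr_ge0// mulr_ge0// ltW.
have tLam v : (\int[mu]_w (expR (t v * w))%:E <= (expR (Lam v))%:E)%E.
  rewrite /t /Lam; case: ifPn => [vz|_]; last first.
    rewrite (_ : (fun w => _) = (fun=> 1%:E)) ?integral_prob_cst ?expR0//.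
    by apply/funext => w; rewrite mul0r expR0.
  have [i [kai iq _ _]] := ka_spec v vz; rewrite kai /=.
  set s : R := if 0 <= v then 1 else -1.
  have ns : `|s * tt i| = tt i.
    rewrite normrM (ger0_norm (tt0 i)) /s; case: ifP => _; rewrite ?normrN1 ?normr1 mul1r//.
  have tiT : tt i <= T by apply: ttT; exact: ltnW.
  have sT : `|s * tt i| <= T by rewrite ns.
  have Zs : Zf p y (s * tt i) = Zf p y (tt i).
    by rewrite /s; case: ifP => _; rewrite ?mul1r// mulN1r (Zf_even p_sym y_sym).
  apply: le_trans (mgf_discretised h0 sT far1) _.
  rewrite -/p -/y Zs ns lee_fin expRD lnK ?posrE ?Zf_gt0//.
  have Zp := Zf_ge p0 p_sym y_sym (tt i).
  have Z0 := Zf_gt0 p0 sp p_sym y_sym (tt i).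
  have e1 : expR (tt i * h) <= expR eps.
    rewrite ler_expR; apply: le_trans hT; rewrite ler_wpM2r// ltW//.
  have e2 : eta <= Zf p y (tt i) * eps.
    apply: (@le_trans _ _ (2^-1 * eps)); first by clear - eta1; lra.
    by rewrite ler_wpM2r ?(ltW eps0)//; exact: le_trans Zp.
  have e3 : expR (2 * eps) = expR eps * expR eps by rewrite -expRD; congr expR; ring.
  have e4 : expR eps + eps <= expR (2 * eps).
    rewrite e3; have x1 := expR_ge1Dx eps.
    have x2 : expR eps * (1 + eps) <= expR eps * expR eps by rewrite ler_wpM2l ?expR_ge0.
    have x3 : eps <= expR eps * eps by apply: ler_peMl (ltW eps0) _; clear - x1 eps0; lra.
    by clear - x1 x2 x3; lra.
  apply: (@le_trans _ _ (Zf p y (tt i) * (expR eps + eps))); last by rewrite ler_wpM2l// ltW.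
  rewrite mulrDr lerD// mulrC ler_wpM2l// ltW//.
have ellt v : ell v <= t v * v - Lam v.
  rewrite /ell /t /Lam; case: ifPn => [vz|_]; last by rewrite mul0r subr0.
  have [i [kai iq _ nPi]] := ka_spec v vz; rewrite kai /= /u kai.
  have Hc := Hq i iq; rewrite -/(tt i) -/(tt i.+1) in Hc.
  have av : (if 0 <= v then 1 else -1) * tt i * v = tt i * `|v|.
    have [v0|v0] := leP 0 v; first by rewrite mul1r (ger0_norm v0).
    by rewrite (ltr0_norm v0); ring.
  rewrite av; move: nPi; rewrite /P -ltNge => nPi.
  have h1 : tt i * (tmean p y (tt i) - gap) <= tt i * `|v|.
    by rewrite ler_wpM2l//; clear - nPi; lra.
  have h2 : tt i * gap <= eps.
    apply: le_trans gapT; rewrite ler_wpM2r ?(ltW gap0)//; apply: ttT; exact: ltnW.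
  by move: Hc; rewrite {2}/tcost; clear - h1 h2; lra.
have [n2 Hn2] := Emu_small mt mLam mell ellB tLam ellt eps0 d0.
have Eell : E u1 - 4 * eps <= E ell.
  have iu1 := bounded_mu_integrable mu mu1 u1B.
  have ie : mu.-integrable setT (EFin \o (fun=> 4 * eps)).
    exact: finite_measure_integrable_cst.
  rewrite -[X in _ - X](Rintegral_prob_cst mu) -RintegralB//.
  apply: le_Rintegral => //.
  - apply: (bounded_mu_integrable mu (B := Bu + 4 * eps)).
      by mfun_tac.
    move=> x; apply: le_trans (ler_normB _ _) _; apply: lerD; first exact: u1B.
    by rewrite ger0_norm// mulr_ge0// ltW.
  - exact: (bounded_mu_integrable mu mell ellB).
  - move=> x _; rewrite /u1 /ell; case: ifP => _ //.
    by rewrite sub0r oppr_le0 mulr_ge0// ltW.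
(* The width 10 is 4 from [Eell], 2 from [Emu_small] and 4 from [Emu_large]. *)
exists (E ell - 2 * eps), (E u1 + 4 * eps); split; first by clear - Eell; lra.
exists (maxn n1 n2) => n; rewrite geq_max => /andP[nn1 nn2] N.
by split; [exact: Hn2 | exact: Hn1].
Qed.

End Window.

(** * Existence of tilts with large mean *)

Section Moments.
Variables (R : realType) (mu : probability R R).
Hypothesis mu_even : even_measure mu.

Definition mgf (t : R) : \bar R := (\int[mu]_x (expR (t * x))%:E)%E.

Lemma measurable_expM (t : R) : measurable_fun setT (fun x : R => expR (t * x)).
Proof. by apply: measurableT_comp => //; mfun_tac; exact: measurable_id. Qed.

Lemma mgf_ge0 t : (0 <= mgf t)%E.
Proof. by apply: integral_ge0 => x _; rewrite lee_fin expR_ge0. Qed.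

Lemma Lambda_mgf t : (Lambda mu t < +oo)%E = (mgf t < +oo)%E.
Proof.
rewrite /Lambda -/(mgf t); have := mgf_ge0 t.
by case: (mgf t) => [r| |]//=; rewrite !ltry.
Qed.

Lemma integral_even (f : R -> \bar R) : measurable_fun setT f -> (forall x, (0 <= f x)%E) ->
  (\int[mu]_x f (- x)%R = \int[mu]_x f x)%E.
Proof.
move=> mf f0.
have mN : measurable_fun setT (fun x : R => - x) by exact: oppr_measurable.
have := @ge0_integral_pushforward _ _ _ _ R _ mN mu setT f.
rewrite preimage_setT => /(_ measurableT mf (fun x _ => f0 x)) /= <-.
by apply: eq_measure_integral => A mA _; exact: mu_even.
Qed.

Lemma mgfN t : mgf (- t) = mgf t.
Proof.
rewrite /mgf -[RHS]integral_even.
- by apply: eq_integral => x _; rewrite mulrN mulNr.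
- by apply/measurable_EFinP; exact: measurable_expM.
- by move=> x; rewrite lee_fin expR_ge0.
Qed.

Lemma mgf_finE t : (mgf t < +oo)%E -> mgf t = (fine (mgf t))%:E.
Proof. by move=> h; rewrite fineK// ge0_fin_numE// mgf_ge0. Qed.

Lemma far_small T T' : 0 < T -> T < T' -> (mgf T' < +oo)%E ->
  forall eta, 0 < eta -> exists L, forall L', L <= L' ->
     (\int[mu]_x (far T L' x)%:E <= eta%:E)%E.
Proof.
move=> T0 TT' fin eta eta0.
set M := fine (mgf T'); have ME : mgf T' = M%:E by exact: mgf_finE.
have M0 : 0 <= M by rewrite fine_ge0// mgf_ge0.
(* The integral is at most [2 * M * c], and [c * ((T' - T) * L') <= 1] because
   [x * expR (- x) <= 1]. *)
exists (2 * M / eta / (T' - T)) => L' LL'.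
have d0 : 0 < T' - T by rewrite subr_gt0.
set c := expR (- ((T' - T) * L')).
have point x : far T L' x <= c * (expR (T' * x) + expR (- T' * x)).
  rewrite /far; have [Lx|_] := leP L' `|x|; last first.
    by rewrite mulr0 mulr_ge0 ?addr_ge0 ?expR_ge0.
  rewrite mulr1 (@le_trans _ _ (c * expR (T' * `|x|)))//.
    rewrite /c -expRD ler_expR.
    have : (T' - T) * L' <= (T' - T) * `|x| by rewrite ler_wpM2l// ltW.
    lra.
  rewrite ler_wpM2l ?expR_ge0//; have [x0|x0] := leP 0 x.
    by rewrite (ger0_norm x0) lerDl expR_ge0.
  by rewrite (ltr0_norm x0) mulrN -mulNr lerDr expR_ge0.
apply: (@le_trans _ _ (\int[mu]_x (c%:E * ((expR (T' * x))%:E + (expR (- T' * x))%:E)))%E).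
  by apply: ge0_le_integralT => x; rewrite -?EFinD -?EFinM lee_fin ?far_ge0.
have m1 := measurable_expM T'; have m2 := measurable_expM (- T').
rewrite ge0_integralZl ?lee_fin ?expR_ge0//; first last.
- by move=> x _; rewrite -EFinD lee_fin addr_ge0 ?expR_ge0.
- by apply: emeasurable_funD; apply/measurable_EFinP.
rewrite ge0_integralD//; try exact/measurable_EFinP;
  try by move=> x _; rewrite lee_fin expR_ge0.
rewrite -/(mgf T') -/(mgf (- T')) mgfN ME -EFinD -EFinM lee_fin.
have M1 : 2 * M <= eta * (T' - T) * L'.
  by move: LL'; rewrite ler_pdivrMr// ler_pdivrMr//; lra.
have c1 : c * ((T' - T) * L') <= 1.
  have := expR_ge1Dx ((T' - T) * L').
  have ce : c * expR ((T' - T) * L') = 1 by rewrite /c -expRD addNr expR0.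
  move=> h; apply: (@le_trans _ _ (c * expR ((T' - T) * L'))); last by rewrite ce.
  rewrite ler_wpM2l ?expR_ge0//; lra.
have : c * (2 * M) <= c * (eta * (T' - T) * L') by rewrite ler_wpM2l ?expR_ge0.
have : eta * (c * ((T' - T) * L')) <= eta * 1 by rewrite ler_wpM2l// ltW.
by lra.
Qed.

Lemma tail_small e : 0 < e -> exists n : nat, tail mu n%:R <= e.
Proof.
move=> e0; have [|n m nm||n Hn] := @mu_bigcap_small _ mu (fun n => `[n%:R, +oo[%classic) _ _ _ e e0.
- by move=> n; exact: measurable_itv.
- apply/subsetPset => v /=; rewrite !in_itv/= !andbT; apply: le_trans.
  by rewrite ler_nat.
- rewrite (_ : \bigcap_n _ = set0) ?measure0//; apply/seteqP; split => // x /= H.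
  have := H (Num.truncn `|x|).+1 I; rewrite /= in_itv/= andbT leNgt => /negP; apply.
  by apply: le_lt_trans (Num.Theory.truncnS_gt _); exact: ler_norm.
- by exists n; rewrite -lee_fin tailE.
Qed.

Lemma tail_far e x : 0 < e -> exists2 L, x <= L & tail mu L <= e.
Proof.
move=> e0; have [n Hn] := tail_small e0.
exists (Num.max x n%:R); first by rewrite le_max lexx.
by apply: le_trans Hn; apply: tail_nincr; rewrite le_max lexx orbT.
Qed.

Lemma mu_itv_co a b : a <= b -> fine (mu `[a, b[%classic) = tail mu a - tail mu b.
Proof.
move=> ab; apply/eqP; rewrite eq_sym subr_eq; apply/eqP.
have -> : tail mu a = fine (mu (`[a, b[%classic `|` `[b, +oo[%classic)).
  congr (fine (mu _)); rewrite -itv_bndbnd_setU//.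
rewrite measureU//=.
  by rewrite fineD ?fin_num_measure.
apply/seteqP; split => // x /= []; rewrite !in_itv/= andbT => /andP[_ xb] bx.
by have := lt_le_trans xb bx; rewrite ltxx.
Qed.

Lemma integral_exp_itv_ge T a b : 0 <= T -> a <= b ->
  ((expR (T * a) * (tail mu a - tail mu b))%:E <=
   \int[mu]_x (expR (T * x) * \1_(`[a, b[%classic) x)%:E)%E.
Proof.
move=> T0 ab; rewrite -mu_itv_co// EFinM -integral_indicE//.
rewrite -ge0_integralZl//; last by apply/measurable_EFinP; exact: measurable_indic.
apply: ge0_le_integralT => x; rewrite -EFinM lee_fin.
  by rewrite mulr_ge0 ?expR_ge0 ?indicE.
rewrite indicE; have [|_] := boolP (x \in _); last by rewrite !mulr0.
rewrite inE /= in_itv/= !mulr1 ler_expR => /andP[ax _].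
by rewrite ler_wpM2l.
Qed.

Lemma measurable_exp_itv T a b :
  measurable_fun setT (fun x : R => expR (T * x) * \1_(`[a, b[%classic) x).
Proof. by apply: measurable_funM; [exact: measurable_expM | exact: measurable_indic]. Qed.

(** Some x > z1 has a positive tail, and a bounded window starting at x keeps at least half of it.
    Arbitrarily large [T] are allowed, and the contribution of the window, of order [expR (T * x)],
    overtakes [expR (T * z1) / T]. *)
Lemma good_tilt_entire z1 : (z1%:E < xstar mu)%E -> (forall t, (mgf t < +oo)%E) ->
  exists z' T L0, [/\ z1 < z', 0 < T,
    (forall eta, 0 < eta -> exists L, forall L', L <= L' ->
       (\int[mu]_x (far T L' x)%:E <= eta%:E)%E) &
    ((expR (T * z1) / T)%:E <=
      ((z' - z1) / 4)%:E * \int[mu]_x (expR (T * x) * \1_(`[z', L0[%classic) x)%:E)%E].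
Proof.
move=> /ereal_sup_gt[_ [x /= mux <-]]; rewrite lte_fin => z1x fin.
have tx : 0 < tail mu x by rewrite -lte_fin tailE.
pose z' := (z1 + x) / 2.
have z1z' : z1 < z' by rewrite /z'; lra.
have z'x : z' <= x by rewrite /z'; lra.
have [L0 xL0 tL0] := tail_far x (divr_gt0 tx (ltr0n R 2)).
pose g := tail mu x / 2.
have g0 : 0 < g by rewrite divr_gt0.
(* Chosen so that [T >= 1] and [T * (x - z1) * (z' - z1) * g >= 4]; one more factor [T] comes from
   [expR (T * (x - z1)) >= T * (x - z1)]. *)
pose T := 1 + 4 / ((x - z1) * (z' - z1) * g).
have D0 : 0 < (x - z1) * (z' - z1) * g by rewrite !mulr_gt0// subr_gt0.
have T1 : 1 <= T by rewrite /T lerDl divr_ge0// ltW.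
have T0 : 0 < T by exact: lt_le_trans T1.
exists z', T, L0; split => //; first by apply: (@far_small T (T + 1)) => //; rewrite ltrDl.
have I1 := integral_exp_itv_ge (ltW T0) xL0.
apply: (@le_trans _ _ (((z' - z1) / 4)%:E * (expR (T * x) * (tail mu x - tail mu L0))%:E)%E).
  rewrite -EFinM lee_fin ler_pdivrMr//.
  have H1 : T * (x - z1) <= expR (T * (x - z1)) by have := expR_ge1Dx (T * (x - z1)); lra.
  have -> : expR (T * x) = expR (T * z1) * expR (T * (x - z1)) by rewrite -expRD; congr expR; ring.
  have H2 : 4 <= T * ((x - z1) * (z' - z1) * g).
    by rewrite /T mulrDl divfK ?gt_eqF// mul1r lerDr ltW.
  have H3 : T * ((x - z1) * (z' - z1) * g) <= T * (T * ((x - z1) * (z' - z1) * g)).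
    by rewrite ler_peMl// mulr_ge0 ?ltW.
  have H4 : g <= tail mu x - tail mu L0 by rewrite /g; move: tL0; lra.
  have T0' : 0 <= T by exact: ltW.
  have g0' : 0 <= g by exact: ltW.
  have zz0 : 0 <= z' - z1 by rewrite subr_ge0 ltW.
  have xz0 : 0 <= x - z1 by lra.
  have H5 : (z' - z1) * g * T * (T * (x - z1)) <= (z' - z1) * (tail mu x - tail mu L0) * T * expR (T * (x - z1)).
    apply: ler_pM => //.
    - by apply: mulr_ge0 => //; apply: mulr_ge0.
    - exact: mulr_ge0.
    - by rewrite ler_wpM2r// ler_wpM2l.
  have H6 : 1 <= (z' - z1) / 4 * (expR (T * (x - z1)) * (tail mu x - tail mu L0)) * T by lra.
  rewrite -[leLHS]mulr1.
  apply: le_trans (_ : expR (T * z1) * ((z' - z1) / 4 * (expR (T * (x - z1)) * (tail mu x - tail mu L0)) * T) <= _).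
    by rewrite ler_wpM2l ?expR_ge0.
  by rewrite le_eqVlt; apply/orP; left; apply/eqP; ring.
apply: lee_wpmul2l; first by rewrite lee_fin divr_ge0// subr_ge0 ltW.
apply: le_trans I1 _; apply: ge0_le_integralT => y; rewrite lee_fin.
  by rewrite mulr_ge0 ?expR_ge0 ?indicE.
rewrite ler_wpM2l ?expR_ge0// !indicE ler_nat.
have [|_] := boolP (y \in `[x, L0[%classic) => //.
rewrite inE /= in_itv/= => /andP[xy yL]; rewrite mem_set//= in_itv/= yL andbT.
exact: le_trans xy.
Qed.

End Moments.

(** * Tails of log-concave measures *)

Section LogConcave.
Variables (R : realType) (mu : probability R R).
Hypothesis mu_even : even_measure mu.

(** Beyond [X] the line is cut into layers of width [d], with [expR (- (s - t) * d) = 1/2], so the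
    bounds [c k * tail (X + k * d)] decrease geometrically. *)
Lemma mgf_finite_of_tail (t s X : R) : 0 < t -> t < s -> 0 <= X ->
  (forall x, X <= x -> tail mu x <= expR (- s * x)) -> (mgf mu t < +oo)%E.
Proof.
move=> t0 ts X0 Ht.
pose d := ln 2 / (s - t).
have st0 : 0 < s - t by rewrite subr_gt0.
have d0 : 0 < d by rewrite divr_gt0// ln_gt0// ltr1n.
pose c k := expR (t * (X + k.+1%:R * d)).
pose A k := `[X + k%:R * d, +oo[%classic : set R.
have mA k : measurable (A k) by exact: measurable_itv.
pose F k x := ((c k)%:E * (\1_(A k) x : R)%:E)%E.
have F0 k x : (0 <= F k x)%E by rewrite mule_ge0 ?lee_fin ?expR_ge0 ?indicE.
have mF k : measurable_fun setT (F k).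
  apply: emeasurable_funM; first exact: measurable_cst.
  by apply/measurable_EFinP; exact: measurable_indic.
have S0 x : (0 <= \sum_(0 <= k <oo) F k x)%E by apply: nneseries_ge0 => k _ _.
have point x : ((expR (t * x))%:E <= (expR (t * X))%:E + \sum_(0 <= k <oo) F k x)%E.
  have [Xx|xX] := leP X x; last first.
    by rewrite -[leLHS]adde0 leeD// lee_fin ler_expR ler_wpM2l ?(ltW t0)// ltW.
  have xh : 0 <= (x - X) / d by rewrite divr_ge0 ?subr_ge0// ltW.
  pose k := Num.truncn ((x - X) / d).
  have /andP[k1 k2] := Num.Theory.truncn_itv xh; rewrite -/k in k1 k2.
  rewrite ler_pdivlMr// in k1; rewrite ltr_pdivrMr// in k2.
  rewrite -[leLHS]add0e leeD ?lee_fin ?expR_ge0//.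
  apply: le_trans (nneseries_lim_ge k.+1 _); last by move=> j _ _.
  rewrite big_mkord (bigD1 (ord_max : 'I_k.+1))//= -[leLHS]adde0 leeD ?sume_ge0//.
  rewrite /F indicE mem_set; last by rewrite /A /= in_itv/= andbT; move: k1; lra.
  rewrite mule1 lee_fin /c ler_expR ler_wpM2l ?(ltW t0)//; move: k2; lra.
apply: (@le_lt_trans _ _ (\int[mu]_x ((expR (t * X))%:E + \sum_(0 <= k <oo) F k x))%E).
  by apply: ge0_le_integralT => x //; rewrite lee_fin expR_ge0.
have mS : measurable_fun setT (fun x => \sum_(0 <= k <oo) F k x)%E.
  exact: (ge0_emeasurable_sum (P := xpredT)).
rewrite ge0_integralD//; try by move=> x _; rewrite lee_fin expR_ge0.
rewrite integral_prob_cst integral_nneseries//.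
apply: lte_add_pinfty; first exact: ltry.
pose C := expR (t * (X + d)) * expR (- s * X) * 2.
have C0 : 0 <= C by rewrite !mulr_ge0 ?expR_ge0.
apply: le_lt_trans (ltry C); apply: le_trans (epsilon_trick0 xpredT C0).
apply: lee_nneseries => [k _ _|k _]; first by apply: integral_ge0.
rewrite /F ge0_integralZl//; try (by apply/measurable_EFinP; exact: measurable_indic);
  try (by rewrite lee_fin expR_ge0); try by move=> x _; rewrite lee_fin indicE.
rewrite integral_indicE// -EFinM lee_fin.
apply: (@le_trans _ _ (c k * expR (- s * (X + k%:R * d)))).
  rewrite ler_wpM2l ?expR_ge0//; apply: Ht.
  by rewrite lerDl mulr_ge0// ltW.
have e2 : expR (- (s - t) * (k%:R * d)) = 2 ^- k.
  have -> : - (s - t) * (k%:R * d) = - (k%:R * ln 2).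
    by rewrite /d; field; rewrite gt_eqF.
  by rewrite expRN expRM_natl lnK// posrE.
rewrite /c /C natrX exprS -expRD.
have -> : t * (X + k.+1%:R * d) + - s * (X + k%:R * d) =
    t * (X + d) + (- s * X) + (- (s - t) * (k%:R * d)).
  by rewrite -natr1; ring.
rewrite expRD expRD e2 le_eqVlt; apply/orP; left; apply/eqP.
by rewrite invfM; field; rewrite expf_neq0.
Qed.

(** Log-concavity concerns compact sets, so the half-lines are truncated to intervals of a common
    length [K], whose combination is again an interval of length [K]. The strict inequalities absorb
    the truncation. *)
Lemma log_concave_tail x y l al be : log_concave mu -> 0 < l < 1 ->
  0 < al -> al < tail mu x -> 0 < be -> be < tail mu y ->
  al `^ l * be `^ (1 - l) <= tail mu (l * x + (1 - l) * y).
Proof.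
move=> lc l01 al0 alx be0 bey; have /andP[l0 l1] := l01.
have window z ga : ga < tail mu z -> exists2 K, 0 <= K & forall K', K <= K' ->
    ga <= fine (mu `[z, z + K']%classic).
  move=> gaz; have [L zL HL] := @tail_far _ mu (tail mu z - ga) z (ltac:(by rewrite subr_gt0)).
  exists (L - z) => [|K' HK']; first by rewrite subr_ge0.
  apply: (@le_trans _ _ (fine (mu `[z, L[%classic))); first by rewrite mu_itv_co//; lra.
  apply: fine_mu_mono => //; try exact: measurable_itv.
  by move=> u /=; rewrite !in_itv/= => /andP[-> /=]; lra.
have [K1 K10 HK1] := window x al alx; have [K2 K20 HK2] := window y be bey.
pose K := Num.max K1 K2.
have K0 : 0 <= K by rewrite le_max K10.
have a1 : al <= fine (mu `[x, x + K]%classic) by apply: HK1; rewrite le_max lexx.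
have b1 : be <= fine (mu `[y, y + K]%classic) by apply: HK2; rewrite le_max lexx orbT.
have := lc _ _ l (@segment_compact _ x (x + K)) (@segment_compact _ y (y + K)) l01.
set I := [set _ | _ in _ & _ in _].
have IE : I = `[l * x + (1 - l) * y, l * x + (1 - l) * y + K]%classic.
  apply/seteqP; split => [_ [a +] [b +] <-|u] /=.
    rewrite !in_itv/= => /andP[xa ax] /andP[yb by_]; have l2 : 0 < 1 - l by lra.
    have := ler_wpM2l (ltW l0) xa; have := ler_wpM2l (ltW l0) ax.
    have := ler_wpM2l (ltW l2) yb; have := ler_wpM2l (ltW l2) by_.
    by move=> h1 h2 h3 h4; apply/andP; split; lra.
  rewrite in_itv/= => /andP[u1 u2]; pose s := u - (l * x + (1 - l) * y).
  exists (x + s); first by rewrite /= in_itv/= /s; apply/andP; split; lra.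
  exists (y + s); first by rewrite /= in_itv/= /s; apply/andP; split; lra.
  by rewrite /s; ring.
rewrite IE => H.
apply: le_trans (_ : fine (mu `[x, x + K]%classic) `^ l * fine (mu `[y, y + K]%classic) `^ (1 - l) <= _).
  apply: ler_pM; rewrite ?powR_ge0//.
    by apply: ge0_ler_powR; rewrite ?nnegrE ?fine_mu_ge0// ltW.
  by apply: ge0_ler_powR; rewrite ?nnegrE ?fine_mu_ge0// ?subr_ge0 ltW.
apply: le_trans H _; apply: fine_mu_mono => //; try exact: measurable_itv.
by move=> u /=; rewrite !in_itv/= => /andP[->].
Qed.

(** If the bound failed at x, log-concavity would keep the tail beyond x below the exponential
    through [al] at 0 and [tail mu x] at x, whose rate [s] exceeds [b]. The moment generating
    function would then be finite at the midpoint of [b] and [s], past the end of its domain. *)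
Lemma log_concave_tail_ge b : log_concave mu -> (forall x, 0 < tail mu x) ->
  0 < b -> (forall t, b < t -> ~ (mgf mu t < +oo)%E) ->
  forall x, 0 <= x -> tail mu 0 * expR (- b * x) <= tail mu x.
Proof.
move=> lc tp b0 Hb x; rewrite le_eqVlt => /orP[/eqP <-|x0].
  by rewrite mulr0 expR0 mulr1.
rewrite leNgt; apply/negP => H.
(* Strictly below [tail mu 0], as [log_concave_tail] demands, and strictly above
   [tail mu x * expR (b * x)], which gives [b < s]. *)
pose al := (tail mu 0 + tail mu x * expR (b * x)) / 2.
have ee : expR (- b * x) * expR (b * x) = 1 by rewrite -expRD mulNr addNr expR0.
have eb : 0 < expR (b * x) by exact: expR_gt0.
have H' : tail mu x * expR (b * x) < tail mu 0.
  have := H; rewrite -(ltr_pM2r eb) -mulrA ee mulr1//.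
have al0 : 0 < al by rewrite divr_gt0// addr_gt0// mulr_gt0.
have al1 : al < tail mu 0 by rewrite /al; lra.
have al2 : tail mu x * expR (b * x) < al by rewrite /al; lra.
pose s := ln (al / tail mu x) / x.
have sx : s * x = ln al - ln (tail mu x) by rewrite /s divfK ?gt_eqF// ln_div ?posrE.
have bs : b < s.
  have at0 : 0 < al / tail mu x by rewrite (divr_gt0 al0).
  rewrite /s ltr_pdivlMr// -[ltLHS]expRK ltr_ln ?posrE ?expR_gt0//.
  by rewrite ltr_pdivlMr// mulrC.
have Hy y : x < y -> tail mu y <= al * expR (- s * y).
  move=> xy; have y0 : 0 < y by exact: lt_trans xy.
  rewrite leNgt; apply/negP => Hlt.
  pose be := (al * expR (- s * y) + tail mu y) / 2.
  have w0 : 0 < al * expR (- s * y) by rewrite mulr_gt0// expR_gt0.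
  have be0 : 0 < be by rewrite divr_gt0// addr_gt0.
  have be1 : be < tail mu y by rewrite /be; lra.
  have be2 : al * expR (- s * y) < be by rewrite /be; lra.
  pose l := 1 - x / y.
  have xy1 : x / y < 1 by rewrite ltr_pdivrMr// mul1r.
  have xy0 : 0 < x / y by rewrite divr_gt0.
  have l01 : 0 < l < 1 by rewrite /l; apply/andP; split; lra.
  have := log_concave_tail lc l01 al0 al1 be0 be1.
  have -> : l * 0 + (1 - l) * y = x by rewrite /l; field; rewrite gt_eqF.
  have pl : 0 < al `^ l by exact: powR_gt0.
  have pb : 0 < be `^ (1 - l) by exact: powR_gt0.
  have plb : 0 < al `^ l * be `^ (1 - l) by exact: mulr_gt0.
  rewrite -ler_ln ?posrE// lnM ?posrE// !ln_powR.
  have lb : ln al - s * y < ln be.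
    have es : 0 < expR (- s * y) by exact: expR_gt0.
    by move: be2; rewrite -ltr_ln ?posrE// lnM ?posrE// expRK mulNr.
  have lb' : x / y * (ln al - s * y) < x / y * ln be by rewrite ltr_pM2l.
  have e1 : x / y * (ln al - s * y) = x / y * ln al - s * x by field; rewrite gt_eqF.
  rewrite leNgt => /negP; apply; rewrite /l.
  have e2 : (1 - (1 - x / y)) * ln be = x / y * ln be by ring.
  by rewrite e2; move: lb'; rewrite e1 sx; lra.
have al_le1 : al <= 1.
  by apply: le_trans (ltW al1) _; rewrite -lee_fin tailE probability_le1.
have [bt ts] := midf_lt bs.
apply: (Hb _ bt); apply: (mgf_finite_of_tail (lt_trans b0 bt) ts (X := x + 1)); first lra.
move=> y xy; apply: le_trans (Hy y _) _; first lra.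
by rewrite -[leRHS]mul1r ler_wpM2r ?expR_ge0.
Qed.

(** A window [[L, L'[] contributes at least [c0 / 2] to the moment of order [b] once [L'] is so far
    that [tail mu L'] is at most half of [c0 * expR (- b * L)]; [m] such windows are placed end to
    end. *)
Lemma exp_windows b c0 z' : 0 < b -> 0 < c0 -> 0 <= z' ->
  (forall x, 0 <= x -> c0 * expR (- b * x) <= tail mu x) ->
  forall m : nat, exists2 L0, z' <= L0 &
   ((m%:R * (c0 / 2))%:E <= \int[mu]_x (expR (b * x) * \1_(`[z', L0[%classic) x)%:E)%E.
Proof.
move=> b0 c00 z'0 H; elim=> [|m [L zL HL]].
  exists z' => //; rewrite mul0r; apply: integral_ge0 => x _.
  by rewrite lee_fin mulr_ge0 ?expR_ge0 ?indicE.
have L0 : 0 <= L by exact: le_trans zL.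
have e0 : 0 < c0 / 2 * expR (- b * L) by rewrite mulr_gt0 ?divr_gt0 ?expR_gt0.
have [L' LL' HL'] := tail_far mu L e0.
exists L'; first exact: le_trans LL'.
have ee : expR (b * L) * expR (- b * L) = 1 by rewrite -expRD mulNr addrN expR0.
have step : ((c0 / 2)%:E <= \int[mu]_x (expR (b * x) * \1_(`[L, L'[%classic) x)%:E)%E.
  apply: le_trans (integral_exp_itv_ge mu (ltW b0) LL'); rewrite lee_fin.
  have h := H L L0.
  have : expR (b * L) * (c0 / 2 * expR (- b * L)) <= expR (b * L) * (tail mu L - tail mu L').
    by rewrite ler_wpM2l ?expR_ge0//; lra.
  by rewrite mulrCA ee mulr1.
have p0 u v x : (0 <= (expR (b * x) * \1_(`[u, v[%classic) x)%:E)%E.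
  by rewrite lee_fin mulr_ge0 ?expR_ge0 ?indicE.
have me u v : measurable_fun setT (fun x => (expR (b * x) * \1_(`[u, v[%classic) x)%:E).
  by apply/measurable_EFinP; exact: measurable_exp_itv.
rewrite -natr1 mulrDl mul1r EFinD; apply: le_trans (leeD HL step) _.
rewrite -ge0_integralD//; apply: ge0_le_integralT => x; first by rewrite adde_ge0.
rewrite -EFinD lee_fin -mulrDr ler_wpM2l ?expR_ge0//.
rewrite !indicE -natrD ler_nat.
have [|nL] := boolP (x \in `[z', L[%classic); rewrite ?inE /= ?in_itv/=.
  move=> /andP[zx xL]; rewrite [X in (_ + nat_of_bool X)%N]memNset; last first.
    by rewrite /= in_itv/= leNgt xL.
  by rewrite mem_set//= in_itv/= zx/=; exact: lt_le_trans LL'.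
have [|//] := boolP (x \in `[L, L'[%classic); rewrite inE /= in_itv/=.
move=> /andP[Lx xL']; rewrite mem_set//= in_itv/= xL' andbT.
exact: le_trans zL Lx.
Qed.

End LogConcave.

(** * Consequences of admissibility *)

Section Admissible.
Variables (R : realType) (mu : probability R R).
Hypothesis mu_even : even_measure mu.

Lemma tail_gt0_lt_xstar x : (x%:E < xstar mu)%E -> 0 < tail mu x.
Proof.
move=> /ereal_sup_gt[_ [y /= muy <-]]; rewrite lte_fin => xy.
apply: (@lt_le_trans _ _ (tail mu y)); last by apply: tail_nincr; exact: ltW.
by rewrite -lte_fin tailE.
Qed.

Lemma tail_eq0_gt_xstar x : (xstar mu < x%:E)%E -> tail mu x = 0.
Proof.
move=> xx; apply/eqP; rewrite eq_le tail_ge0 andbT leNgt; apply/negP => tx.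
move: xx; rewrite ltNge => /negP; apply; apply: ereal_sup_ubound; exists x => //=.
by rewrite -tailE lte_fin.
Qed.

(** At the end [b] of the domain a bounded window already has a moment as large as desired, but
    negligible far parts are obtained only for [T < b]. Lowering [b] by [dl] with [dl * L0 <= 1/2]
    costs at most a factor 2 on the window. *)
Lemma good_tilt_log_concave z1 r : 0 <= z1 -> xstar mu = +oo%E -> 0 < r ->
  (mgf mu r < +oo)%E -> (exists M : R, forall t, (mgf mu t < +oo)%E -> `|t| <= M) ->
  log_concave mu ->
  exists z' T L0, [/\ z1 < z', 0 < T,
    (forall eta, 0 < eta -> exists L, forall L', L <= L' ->
       (\int[mu]_x (far T L' x)%:E <= eta%:E)%E) &
    ((expR (T * z1) / T)%:E <=
      ((z' - z1) / 4)%:E * \int[mu]_x (expR (T * x) * \1_(`[z', L0[%classic) x)%:E)%E].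
Proof.
move=> z10 xoo r0 fr [M HM] lc.
pose D := [set t : R | (mgf mu t < +oo)%E].
have hD : has_sup D.
  split; first by exists r.
  by exists M => t /HM; apply: le_trans; exact: ler_norm.
have ubD t : D t -> t <= sup D by move=> Dt; apply: ub_le_sup => //; case: hD.
pose b := sup D.
have b0 : 0 < b by apply: lt_le_trans (ubD r fr).
have Hb t : b < t -> ~ (mgf mu t < +oo)%E.
  by move=> bt /ubD; rewrite -/b leNgt bt.
have tp x : 0 < tail mu x by apply: tail_gt0_lt_xstar; rewrite xoo ltry.
have tge := log_concave_tail_ge lc tp b0 Hb.
have z'0 : 0 <= z1 + 1 by lra.
(* As [T >= b / 2] and [(z' - z1) / 4 = 1/4], the target is at most [2 * expR (b * z1) / b = Q / 4],
   which is a quarter of half of [2 * Q]. *)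
pose Q := 8 * expR (b * z1) / b.
have Q0 : 0 < Q by rewrite divr_gt0// mulr_gt0// expR_gt0.
have c20 : 0 < tail mu 0 / 2 by rewrite divr_gt0.
have [L0 zL0 HL0] := exp_windows b0 (tp 0) z'0 tge (Num.truncn (2 * Q / (tail mu 0 / 2))).+1.
have HQ : ((2 * Q)%:E <= \int[mu]_x (expR (b * x) * \1_(`[(z1 + 1), L0[%classic) x)%:E)%E.
  apply: le_trans HL0; rewrite lee_fin -ler_pdivrMr//.
  by rewrite ltW// Num.Theory.truncnS_gt.
have L00 : 0 < L0 by apply: lt_le_trans zL0; lra.
pose dl := Num.min (b / 2) ((2 * L0)^-1).
have dl0 : 0 < dl by rewrite lt_min divr_gt0// invr_gt0 mulr_gt0.
have dl1 : dl <= b / 2 by rewrite ge_min lexx.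
have dl2 : dl * L0 <= 2^-1.
  have : dl <= (2 * L0)^-1 by rewrite ge_min lexx orbT.
  by rewrite invfM -ler_pdivrMr ?invr_gt0// invrK.
pose T := b - dl.
have Tb : T < b by rewrite /T; lra.
have Tb2 : b / 2 <= T by rewrite /T; lra.
have T0 : 0 < T by apply: lt_le_trans Tb2; rewrite divr_gt0.
exists (z1 + 1), T, L0; split => //; first by lra.
  have bT0 : 0 < b - T by rewrite subr_gt0.
  have [t Dt Tt] := sup_adherent bT0 hD.
  apply: (far_small mu_even T0 _ Dt); move: Tt; rewrite -/b; lra.
have half : ((2^-1)%:E * \int[mu]_x (expR (b * x) * \1_(`[(z1 + 1)%R, L0[%classic) x)%:E <=
   \int[mu]_x (expR (T * x) * \1_(`[(z1 + 1)%R, L0[%classic) x)%:E)%E.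
  have mexp : measurable_fun setT
      (fun x : R => (expR (b * x) * \1_(`[(z1 + 1)%R, L0[%classic) x)%:E).
    by apply/measurable_EFinP; exact: measurable_exp_itv.
  rewrite -(ge0_integralZl_EFin mu measurableT _ mexp);
    [|by move=> x _; rewrite lee_fin mulr_ge0 ?expR_ge0 ?indicE|by rewrite invr_ge0].
  apply: ge0_le_integralT => x; rewrite -EFinM lee_fin.
    by rewrite !mulr_ge0 ?expR_ge0 ?indicE ?invr_ge0.
  rewrite indicE; have [|_] := boolP (x \in _); last by rewrite !mulr0.
  rewrite inE /= in_itv/= !mulr1 => /andP[zx xL].
  have h1 : 2^-1 <= expR (- (dl * x)).
    have : dl * x <= dl * L0 by rewrite ler_wpM2l ?ltW.
    by have := expR_ge1Dx (- (dl * x)); lra.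
  apply: (@le_trans _ _ (expR (- (dl * x)) * expR (b * x))).
    by rewrite ler_wpM2r ?expR_ge0.
  by rewrite -expRD ler_expR /T mulrBl addrC.
have -> : (z1 + 1 - z1) / 4 = 4^-1 by field.
apply: (@le_trans _ _ ((4^-1)%:E * ((2^-1)%:E * (2 * Q)%:E))%E).
  rewrite -!EFinM lee_fin.
  have -> : 4^-1 * (2^-1 * (2 * Q)) = expR (b * z1) / (b / 2).
    by rewrite /Q; field; rewrite gt_eqF.
  apply: ler_pM; rewrite ?expR_ge0 ?invr_ge0 ?(ltW T0)//.
    by rewrite ler_expR ler_wpM2r// ltW.
  by rewrite lef_pV2 ?posrE// divr_gt0.
apply: lee_wpmul2l; first by rewrite lee_fin.
apply: le_trans half; apply: lee_wpmul2l => //; by rewrite lee_fin.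
Qed.

Lemma mgf_bounded_support : (xstar mu < +oo)%E -> forall t, (mgf mu t < +oo)%E.
Proof.
move=> xfin.
suff pos t : 0 <= t -> (mgf mu t < +oo)%E.
  move=> t; have [t0|t0] := leP 0 t; first exact: pos.
  by rewrite -(mgfN mu_even); apply: pos; rewrite oppr_ge0 ltW.
move=> t0.
have [X HX] : exists X : R, tail mu X = 0.
  move: xfin; case E : (xstar mu) => [a| |]// _.
    by exists (a + 1); apply: tail_eq0_gt_xstar; rewrite E lte_fin ltrDl.
  by exists 0; apply: tail_eq0_gt_xstar; rewrite E ltNyr.
have mI : measurable (`[X, +oo[%classic : set R) by exact: measurable_itv.
apply: (@le_lt_trans _ _ (\int[mu]_x (expR (t * X))%:E)%E); last first.
  by rewrite integral_prob_cst ltry.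
apply: ae_ge0_le_integral => //; try (by move=> x _; rewrite lee_fin expR_ge0);
  try (by apply/measurable_EFinP; exact: measurable_expM).
exists (`[X, +oo[%classic); split.
- exact: mI.
- by have := esym (tailE mu X); rewrite HX.
- move=> x /=; apply: contra_notP => /negP; rewrite in_itv/= andbT -ltNge => xX _.
  by rewrite lee_fin ler_expR ler_wpM2l// ltW.
Qed.

(** For finite [xstar = a] the half-lines from [z n] decrease to the half-line from [a], which is
    the point [a], of mass 0 by hypothesis, together with half-lines strictly beyond [xstar]. *)
Lemma tail_near_xstar e : 0 < e -> (0 < xstar mu)%E ->
  (forall a : R, xstar mu = a%:E -> mu [set a] = 0%E) ->
  exists z, [/\ 0 <= z, (z%:E < xstar mu)%E & tail mu z <= e].
Proof.
move=> e0 xpos atom.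
case E : (xstar mu) => [a| |]; last by move: xpos; rewrite E.
  have a0 : 0 < a by rewrite -lte_fin -E.
  pose z (n : nat) : R := a - a / n.+2%:R.
  have z0 n : 0 <= z n.
    by rewrite subr_ge0 ler_pdivrMr// ler_peMr ?ler1n// ltW.
  have [|n m nm||n Hn] := @mu_bigcap_small _ mu (fun n => `[z n, +oo[%classic) _ _ _ e e0.
  - by move=> n; exact: measurable_itv.
  - apply/subsetPset => v /=; rewrite !in_itv/= !andbT; apply: le_trans.
    by rewrite lerD2l lerN2 ler_pM2l// lef_pV2 ?posrE// ler_nat !ltnS.
  - apply/eqP; rewrite eq_le measure_ge0 andbT.
    have upper : (mu (\bigcup_n `[(a + n.+1%:R^-1)%R, +oo[%classic) <= 0)%E.
      apply: mu_bigcup_le => [n|n m nm|n]; first exact: measurable_itv.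
        apply/subsetPset => v /=; rewrite !in_itv/= !andbT; apply: le_trans.
        by rewrite lerD2l lef_pV2 ?posrE// ler_nat.
      rewrite -tailE lee_fin tail_eq0_gt_xstar// E lte_fin ltrDl invr_gt0//.
    apply: (@le_trans _ _ (mu ([set a] `|` \bigcup_n `[(a + n.+1%:R^-1)%R, +oo[%classic))).
      apply: le_measure; rewrite ?inE.
      + by apply: bigcapT_measurable => n; exact: measurable_itv.
      + apply: measurableU; first exact: measurable_set1.
        by apply: bigcup_measurable => n _; exact: measurable_itv.
      move=> v Hv; have av : a <= v.
        rewrite leNgt; apply/negP => va.
        have : 0 < (a - v) / a by rewrite divr_gt0// subr_gt0.
        move=> /ltr_add_invr[k]; rewrite add0r => Hk.
        have := Hv k I; rewrite /= in_itv/= andbT /z leNgt => /negP; apply.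
        have kk : k.+2%:R^-1 < (a - v) / a.
          by apply: le_lt_trans Hk; rewrite lef_pV2 ?posrE// ler_nat.
        by rewrite ltrBrDr -ltrBrDl; move: kk; rewrite ltr_pdivlMr// mulrC.
      have [->|va] := eqVneq v a; [by left | right].
      have : 0 < v - a by rewrite subr_gt0 lt_neqAle eq_sym va.
      move=> /ltr_add_invr[k]; rewrite add0r => Hk.
      by exists k => //=; rewrite in_itv/= andbT -lerBrDl ltW.
    apply: le_trans (measureU2 _ _ _) _ => //.
      by apply: bigcup_measurable => n _; exact: measurable_itv.
    by rewrite [X in (X + _)%E](atom a E) add0e.
  - exists (z n); split => //; first by rewrite lte_fin /z ltrBlDr ltrDl divr_gt0.
    by rewrite -lee_fin tailE.
have [n Hn] := tail_small mu e0.
by exists n%:R; split => //; rewrite ltry.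
Qed.

Lemma mu_abs_gt z : 0 <= z -> (mu [set v : R | (z < `|v|)%R] <= (2 * tail mu z)%:E)%E.
Proof.
move=> z0; have m1 : measurable (`[z, +oo[%classic : set R) by exact: measurable_itv.
have m2 : measurable ((fun x : R => - x) @^-1` `[z, +oo[%classic).
  by rewrite -[X in measurable X]setTI; exact: oppr_measurable.
apply: (@le_trans _ _ (mu (`[z, +oo[%classic `|` (fun x : R => - x) @^-1` `[z, +oo[%classic))).
  apply: le_measure; rewrite ?inE.
  - rewrite (_ : [set v : R | _] = (@Num.norm _ R) @^-1` ~` [set w | w <= z]).
      rewrite -[X in measurable X]setTI.
      by apply: normr_measurable => //; apply: measurableC; exact: measurable_le_l.
    apply/seteqP; split => v /=; first by move=> h; apply/negP; rewrite -ltNge.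
    by move=> /negP h; rewrite ltNge h.
  - exact: measurableU.
  - move=> v /=; rewrite !in_itv/= !andbT; have [v0|v0] := leP 0 v.
      by rewrite (ger0_norm v0) => /ltW; left.
    by rewrite (ltr0_norm v0) => /ltW; right.
apply: le_trans (measureU2 _ m1 m2) _.
have e1 : mu `[z, +oo[%classic = (tail mu z)%:E by rewrite tailE.
have e2 : mu ((fun x : R => - x) @^-1` `[z, +oo[%classic) = (tail mu z)%:E.
  by rewrite (mu_even m1) tailE.
by rewrite [X in (X + _)%E]e1 [X in (_ + X)%E]e2 -EFinD lee_fin; lra.
Qed.

(** Otherwise symmetry makes [mu] the point mass at 0, and measurable functions vanishing at 0 have
    integral 0: first the identity, so the mean is 0, then the square. *)
Lemma tail_pos_of_variance : (0 < Defs.variance mu)%E -> exists2 s, 0 < s & 0 < tail mu s.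
Proof.
move=> var0; apply: contrapT => H.
have t0 s : 0 < s -> tail mu s = 0.
  move=> s0; apply/eqP; rewrite eq_le tail_ge0 andbT leNgt; apply/negP => ts.
  by apply: H; exists s.
have nz : (mu [set v : R | (0 < `|v|)%R] <= 0)%E.
  have E : [set v : R | (0 < `|v|)%R] = \bigcup_n [set v : R | (n.+1%:R^-1 < `|v|)%R].
    apply/seteqP; split => v /=.
      by move=> /ltr_add_invr[n]; rewrite add0r => Hn; exists n.
    by move=> [n _] /=; apply: lt_trans; rewrite invr_gt0.
  rewrite E; apply: mu_bigcup_le => [n|n m nm|n].
  - rewrite (_ : [set v : R | _] = (@Num.norm _ R) @^-1` ~` [set w | w <= n.+1%:R^-1]).
      rewrite -[X in measurable X]setTI.
      by apply: normr_measurable => //; apply: measurableC; exact: measurable_le_l.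
    apply/seteqP; split => v /=; first by move=> h; apply/negP; rewrite -ltNge.
    by move=> /negP h; rewrite ltNge h.
  - apply/subsetPset => v /=; apply: le_lt_trans.
    by rewrite lef_pV2 ?posrE// ler_nat.
  - apply: le_trans (mu_abs_gt _) _; first by rewrite invr_ge0.
    by rewrite t0 ?mulr0// invr_gt0.
have ae0 (f : R -> \bar R) : measurable_fun setT f -> f 0 = 0%E -> (\int[mu]_x f x = 0)%E.
  move=> mf f0; rewrite (ae_eq_integral (cst 0%E))//; first exact: integral0.
  exists [set v : R | (0 < `|v|)%R]; split.
  - rewrite (_ : [set v : R | _] = (@Num.norm _ R) @^-1` ~` [set w | w <= 0]).
      rewrite -[X in measurable X]setTI.
      by apply: normr_measurable => //; apply: measurableC; exact: measurable_le_l.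
    apply/seteqP; split => v /=; first by move=> h; apply/negP; rewrite -ltNge.
    by move=> /negP h; rewrite ltNge h.
  - by apply/eqP; rewrite eq_le nz measure_ge0.
  - move=> v /=; apply: contra_notP => /negP; rewrite normr_gt0 negbK => /eqP ->.
    by rewrite f0.
move: var0; rewrite /Defs.variance ae0 ?ltxx//.
- apply/measurable_EFinP; apply: measurable_funX; apply: measurable_funB.
    exact: measurable_id.
  exact: measurable_cst.
- rewrite /Defs.mean ae0//= ?subrr ?expr0n//.
Qed.

End Admissible.

(** * The threshold *)

Section Final.
Variables (R : realType) (mu : probability R R).
Hypothesis mu_even : even_measure mu.
Local Notation E f := (Rintegral mu setT f).

Lemma expR_le_quad_abs (y : R) : expR y <= 1 + y + 4 * (y ^+ 2 * expR `|y|).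
Proof.
have [y2|y2] := leP y 2^-1.
  apply: le_trans (expR_le_quad y2) _; rewrite lerD2l.
  have e1 : 1 <= expR `|y| by rewrite -[leLHS]expR0 ler_expR.
  have : y ^+ 2 * 1 <= y ^+ 2 * expR `|y| by rewrite ler_wpM2l ?sqr_ge0.
  have := sqr_ge0 y; lra.
have y0 : 0 <= y by lra.
rewrite (ger0_norm y0).
have yy : 2^-1 * 2^-1 <= y * y by apply: ler_pM => //; exact: ltW.
have : 4^-1 * expR y <= y ^+ 2 * expR y.
  by rewrite ler_wpM2r ?expR_ge0// expr2; lra.
lra.
Qed.

(** Adding the values at [t] and [- t], equal by symmetry, cancels the linear term of the
    exponential. In the remainder two of the three [rho] in [3 * rho] absorb [x ^+ 2] and the third
    absorbs [expR |t * x|]. *)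
Lemma mgf_quadratic r : 0 < r -> (forall t, - r < t < r -> (mgf mu t < +oo)%E) ->
  exists rD : R * R, [/\ 0 < rD.1, 0 <= rD.2 & forall t, 0 <= t -> t <= rD.1 ->
    (mgf mu t <= (expR (rD.2 * t ^+ 2))%:E)%E].
Proof.
move=> r0 fr; pose rho := r / 8.
have rho0 : 0 < rho by rewrite divr_gt0.
have f3 : (mgf mu (3 * rho) < +oo)%E by apply: fr; rewrite /rho; apply/andP; split; lra.
pose K2 := fine (mgf mu (3 * rho)).
have K2E : mgf mu (3 * rho) = K2%:E by exact: mgf_finE.
have K20 : 0 <= K2 by rewrite fine_ge0// mgf_ge0.
pose D := 8 * rho ^- 2 * K2.
have r20 : 0 <= rho ^- 2 by rewrite invr_ge0 exprn_ge0// ltW.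
have D0 : 0 <= D by rewrite !mulr_ge0.
exists (rho, D); split => //= t t0 trho.
have ft : (mgf mu t < +oo)%E by apply: fr; move: trho; rewrite /rho => ?; apply/andP; split; lra.
pose c := 8 * t ^+ 2 * rho ^- 2.
have c0 : 0 <= c by rewrite !mulr_ge0// sqr_ge0.
have point x : expR (t * x) + expR (- t * x) <=
    2 + c * (expR (3 * rho * x) + expR (- (3 * rho) * x)).
  have h1 := expR_le_quad_abs (t * x); have := expR_le_quad_abs (- t * x).
  rewrite [`|- t * x|]normrM normrN -normrM mulNr sqrrN => h2.
  have h3 : (t * x) ^+ 2 * expR `|t * x| <= t ^+ 2 * rho ^- 2 * expR (3 * rho * `|x|).
    have x2 : x ^+ 2 <= rho ^- 2 * expR (2 * rho * `|x|).
      rewrite -[leLHS]real_normK ?num_real//.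
      have : (rho * `|x|) ^+ 2 <= expR (rho * `|x|) ^+ 2.
        rewrite lerXn2r ?nnegrE ?expR_ge0//; first by rewrite mulr_ge0// ltW.
        by have := expR_ge1Dx (rho * `|x|); lra.
      rewrite -expRM_natl exprMn [2%:R * _]mulrA => h.
      by rewrite [leRHS]mulrC ler_pdivlMr ?exprn_gt0// [leLHS]mulrC.
    have tx : expR `|t * x| <= expR (rho * `|x|).
      by rewrite ler_expR normrM (ger0_norm t0) ler_wpM2r.
    have -> : expR (3 * rho * `|x|) = expR (2 * rho * `|x|) * expR (rho * `|x|).
      by rewrite -expRD; congr expR; ring.
    rewrite exprMn -!(mulrA (t ^+ 2)) ler_wpM2l ?sqr_ge0// (mulrA (rho ^- 2)).
    by apply: ler_pM => //; rewrite ?sqr_ge0 ?expR_ge0.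
  have h4 : expR (3 * rho * `|x|) <= expR (3 * rho * x) + expR (- (3 * rho) * x).
    have [x0|x0] := leP 0 x; first by rewrite (ger0_norm x0) lerDl expR_ge0.
    by rewrite (ltr0_norm x0) mulrN -mulNr lerDr expR_ge0.
  have h5 : t ^+ 2 * rho ^- 2 * expR (3 * rho * `|x|) <=
      t ^+ 2 * rho ^- 2 * (expR (3 * rho * x) + expR (- (3 * rho) * x)).
    by rewrite ler_wpM2l// mulr_ge0// sqr_ge0.
  by rewrite /c; move: h1 h2 h3 h5; rewrite mulNr; lra.
have m1 s : measurable_fun setT (fun x : R => (expR (s * x))%:E).
  by apply/measurable_EFinP; exact: measurable_expM.
have p1 s (x : R) : (0 <= (expR (s * x))%:E)%E by rewrite lee_fin expR_ge0.
have intD s s' : (\int[mu]_x ((expR (s * x))%:E + (expR (s' * x))%:E) = mgf mu s + mgf mu s')%E.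
  by rewrite ge0_integralD.
have H2 : (mgf mu t + mgf mu (- t) <= 2%:E + c%:E * (mgf mu (3 * rho) + mgf mu (- (3 * rho))))%E.
  rewrite -!intD -[2%:E](integral_prob_cst mu) -ge0_integralZl//; try (by apply: emeasurable_funD);
    try (by move=> x _; apply: adde_ge0); try (by rewrite lee_fin).
  rewrite -ge0_integralD//; try (by move=> x _; rewrite mule_ge0 ?lee_fin// addr_ge0 ?expR_ge0);
    try (by apply: emeasurable_funM; [exact: measurable_cst | exact: emeasurable_funD]).
  apply: ge0_le_integralT => x; first by apply: adde_ge0.
  by have := point x; rewrite -lee_fin !EFinD EFinM EFinD.
have K2N : mgf mu (- (3 * rho)) = K2%:E by rewrite mgfN.
move: H2; rewrite mgfN// K2E K2N (mgf_finE ft) -(EFinD K2) -(EFinM c) -(EFinD 2) -(EFinD (fine _)) !lee_fin => H2.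
have := expR_ge1Dx (D * t ^+ 2).
have -> : D * t ^+ 2 = c * K2 by rewrite /D /c; ring.
lra.
Qed.

(** A small slope [t1] gives each coordinate with [|v| >= s] the positive rate
    [t1 * s - D * t1 ^+ 2]. The resulting [a0 > 0] does not depend on [delta], and it keeps the
    threshold window at rates where [N > n] is possible. *)
Lemma Emu_small_pos r s : 0 < r -> (forall t, - r < t < r -> (mgf mu t < +oo)%E) ->
  0 < s -> 0 < tail mu s -> exists2 a0 : R, 0 < a0 &
  forall delta : R, 0 < delta -> exists n0, forall n, (n0 <= n)%N -> forall N,
    N%:R <= expR (a0 * n%:R) -> (Emu mu n N <= delta%:E)%E.
Proof.
move=> r0 fr s0 ts.
have [[rho D] /= [rho0 D0 HD]] := mgf_quadratic r0 fr.
pose t1 := Num.min rho (s / (2 * (D + 1))).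
have D1 : 0 < 2 * (D + 1) by rewrite mulr_gt0// ltr_wpDl.
have t10 : 0 < t1 by rewrite lt_min rho0 divr_gt0.
have t1r : t1 <= rho by rewrite ge_min lexx.
have t1s : t1 * (2 * (D + 1)) <= s by rewrite -ler_pdivlMr// ge_min lexx orbT.
pose La := D * t1 ^+ 2.
have La1 : La < t1 * s.
  have : t1 * (t1 * (2 * (D + 1))) <= t1 * s by rewrite ler_wpM2l// ltW.
  have : 0 < t1 * t1 by rewrite mulr_gt0.
  have : 0 <= D * (t1 * t1) by rewrite !mulr_ge0// ltW.
  by rewrite /La expr2; lra.
pose t (v : R) := if s <= `|v| then (if 0 <= v then t1 else - t1) else 0.
pose Lam (v : R) := if s <= `|v| then La else 0.
pose ell (v : R) := if s <= `|v| then t1 * s - La else 0.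
have ms : measurable_fun setT (fun v : R => s <= `|v|).
  by apply: measurable_fun_ler; [exact: measurable_cst | exact: normr_measurable].
have mt : measurable_fun setT t.
  apply: measurable_fun_ifT => //; apply: measurable_fun_ifT => //.
  by apply: measurable_fun_ler; [exact: measurable_cst | exact: measurable_id].
have mLam : measurable_fun setT Lam by exact: measurable_fun_ifT.
have mell : measurable_fun setT ell by exact: measurable_fun_ifT.
have d0 : 0 < t1 * s - La by rewrite subr_gt0.
have ellB v : `|ell v| <= t1 * s - La.
  by rewrite /ell; case: ifP => _; rewrite ?normr0 ?ger0_norm// ltW.
have tLam v : (\int[mu]_w (expR (t v * w))%:E <= (expR (Lam v))%:E)%E.
  rewrite /t /Lam; case: ifPn => [vs|_]; last first.
    rewrite (_ : (fun w => _) = (fun=> 1%:E)) ?integral_prob_cst ?expR0//.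
    by apply/funext => w; rewrite mul0r expR0.
  have H := HD t1 (ltW t10) t1r.
  by case: (0 <= v); [exact: H | rewrite -/(mgf mu (- t1)) mgfN//; exact: H].
have ellt v : ell v <= t v * v - Lam v.
  rewrite /ell /t /Lam; case: ifPn => [vs|_]; last by rewrite mul0r subr0.
  rewrite lerD2r; have [v0|v0] := leP 0 v.
    by rewrite ler_wpM2l ?(ltW t10)//; move: vs; rewrite (ger0_norm v0).
  by rewrite mulNr -mulrN ler_wpM2l ?(ltW t10)//; move: vs; rewrite (ltr0_norm v0).
have mI : measurable (`[s, +oo[%classic : set R) by exact: measurable_itv.
have Eell : (t1 * s - La) * tail mu s <= E ell.
  have mind : measurable_fun setT (\1_(`[s, +oo[%classic) : R -> R) by exact: measurable_indic.
  have bind (x : R) : `|\1_(`[s, +oo[%classic) x : R| <= 1.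
    by rewrite indicE ger0_norm// lern1 leq_b1.
  have iind := bounded_mu_integrable mu mind bind.
  have -> : tail mu s = E (\1_(`[s, +oo[%classic)).
    by rewrite /Rintegral integral_indicE.
  rewrite -RintegralZl//; apply: le_Rintegral => //.
  - apply: (bounded_mu_integrable mu (B := t1 * s - La)).
      by apply: measurable_funM => //; exact: measurable_cst.
    move=> x; rewrite normrM (gtr0_norm d0) -[leRHS]mulr1; apply: ler_wpM2l (bind x); exact: ltW.
  - exact: (bounded_mu_integrable mu mell ellB).
  - move=> x _; rewrite /ell; have [|_] := boolP (x \in _); last first.
      by rewrite mulr0; case: ifP => // _; exact: ltW.
    rewrite inE /= in_itv/= andbT mulr1 => sx.
    by rewrite (le_trans sx (ler_norm x)).
have Epos : 0 < E ell by apply: lt_le_trans Eell; rewrite mulr_gt0.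
exists (E ell / 2); first by rewrite divr_gt0.
move=> delta delta0.
have e4 : 0 < E ell / 4 by rewrite divr_gt0.
have [n0 Hn0] := Emu_small mt mLam mell ellB tLam ellt e4 delta0.
exists n0 => n nn N HN; apply: Hn0 => //; apply: le_trans HN _.
by rewrite ler_expR ler_wpM2r//; lra.
Qed.

Lemma exp_beats_linear (a : R) : 0 < a -> exists n0, forall n, (n0 <= n)%N ->
  n.+2%:R <= expR (a * n%:R).
Proof.
move=> a0; pose n0 := (Num.truncn (3 * 4 / a ^+ 2)).+1.
exists (maxn n0 1) => n; rewrite geq_max => /andP[nn n1].
have n1' : 1 <= n%:R :> R by rewrite ler1n.
have nD : 3 * 4 / a ^+ 2 <= n%:R.
  by apply: ltW; apply: lt_le_trans (Num.Theory.truncnS_gt _) _; rewrite ler_nat.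
rewrite ler_pdivrMr ?exprn_gt0// in nD.
have e2 : (a * n%:R / 2) ^+ 2 <= expR (a * n%:R).
  have y0 : 0 <= a * n%:R / 2 by rewrite divr_ge0// mulr_ge0// ltW.
  have -> : expR (a * n%:R) = expR (a * n%:R / 2) ^+ 2.
    by rewrite -expRM_natl; congr expR; field.
  rewrite lerXn2r ?nnegrE ?expR_ge0//.
  by have := expR_ge1Dx (a * n%:R / 2 : R); lra.
apply: le_trans e2.
have : n%:R * (3 * 4) <= n%:R * (n%:R * a ^+ 2) by rewrite ler_wpM2l.
have -> : (a * n%:R / 2) ^+ 2 = n%:R * (n%:R * a ^+ 2) / 4 by field.
have -> : n.+2%:R = n%:R + 2 :> R by rewrite -addn2 natrD.
move: n1'; lra.
Qed.

Lemma window_exists eps delta : admissible mu -> 0 < eps -> 0 < delta ->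
  exists a b : R, b - a <= 10 * eps /\ exists n0, forall n, (n0 <= n)%N -> forall N,
    (N%:R <= expR (a * n%:R) -> (Emu mu n N <= delta%:E)%E) /\
    (expR (b * n%:R) <= N%:R -> ((1 - delta)%:E <= Emu mu n N)%E).
Proof.
move=> [var [r r0 fr] atom cases] eps0 d0.
have [s s0 ts] := tail_pos_of_variance mu_even var.
have xs : (s%:E <= xstar mu)%E.
  by apply: ereal_sup_ubound; exists s => //=; rewrite -tailE lte_fin.
have xpos : (0 < xstar mu)%E by apply: lt_le_trans xs; rewrite lte_fin.
(* The budget [c] for the expected tail cost is halved: [J] makes [4 * 2 ^- J] at most [c / 2], then
   [z0] is taken so far out that [J] times the mass beyond it is at most [c / 2]. *)
pose c := eps * (delta / 3).
have c0 : 0 < c by rewrite mulr_gt0// divr_gt0.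
have h01 : 0 <= (2^-1 : R) < 1 by rewrite invr_ge0 ler0n/= invf_lt1// ltr1n.
have c80 : 0 < c / 8 by rewrite divr_gt0.
have [J HJ] := expr_cvg0 h01 c80.
have {}HJ : 4 * 2 ^- J <= c / 2.
  by have := HJ J (leqnn J); rewrite exprVn; lra.
have e0 : 0 < c / (4 * J.+1%:R) by rewrite divr_gt0// mulr_gt0.
have [z0 [z00 z0x tz0]] := tail_near_xstar e0 xpos atom.
have HJ2 : J%:R * fine (mu [set v : R | z0 < `|v|]) + 4 * 2 ^- J <= eps * (delta / 3).
  have H1 : fine (mu [set v : R | z0 < `|v|]) <= 2 * (c / (4 * J.+1%:R)).
    have := mu_abs_gt mu_even z00.
    have fz : mu [set v : R | (z0 < `|v|)%R] \is a fin_num.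
      rewrite ge0_fin_numE//; apply: le_lt_trans (mu_abs_gt mu_even z00) _.
      by rewrite ltry.
    rewrite -(fineK fz) lee_fin => h; apply: le_trans h _; rewrite ler_wpM2l//.
  have H2 : J%:R * fine (mu [set v : R | z0 < `|v|]) <= c / 2.
    apply: (@le_trans _ _ (J.+1%:R * (2 * (c / (4 * J.+1%:R))))).
      by apply: ler_pM; rewrite ?fine_ge0// ler_nat.
    by rewrite le_eqVlt; apply/orP; left; apply/eqP; field.
  by rewrite -/c; lra.
have [z1 z01 z1x] : exists2 z1, z0 < z1 & (z1%:E < xstar mu)%E.
  move: z0x; case: (xstar mu) => [x| |]//; rewrite ?lte_fin => zx.
    by exists ((z0 + x) / 2); rewrite ?lte_fin; have := midf_lt zx; case.
  by exists (z0 + 1); [rewrite ltrDl | rewrite ltry].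
have z10 : 0 <= z1 by apply: le_trans (ltW z01).
have [z' [T [L0 [z1z' T0 Hfar HI]]]] : exists z' T L0, [/\ z1 < z', 0 < T,
    (forall eta, 0 < eta -> exists L, forall L', L <= L' ->
       (\int[mu]_x (far T L' x)%:E <= eta%:E)%E) &
    ((expR (T * z1) / T)%:E <=
      ((z' - z1) / 4)%:E * \int[mu]_x (expR (T * x) * \1_(`[z', L0[%classic) x)%:E)%E].
  case: cases => [xf|[xoo Lf]|[xoo [M HM] lc]].
  - by apply: (good_tilt_entire mu_even) => //; exact: (mgf_bounded_support mu_even xf).
  - by apply: (good_tilt_entire mu_even) => // t; rewrite -Lambda_mgf.
  - apply: (good_tilt_log_concave mu_even (r := r / 2)) => //.
    + by rewrite divr_gt0.
    + by apply: fr; apply/andP; split; lra.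
    + by exists M => t; rewrite -Lambda_mgf; exact: HM.
exact: (Emu_window mu_even z00 z01 z1z' T0 eps0 d0 Hfar HI HJ2).
Qed.

End Final.

Theorem theorem1p1 (R : realType) (mu : probability R R) :
  admissible mu -> even_measure mu -> Lambda_star_condition mu ->
  forall delta : R, 0 < delta < 1 / 2 ->
  ((rho2 mu n delta - rho1 mu n delta)%E @[n --> \oo] --> 0%E).
Proof.
move=> adm mu_even _ delta /andP[d0 d2].
have [var [r r0 fr] _ _] := adm.
have [s s0 ts] := tail_pos_of_variance mu_even var.
have [a0 a00 Ha0] := Emu_small_pos mu_even r0 fr s0 ts.
have close e : 0 < e -> exists n0, forall n, (n0 <= n)%N ->
    exists x1 x2 : R, [/\ rho1 mu n delta = x1%:E, rho2 mu n delta = x2%:E & `|x2 - x1| <= e].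
  (* Ten [eps] for the window and one at each end for rounding exponentials to integers. *)
  move=> e0; pose eps := e / 12.
  have eps0 : 0 < eps by rewrite divr_gt0.
  have [a [b [ab [n1 Hn1]]]] := window_exists mu_even adm eps0 d0.
  have [n2 Hn2] := Ha0 delta d0.
  (* Raising both ends to positive rates preserves the two bounds and the width, and ensures
     [expR (a' * n) >= n + 2] for large n. *)
  pose a' := Num.max a a0; pose b' := Num.max b a'.
  have a'0 : 0 < a' by rewrite lt_max a00 orbT.
  have a'b' : a' <= b' by rewrite le_max lexx orbT.
  have b'0 : 0 < b' by exact: lt_le_trans a'b'.
  have ab' : b' - a' <= 10 * eps.
    have aa' : a <= a' by rewrite le_max lexx.
    by rewrite lerBlDr ge_max; apply/andP; split; lra.
  have [n3 Hn3] := exp_beats_linear a'0.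
  have [n4 Hn4] := exp_beats_linear eps0.
  exists (maxn (maxn n1 n2) (maxn n3 n4)) => n.
  rewrite !geq_max => /andP[/andP[nn1 nn2] /andP[nn3 nn4]].
  have small N : N%:R <= expR (a' * n%:R) -> (Emu mu n N <= delta%:E)%E.
    rewrite /a'; have [_|_] := leP a a0; first exact: Hn2.
    by case: (Hn1 n nn1 N).
  have large N : expR (b' * n%:R) <= N%:R -> ((1 - delta)%:E <= Emu mu n N)%E.
    move=> HN; case: (Hn1 n nn1 N) => _; apply; apply: le_trans HN.
    by rewrite ler_expR ler_wpM2r// le_max lexx.
  have ean : n.+2%:R <= expR (a' * n%:R) by exact: Hn3.
  have een : 2 <= expR (eps * n%:R).
    by apply: le_trans (Hn4 n nn4); rewrite ler_nat.
  have ebn : n.+2%:R <= expR (b' * n%:R).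
    by apply: le_trans ean _; rewrite ler_expR ler_wpM2r.
  have dlt : (delta%:E < (1 - delta)%:E)%E by rewrite lte_fin; lra.
  have r1lo : (a'%:E <= rho1 mu n delta)%E.
    apply: ereal_sup_ubound; exists a' => //=.
    by apply: ge_ereal_sup => _ [N [nN HN] <-]; exact: small.
  have r2hi : (rho2 mu n delta <= b'%:E)%E.
    apply: ereal_inf_lbound; exists b' => //=.
    by apply: le_ereal_inf_tmp => _ [N [nN HN] <-]; exact: large.
  (* A rate beyond [b' + eps] admits the integer [N] just above [expR (b' * n)], since
     [expR (eps * n) >= 2] makes room for it; there the expected measure is at least
     [1 - delta > delta]. *)
  have r1hi : (rho1 mu n delta <= (b' + eps)%:E)%E.
    apply: ge_ereal_sup => _ [x Hx <-]; rewrite lee_fin leNgt; apply/negP => bx.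
    pose N := (Num.truncn (expR (b' * n%:R))).+1.
    have /andP[N1 N2] := Num.Theory.truncn_itv (expR_ge0 (b' * n%:R)).
    have HN1 : expR (b' * n%:R) <= N%:R by exact: ltW.
    have HNx : N%:R <= expR (x * n%:R).
      rewrite /N -natr1; apply: (@le_trans _ _ (expR (b' * n%:R) * expR (eps * n%:R))).
        have e1 : 1 <= expR (b' * n%:R) by rewrite -[leLHS]expR0 ler_expR mulr_ge0// ltW.
        have : expR (b' * n%:R) * 2 <= expR (b' * n%:R) * expR (eps * n%:R).
          by rewrite ler_wpM2l ?expR_ge0.
        by lra.
      by rewrite -expRD ler_expR -mulrDl ler_wpM2r// ltW.
    have nN : (n < N)%N.
      by rewrite -(ltr_nat R); apply: lt_le_trans HN1; apply: lt_le_trans ebn; rewrite ltr_nat.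
    have H1 : (Emu mu n N <= delta%:E)%E.
      by apply: le_trans Hx; apply: ereal_sup_ubound; exists N.
    have := le_lt_trans H1 dlt; rewrite ltNge => /negP; apply; exact: large.
  (* Symmetrically, [N] is the integer part of [expR (a' * n)]; it exceeds n and is at least half of
     [expR (a' * n)]. *)
  have r2lo : ((a' - eps)%:E <= rho2 mu n delta)%E.
    apply: le_ereal_inf_tmp => _ [x Hx <-]; rewrite lee_fin leNgt; apply/negP => xa.
    pose N := Num.truncn (expR (a' * n%:R)).
    have /andP[N1 N2] := Num.Theory.truncn_itv (expR_ge0 (a' * n%:R)).
    have HNx : expR (x * n%:R) <= N%:R.
      rewrite -/N -natr1 in N2.
      apply: (@le_trans _ _ (expR (a' * n%:R) - 1)); last by lra.
      have e2 : 2 <= expR (a' * n%:R) by apply: le_trans ean; rewrite ler_nat.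
      have e1 : expR (x * n%:R) * 2 <= expR (a' * n%:R).
        apply: (@le_trans _ _ (expR (x * n%:R) * expR (eps * n%:R))).
          by rewrite ler_wpM2l ?expR_ge0.
        by rewrite -expRD ler_expR -mulrDl ler_wpM2r//; lra.
      by lra.
    have nN : (n < N)%N.
      by rewrite -(ltr_nat R) -(ltrD2r 1) !natr1; apply: le_lt_trans N2; rewrite (le_trans _ ean)// ler_nat.
    have H1 : ((1 - delta)%:E <= Emu mu n N)%E.
      by apply: le_trans Hx _; apply: ereal_inf_lbound; exists N.
    have := lt_le_trans dlt H1; rewrite ltNge => /negP; apply; exact: small.
  move: r1lo r1hi r2lo r2hi.
  case: (rho1 mu n delta) => [x1| |]//; case: (rho2 mu n delta) => [x2| |]//.
  rewrite !lee_fin => h1 h2 h3 h4; exists x1, x2; split => //.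
  by rewrite ler_norml; move: ab'; rewrite /eps in h2 h3 * => ab'; apply/andP; split; lra.
apply/fine_cvgP; split.
  have [n0 H] := close 1 ltr01.
  exists n0 => // n /= nn; have [x1 [x2 [-> -> _]]] := H n nn.
  by rewrite -EFinB.
apply/cvgrPdist_le => e e0; have [n0 H] := close e e0.
exists n0 => // n /= nn; have [x1 [x2 [-> -> h]]] := H n nn.
by rewrite -EFinB /= sub0r normrN.
Qed.
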